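(* Let $M\ge2$ and consider coordinates $(x_1,\dots,x_M,z)$ in $\mathbb{C}^{M+1}$. Let $\mathcal{D}$ be the distribution defined by the equation $dz=\omega$, where $\omega$ is a rational non-closed $1$-form in the variables $(x_1,\dots,x_M)$. Then $\mathcal{D}$ supports a Legendrian polynomial vector field whose generic leaf is dense in $\mathbb{C}^{M+1}$. In particular, if $M=2m$ and $\xi$ is the contact distribution on $\mathbb{CP}^{2m+1}$ defined, in the affine chart $\mathbb{C}^{2m+1}$ with coordinates $(x_1,y_1,\dots,x_m,y_m,z)$, by $$dz=(y_1dx_1-x_1dy_1)+\dots+(y_mdx_m-x_mdy_m),$$ then $\xi$ supports a Legendrian one-dimensional holomorphic foliation whose generic leaf is dense in $\mathbb{CP}^{2m+1}$.
   Context: ''Holomorphic foliation'' means singular holomorphic foliation. A foliation is Legendrian for a distribution $\mathcal{D}$ if its leaves are tangent to $\mathcal{D}$; a vector field (not identically zero) is Legendrian for $\mathcal{D}$ if the one-dimensional foliation it generates is. The distribution $dz=\omega$ is defined off the poles of $\omega$, and tangency is required there. The contact distribution $\xi$ on $\mathbb{CP}^{2m+1}$ is the (unique) holomorphic extension to $\mathbb{CP}^{2m+1}$ of the distribution given by the displayed equation on the affine chart. ''The generic leaf is dense'' means that there is a proper closed analytic subset such that every leaf through a point outside this subset is dense. *)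

(* Defs.v *)
From Stdlib Require Relation_Operators.
From HB Require Import structures.
From mathcomp Require Import all_boot all_order all_algebra.
From mathcomp Require Import generic_quotient fraction.
From mathcomp Require Import all_classical all_reals all_analysis.
From mathcomp Require Import complex ring.
(* mpoly's notations clash with those of MathComp-Analysis *)
From mathcomp Require Import -(notations) mpoly.

Set Implicit Arguments.
Unset Strict Implicit.
Unset Printing Implicit Defensive.

Import Order.TTheory GRing.Theory Num.Theory.
Import numFieldNormedType.Exports.

Local Open Scope ring_scope.
Local Open Scope classical_set_scope.
Local Open Scope quotient_scope.

(* R[i], seen as an abstract numClosedFieldType so that it receives the
   topology of its modulus; the derivatives of MathComp-Analysis over CC R are
   then the complex ones. Below, K always stands for CC R: the definitions only
   use this interface. *)
Definition CC (R : realType) : numClosedFieldType := R[i].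

Definition holomorphic_on (K : numClosedFieldType) (n k : nat)
    (W : set 'rV[K]_n) (f : 'rV[K]_n -> 'rV[K]_k) :=
  forall u, W u -> differentiable f u.

(** * Complex manifolds *)

(* An n-dimensional complex manifold whose charts are parametrisations by the
   whole of C^n. The usual axioms (charts are homeomorphisms onto open sets
   that cover the space, transitions are holomorphic) are not part of the
   record: only the two instances below, C^n and CP^n, are used. *)
Record atlas (K : numClosedFieldType) (n : nat) := Atlas {
  space : topologicalType;
  chart_index : Type;
  chart : chart_index -> 'rV[K]_n -> space }.

(* The change of coordinates from chart i to chart j; only its values on
   chart i @^-1` range (chart j) are meaningful. *)
Definition transition (K : numClosedFieldType) (n : nat) (X : atlas K n)
    (i j : chart_index X) (u : 'rV[K]_n) : 'rV[K]_n :=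
  xget 0 [set w | chart j w = chart i u].

Definition affine_space (K : numClosedFieldType) (n : nat) : atlas K n :=
  @Atlas K n 'rV[K]_n unit (fun _ => id).

Definition nonzero_vectors (K : numClosedFieldType) (n : nat) :
    set 'rV[K]_n.+1 :=
  [set v | v != 0].
Arguments nonzero_vectors : clear implicits.

(* v and w span the same line *)
Definition collinear (K : numClosedFieldType) (n : nat) :
    rel (nonzero_vectors K n) :=
  fun v w => (set_val v == set_val w)%MS.

Lemma collinear_equiv (K : numClosedFieldType) (n : nat) :
  equiv_class_of (@collinear K n).
Proof.
split=> [v|v w|w v x] /=; rewrite /collinear.
- exact/eqmxP.
- by apply/eqmxP/eqmxP => /eqmx_sym.
- by move=> /eqmxP vw /eqmxP wx; apply/eqmxP/(eqmx_trans vw).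
Qed.

Canonical collinear_equivRel (K : numClosedFieldType) (n : nat) :=
  EquivRelPack (@collinear_equiv K n).

Definition CP (K : numClosedFieldType) (n : nat) : topologicalType :=
  quotient_topology {eq_quot @collinear_equivRel K n}.

(* [u_0 : ... : u_(i-1) : 1 : u_i : ... : u_(n-1)] *)
Definition homogenize (K : numClosedFieldType) (n : nat) (i : 'I_n.+1)
    (u : 'rV[K]_n) : 'rV[K]_n.+1 :=
  \row_j (if unlift i j is Some k then u 0 k else 1).

Lemma homogenize_neq0 (K : numClosedFieldType) (n : nat) (i : 'I_n.+1)
  (u : 'rV[K]_n) : homogenize i u \in nonzero_vectors K n.
Proof.
apply/mem_set/eqP => /rowP /(_ i); rewrite !mxE unlift_none.
by move/eqP; rewrite oner_eq0.
Qed.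

Definition CP_chart (K : numClosedFieldType) (n : nat) (i : 'I_n.+1)
    (u : 'rV[K]_n) : CP K n :=
  \pi_(quotient_topology {eq_quot @collinear_equivRel K n})
    (exist _ (homogenize i u) (homogenize_neq0 i u) : nonzero_vectors K n).

Definition projective_space (K : numClosedFieldType) (n : nat) : atlas K n :=
  @Atlas K n (CP K n) 'I_n.+1 (@CP_chart K n).

(* Since every point of the space is tested, such an A is automatically
   closed. *)
Definition analytic_subset (K : numClosedFieldType) (n : nat) (X : atlas K n)
    (A : set (space X)) :=
  forall (i : chart_index X) (u : 'rV[K]_n),
    exists (W : set 'rV[K]_n) (k : nat) (f : 'rV[K]_n -> 'rV[K]_k),
      [/\ open W, W u, holomorphic_on W f &
          forall w, W w -> A (chart i w) <-> f w = 0].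

(** * One-dimensional singular holomorphic foliations *)

(* The data of a foliation: local vector fields, each defined on an open
   subset of the domain of some chart and written in the coordinates of that
   chart. *)
Record foliation (K : numClosedFieldType) (n : nat) (X : atlas K n) :=
  Foliation {
  fol_index : Type;
  fol_chart : fol_index -> chart_index X;
  fol_dom : fol_index -> set 'rV[K]_n;
  fol_field : fol_index -> 'rV[K]_n -> 'rV[K]_n }.

Section Foliations.
Context (K : numClosedFieldType) (n : nat) (X : atlas K n) (F : foliation X).

Definition fol_patch (a : fol_index F) : set (space X) :=
  chart (fol_chart a) @` fol_dom a.

Definition fol_overlap (a b : fol_index F) : set 'rV[K]_n :=
  fol_dom a `&` chart (fol_chart a) @^-1` fol_patch b.

(* The local fields are holomorphic, vanish identically on no nonempty open
   set, and on overlaps agree up to a nowhere vanishing holomorphic factor. The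
   singular set may contain divisors; dividing them out only changes a leaf not
   contained in them by a discrete subset. *)
Definition is_foliation :=
  [/\ forall p, exists a, fol_patch a p,
      forall a : fol_index F,
        open (fol_dom a) /\ holomorphic_on (fol_dom a) (fol_field a),
      forall (a : fol_index F) (W : set 'rV[K]_n),
        open W -> W !=set0 -> W `<=` fol_dom a ->
        exists2 u, W u & fol_field a u != 0 &
      forall a b, let T := transition (fol_chart a) (fol_chart b) in
        exists g : 'rV[K]_n -> K, forall u, fol_overlap a b u ->
          [/\ differentiable g u, g u != 0 &
              fol_field b (T u) = g u *: 'd T u (fol_field a u)]].

Definition fol_sing : set (space X) :=
  [set p | exists (a : fol_index F) u,
     [/\ fol_dom a u, chart (fol_chart a) u = p & fol_field a u = 0]].

(* q lies on a holomorphic disc through p that is an integral curve of one of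
   the local fields. *)
Definition fol_step (p q : space X) :=
  exists (a : fol_index F) (gamma : K -> 'rV[K]_n) (r t : K),
    [/\ forall s, `|s| < r -> fol_dom a (gamma s) /\
          is_derive s (1 : K) gamma (fol_field a (gamma s)),
        `|t| < r,
        chart (fol_chart a) (gamma 0) = p &
        chart (fol_chart a) (gamma t) = q].

(* Leaves are the orbits of the nonsingular points; an integral curve starting
   at a nonsingular point stays off the singular set. *)
Definition is_leaf (L : set (space X)) :=
  exists2 p, ~ fol_sing p &
    L = [set q | Relation_Operators.clos_refl_sym_trans _ fol_step p q].

Definition generic_leaf_dense :=
  exists A : set (space X),
    [/\ closed A, analytic_subset A, A != setT &
        forall L, is_leaf L -> L `\` A !=set0 -> dense L].

(* A distribution is a set D i u of tangent vectors for every chart i and every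
   point u, in the coordinates of that chart. The tangent line of a leaf at a
   nonsingular point is spanned by the local field. Tangency is required on E
   only. *)
Definition legendrian_on (E : set (space X))
    (D : chart_index X -> 'rV[K]_n -> set 'rV[K]_n) :=
  forall (a : fol_index F) u, fol_dom a u -> E (chart (fol_chart a) u) ->
    D (fol_chart a) u (fol_field a u).

End Foliations.

Definition hyperplane_distribution (K : numClosedFieldType) (n : nat)
    (X : atlas K n)
    (D : chart_index X -> 'rV[K]_n -> set 'rV[K]_n) :=
  (forall i j u v, range (chart j) (chart i u) ->
     let T := transition i j in D i u v <-> D j (T u) ('d T u v)) /\
  (forall i u, exists W (alpha : 'rV[K]_n -> 'rV[K]_n),
     [/\ open W, W u, holomorphic_on W alpha &
         forall w, W w -> alpha w != 0 /\
           D i w = [set v | \sum_k alpha w 0 k * v 0 k = 0]]).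

(** * Rational 1-forms *)

Definition ratfun (K : numClosedFieldType) (M : nat) := {fraction (mpoly M K)}.

Definition poly_eval (K : numClosedFieldType) (n : nat) (p : mpoly n K)
    (x : 'rV[K]_n) : K := meval (fun i => x 0 i) p.

(* c = p(x)/q(x) for some representation f = p/q with q(x) <> 0 *)
Definition rat_value (K : numClosedFieldType) (M : nat) (f : ratfun K M)
    (x : 'rV[K]_M) : set K :=
  [set c | exists p q : mpoly M K,
     [/\ f = tofrac p / tofrac q, poly_eval q x != 0 &
         c = poly_eval p x / poly_eval q x]].

Definition rat_eval (K : numClosedFieldType) (M : nat) (f : ratfun K M)
    (x : 'rV[K]_M) : K := xget 0 (rat_value f x).

(* Quotient rule; the choice of the representative is immaterial, see
   rat_derivE. *)
Definition rat_deriv (K : numClosedFieldType) (M : nat) (i : 'I_M)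
    (f : ratfun K M) : ratfun K M :=
  let: (n, d) := frac (repr f) in
  tofrac (mderiv i n * d - n * mderiv i d) / tofrac d ^+ 2.

Lemma frac_repr (D : idomainType) (f : {fraction D}) :
  f = tofrac (frac (repr f)).1 / tofrac (frac (repr f)).2.
Proof.
rewrite -[LHS]reprK; set x := repr f.
unlock tofrac; rewrite -[_^-1]FracField.pi_inv -[RHS]FracField.pi_mul.
congr (\pi _); rewrite /FracField.mulf /FracField.invf.
by rewrite !numden_Ratio ?oner_eq0 ?denom_ratioP// mulr1 mul1r Ratio_numden.
Qed.

Lemma rat_derivE (K : numClosedFieldType) (M : nat) (i : 'I_M)
    (p q : mpoly M K) :
  q != 0 ->
  rat_deriv i (tofrac p / tofrac q) =
  tofrac (mderiv i p * q - p * mderiv i q) / tofrac q ^+ 2.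
Proof.
move=> q0; rewrite /rat_deriv; set f := tofrac p / tofrac q.
have := frac_repr f; have := denom_ratioP (repr f).
case: (frac (repr f)) => n d /= d0 fE.
have tq0 : tofrac q != 0 by rewrite tofrac_eq0.
have td0 : tofrac d != 0 by rewrite tofrac_eq0.
move/eqP: fE; rewrite /f (eqr_div _ _ tq0 td0) -!tofracM tofrac_eq => /eqP e.
have /(congr1 (@mderiv M K i)) := e; rewrite !mderivM => e'.
apply/eqP; rewrite -!tofracXn eqr_div ?tofrac_eq0 ?expf_neq0//.
rewrite -!tofracM tofrac_eq; apply/eqP.
move: (mderiv i p) (mderiv i q) (mderiv i n) (mderiv i d) e e'.
move=> p' q' n' d' e e'.
have -> : (n' * d - n * d') * q ^+ 2 =
    d * q * (n' * q + n * q') - n * q * (d * q' + q * d') by ring.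
rewrite -e -e'; ring.
Qed.

(* omega = \sum_i omega i dx_i *)
Definition rational_form (K : numClosedFieldType) (M : nat) :=
  'I_M -> ratfun K M.

Definition closed_form (K : numClosedFieldType) (M : nat)
    (omega : rational_form K M) :=
  forall i j, rat_deriv i (omega j) = rat_deriv j (omega i).

(* Coordinates (x_1, ..., x_M, z) on C^(M+1): the last one is z. *)
Definition x_part (K : numClosedFieldType) (M : nat)
    (u : 'rV[K]_M.+1) : 'rV[K]_M :=
  \row_i u 0 (widen_ord (leqnSn M) i).

Definition off_poles (K : numClosedFieldType) (M : nat)
    (omega : rational_form K M) : set 'rV[K]_M.+1 :=
  [set u | forall i, rat_value (omega i) (x_part u) !=set0].

Definition graph_distribution (K : numClosedFieldType) (M : nat)
    (omega : rational_form K M) (_ : unit) (u : 'rV[K]_M.+1) :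
    set 'rV[K]_M.+1 :=
  [set v : 'rV[K]_M.+1 | v 0 ord_max =
           \sum_i rat_eval (omega i) (x_part u) * x_part v 0 i].

(* The foliation generated by a polynomial vector field. *)
Definition generated (K : numClosedFieldType) (n : nat)
    (Y : 'I_n -> mpoly n K) : foliation (affine_space K n) :=
  @Foliation K n (affine_space K n) unit id (fun _ => setT)
    (fun _ u => \row_i poly_eval (Y i) u).

(** * The contact distribution of CP^(2m+1) *)

(* In the affine chart ord0, i.e. u |-> [1 : u], the coordinates
   (x_1, y_1, ..., x_m, y_m, z) have indices 0, 1, ..., 2m-2, 2m-1, 2m. *)
Definition is_contact_distribution (K : numClosedFieldType) (m : nat)
    (xi : 'I_m.*2.+2 -> 'rV[K]_m.*2.+1 -> set 'rV[K]_m.*2.+1) :=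
  @hyperplane_distribution K m.*2.+1 (projective_space K m.*2.+1) xi /\
  forall u, xi ord0 u =
    [set v : 'rV[K]_m.*2.+1 | v 0 ord_max =
       \sum_(k < m) (u 0 (inord k.*2.+1) * v 0 (inord k.*2)
                     - u 0 (inord k.*2) * v 0 (inord k.*2.+1))].

Section ProjectiveCharts.
Context (K : numClosedFieldType) (n : nat).
Implicit Types (i j : 'I_n.+1) (u v w : 'rV[K]_n).

Lemma CP_chart_eq i j u w : CP_chart i u = CP_chart j w <->
  exists c, homogenize j w = c *: homogenize i u.
Proof.
rewrite /CP_chart; split.
  move=> /eqmodP /=; rewrite /collinear /= => /andP[_].
  by rewrite !set_valE /= => /sub_rVP[c e]; exists c.
move=> [c e]; apply/eqmodP; rewrite /= /collinear !set_valE /=.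
have c0 : c != 0.
  apply: contraTneq (homogenize_neq0 j w) => c0; rewrite e c0 scale0r.
  by apply/negP => /set_mem; rewrite /nonzero_vectors /= eqxx.
rewrite e; apply/andP; split; apply/sub_rVP; last by exists c.
by exists c^-1; rewrite scalerA mulVf// scale1r.
Qed.

Lemma homogenize_diag i u : homogenize i u 0 i = 1.
Proof. by rewrite mxE unlift_none. Qed.

Lemma homogenize_lift i u k : homogenize i u 0 (lift i k) = u 0 k.
Proof. by rewrite mxE liftK. Qed.

Definition CP_change i j u : 'rV[K]_n :=
  \row_k (homogenize i u 0 (lift j k) * (homogenize i u 0 j)^-1).

Lemma homogenize_CP_change i j u : homogenize i u 0 j != 0 ->
  homogenize j (CP_change i j u) = (homogenize i u 0 j)^-1 *: homogenize i u.
Proof.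
move=> h0; apply/rowP => k; rewrite [in RHS]mxE.
case: (unliftP j k) => [l ->|->]; first by rewrite homogenize_lift mxE mulrC.
by rewrite homogenize_diag mulVf.
Qed.

Lemma range_chart i j u :
  range (CP_chart j) (CP_chart i u) <-> homogenize i u 0 j != 0.
Proof.
split=> [[w _ /esym /CP_chart_eq[c e]]|h0].
  have : homogenize j w 0 j = c * homogenize i u 0 j by rewrite e [LHS]mxE.
  rewrite homogenize_diag => e1.
  by apply: contra_eq_neq e1 => ->; rewrite mulr0 oner_neq0.
exists (CP_change i j u) => //; apply/esym/CP_chart_eq.
by exists (homogenize i u 0 j)^-1; rewrite homogenize_CP_change.
Qed.

Lemma CP_chart_inj i : injective (@CP_chart K n i).
Proof.
move=> u w /CP_chart_eq[c e].
have : homogenize i w 0 i = c * homogenize i u 0 i by rewrite e [LHS]mxE.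
rewrite !homogenize_diag mulr1 => c1; move: e; rewrite -c1 scale1r => e.
apply/rowP => k; have := congr1 (fun x : 'rV_n.+1 => x 0 (lift i k)) e.
by rewrite !homogenize_lift.
Qed.

Lemma transitionE i j u : homogenize i u 0 j != 0 ->
  @transition K n (projective_space K n) i j u = CP_change i j u.
Proof.
move=> h0; rewrite /transition.
have e : CP_chart j (CP_change i j u) = CP_chart i u.
  by apply/esym/CP_chart_eq; exists (homogenize i u 0 j)^-1; rewrite homogenize_CP_change.
apply: (@xget_unique _ _ _ (CP_change i j u)) => //= w /= ew.
by apply: (@CP_chart_inj j); rewrite ew e.
Qed.

Definition dhomogenize i v : 'rV[K]_n.+1 :=
  \row_j (if unlift i j is Some k then v 0 k else 0).

Lemma diff_homogenize i j u :
  differentiable (fun w => homogenize i w 0 j : K) u /\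
  forall v, 'd (fun w => homogenize i w 0 j : K) u v = dhomogenize i v 0 j.
Proof.
case: (unliftP i j) => [k ->|->].
  have -> : (fun w => homogenize i w 0 (lift i k) : K) = (fun w => w 0 k).
    by apply/funext => w; rewrite homogenize_lift.
  split; first exact: differentiable_coord.
  move=> v; rewrite mxE liftK.
  have @f : {linear 'rV[K]_n -> K}.
    by exists (fun N : 'rV[K]_n => N 0 k); do 2![eexists]; do ?[constructor];
     rewrite ?mxE// => ? *; rewrite ?mxE//; move=> ?; rewrite !mxE.
  rewrite (_ : (fun _ => _) = f) // diff_lin//; exact: coord_continuous.
have -> : (fun w => homogenize i w 0 i : K) = cst 1.
  by apply/funext => w; rewrite homogenize_diag.
split; first exact: differentiable_cst.
by move=> v; rewrite diff_cst mxE unlift_none.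
Qed.

Lemma diff_row (f : 'rV[K]_n -> 'rV[K]_n) u :
  (forall k, differentiable (fun w => f w 0 k : K) u) ->
  differentiable f u /\
  forall v k, 'd f u v 0 k = 'd (fun w => f w 0 k : K) u v.
Proof.
move=> df.
have df' : differentiable f u.
  rewrite (_ : f = \sum_k (fun w => f w 0 k *: delta_mx 0 k)).
    by apply: differentiable_sum => k; apply: differentiableZl.
  by apply/funext => w; rewrite fct_sumE -row_sum_delta.
split=> // v k.
have @g : {linear 'rV[K]_n -> K}.
  by exists (fun N : 'rV[K]_n => N 0 k); do 2![eexists]; do ?[constructor];
     rewrite ?mxE// => ? *; rewrite ?mxE//; move=> ?; rewrite !mxE.
have cg : continuous g by exact: coord_continuous.
rewrite (_ : (fun w => f w 0 k) = g \o f)//.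
have e := diff_comp df' (linear_differentiable (f u) cg).
have e' := diff_lin (f u) cg.
by rewrite -[RHS]/(('d (g \o f) u : _ -> _) v) e /= -[RHS]/(('d g (f u) : _ -> _) ('d f u v)) e'.
Qed.

Local Lemma comb_entry (a b : K) (A B : 'rV[K]_n.+1) k :
  (a *: A + b *: B) 0 k = a * A 0 k + b * B 0 k.
Proof. by rewrite !mxE. Qed.

Lemma diff_CP_change i j u : homogenize i u 0 j != 0 ->
  differentiable (CP_change i j) u /\ forall v, exists a,
    dhomogenize j ('d (CP_change i j) u v) =
    a *: homogenize i u + (homogenize i u 0 j)^-1 *: dhomogenize i v.
Proof.
move=> h0; have [dj djE] := diff_homogenize i j u.
have dV := differentiableV dj h0.
have dk k : differentiable (fun w => CP_change i j w 0 k : K) u /\ forall v,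
   'd (fun w => CP_change i j w 0 k : K) u v =
   - (homogenize i u 0 j) ^- 2 * dhomogenize i v 0 j * homogenize i u 0 (lift j k)
   + (homogenize i u 0 j)^-1 * dhomogenize i v 0 (lift j k).
  have [dl dlE] := diff_homogenize i (lift j k) u.
  have -> : (fun w => CP_change i j w 0 k : K) =
    (fun w => homogenize i w 0 (lift j k) : K) *
    (fun w => (homogenize i w 0 j)^-1 : K).
    by apply/funext => w; rewrite mxE.
  split; first exact: differentiableM.
  move=> v.
  have E1 := congr1 (fun h : _ -> _ => h v) (diffM dl dV).
  have E2 := congr1 (fun h : _ -> _ => h v) (diffV dj h0).
  have E2' : 'd (fun w => (homogenize i w 0 j)^-1 : K) u v =
    - (homogenize i u 0 j) ^- 2 * dhomogenize i v 0 j.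
    by rewrite -(djE v); exact: E2.
  suff G : homogenize i u 0 (lift j k) * 'd (fun w => (homogenize i w 0 j)^-1 : K) u v
      + (homogenize i u 0 j)^-1 * 'd (fun w => homogenize i w 0 (lift j k) : K) u v
    = - (homogenize i u 0 j) ^- 2 * dhomogenize i v 0 j * homogenize i u 0 (lift j k)
   + (homogenize i u 0 j)^-1 * dhomogenize i v 0 (lift j k).
    exact: (etrans E1 G).
  rewrite E2'.
  rewrite dlE.
  rewrite [X in X + _ = _]mulrC.
  reflexivity.
have [d dE] := diff_row (fun k => (dk k).1).
split=> // v; exists (- (homogenize i u 0 j) ^- 2 * dhomogenize i v 0 j).
apply/rowP => k; rewrite comb_entry.
case: (unliftP j k) => [l ->|->].
  by rewrite [LHS]mxE liftK dE (dk l).2.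
rewrite [LHS]mxE unlift_none.
move: (homogenize i u 0 j) (dhomogenize i v 0 j) h0 => x y x0.
by field.
Qed.

Lemma near_eq_diff (f g : 'rV[K]_n -> 'rV[K]_n) u :
  (\near u, f u = g u) -> differentiable g u ->
  differentiable f u /\ 'd f u = 'd g u :> (_ -> _).
Proof.
move=> fg dg.
have fgu : f u = g u by apply: nbhs_singleton fg.
have [cg eg] := (diff_locallyP _ _).1 dg.
have fg0 : \forall z \near (0 : 'rV[K]_n), f (z + u) = g (z + u).
  have := fg; rewrite (near_shift (0 : 'rV[K]_n) u).
  by apply: filterS => z /=; rewrite subr0.
have ef : f \o shift u = cst (f u) + 'd g u +o_ (0 : 'rV[K]_n) id.
  apply/eqaddoP => e e0; have /eqaddoP /(_ e e0) := eg.
  by apply: filterS2 fg0 => h /= fgh; rewrite !fctE /= fgh fgu.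
have E : 'd f u = 'd g u :> (_ -> _) by apply: diff_unique.
split; last exact: E.
apply/diff_locallyP; rewrite E.
split; [exact: cg|exact: ef].
Qed.

Lemma diff_transition i j u : homogenize i u 0 j != 0 ->
  let T := @transition K n (projective_space K n) i j in
  differentiable T u /\ 'd T u = 'd (CP_change i j) u :> (_ -> _).
Proof.
move=> h0; apply: near_eq_diff; last exact: (diff_CP_change h0).1.
have c : {for u, continuous (fun w => homogenize i w 0 j : K)}.
  by apply: differentiable_continuous; exact: (diff_homogenize i j u).1.
have : \forall w \near u, homogenize i w 0 j != 0.
  apply: (c [set x | x != 0]); apply: open_nbhs_nbhs; split=> //.
  rewrite (_ : [set x | x != 0] = ~` [set (0 : K)]); last first.
    by apply/seteqP; split=> x /= /eqP.
  apply: closed_openC; apply: accessible_closed_set1.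
  apply: hausdorff_accessible; exact: norm_hausdorff.
by apply: filterS => w /transitionE.
Qed.

End ProjectiveCharts.

(* The contact distribution exists: in homogeneous coordinates it is the kernel
   of Z_0 dZ - Z dZ_0 - \sum_k (Y_k dX_k - X_k dY_k). *)
Section Contact.
Context (K : numClosedFieldType) (m : nat).
Let n := m.*2.+1.
Let lx (k : 'I_m) : 'I_n.+1 := lift ord0 (inord k.*2).
Let ly (k : 'I_m) : 'I_n.+1 := lift ord0 (inord k.*2.+1).
Let lz : 'I_n.+1 := lift ord0 ord_max.
Definition contact_form (Z V : 'rV[K]_n.+1) : K := Z 0 ord0 * V 0 lz - Z 0 lz * V 0 ord0
  - \sum_(k < m) (Z 0 (ly k) * V 0 (lx k) - Z 0 (lx k) * V 0 (ly k)).

Lemma cfN Z V : contact_form Z V = - contact_form V Z.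
Proof.
rewrite /contact_form.
have -> : \sum_(k < m) (Z 0 (ly k) * V 0 (lx k) - Z 0 (lx k) * V 0 (ly k)) =
 - \sum_(k < m) (V 0 (ly k) * Z 0 (lx k) - V 0 (lx k) * Z 0 (ly k)).
  by rewrite -sumrN; apply: eq_bigr => k _; ring.
ring.
Qed.
Lemma cfZZ Z : contact_form Z Z = 0.
Proof.
rewrite /contact_form big1; first by ring.
by move=> k _; ring.
Qed.
Lemma cfl a b Z V W : contact_form Z (a *: V + b *: W) = a * contact_form Z V + b * contact_form Z W.
Proof.
rewrite /contact_form !comb_entry.
under eq_bigr do rewrite !comb_entry.
rewrite !mulrBr !mulr_sumr.
rewrite [X in _ - X](_ : _ = 
 \sum_(k < m) a * (Z 0 (ly k) * V 0 (lx k) - Z 0 (lx k) * V 0 (ly k))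
 + \sum_(k < m) b * (Z 0 (ly k) * W 0 (lx k) - Z 0 (lx k) * W 0 (ly k))).
  ring.
rewrite -big_split /=; apply: eq_bigr => k _; ring.
Qed.
Lemma cflZ a Z V : contact_form Z (a *: V) = a * contact_form Z V.
Proof. by rewrite -[a *: V]addr0 -(scale0r V) cfl mul0r addr0. Qed.
Lemma cfrZ a Z V : contact_form (a *: Z) V = a * contact_form Z V.
Proof. by rewrite cfN cflZ -mulrN -cfN. Qed.

Local Lemma lift_max_inord (k : nat) : (k < m.*2)%N -> (lift ord0 (inord k) : 'I_n.+1) != lz.
Proof.
move=> km; rewrite /lz (inj_eq (@lift_inj _ _)) -val_eqE /= inordK ?ltnS ?(ltnW km)//.
by rewrite ltn_eqF.
Qed.
Local Lemma kx (k : 'I_m) : (k.*2 < m.*2)%N. Proof. by rewrite ltn_double. Qed.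
Local Lemma ky (k : 'I_m) : (k.*2.+1 < m.*2)%N.
Proof. by rewrite -doubleS leq_double. Qed.

Local Lemma lxy (k l : 'I_m) : lx k != ly l.
Proof.
rewrite /lx /ly (inj_eq (@lift_inj _ _)) -val_eqE /= !inordK ?ltnS ?(ltnW (kx _)) ?(ltnW (ky _))//.
apply/eqP => /(congr1 odd); by rewrite /= !odd_double.
Qed.
Local Lemma lx_inj (k l : 'I_m) : (lx k == lx l) = (k == l).
Proof.
rewrite /lx (inj_eq (@lift_inj _ _)) -val_eqE /= !inordK ?ltnS ?(ltnW (kx _))//.
by rewrite (inj_eq double_inj).
Qed.
Local Lemma ly_inj (k l : 'I_m) : (ly k == ly l) = (k == l).
Proof.
rewrite /ly (inj_eq (@lift_inj _ _)) -val_eqE /= !inordK ?ltnS ?(ltnW (ky _))//.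
by rewrite eqSS (inj_eq double_inj).
Qed.

Lemma cf_nondeg Z : (forall V, contact_form Z V = 0) -> Z = 0.
Proof.
move=> H.
have D (i j : 'I_n.+1) : (delta_mx 0 i : 'rV[K]_n.+1) 0 j = (j == i)%:R.
  by rewrite mxE eqxx.
have l0 (i : 'I_n) : (lift ord0 i == ord0) = false by rewrite eq_sym; apply/negbTE/neq_lift.
have xz k : (lx k == lz) = false by apply/negbTE/lift_max_inord/kx.
have yz k : (ly k == lz) = false by apply/negbTE/lift_max_inord/ky.
have Z0 : Z 0 ord0 = 0.
  have := H (delta_mx 0 lz); rewrite /contact_form !D eqxx [ord0 == _]eq_sym l0 big1 => [|k _].
    by rewrite mulr1 mulr0 !subr0.
  by rewrite !D xz yz !mulr0 subr0.
have Zz : Z 0 lz = 0.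
  have := H (delta_mx 0 ord0); rewrite /contact_form !D eqxx l0 big1 => [|k _].
    by rewrite mulr1 mulr0 subr0 sub0r => /eqP; rewrite oppr_eq0 => /eqP.
  by rewrite !D !l0 !mulr0 subr0.
have Zy k : Z 0 (ly k) = 0.
  have := H (delta_mx 0 (lx k)); rewrite /contact_form Z0 Zz !mul0r subr0 sub0r => /eqP.
  rewrite oppr_eq0 (bigD1 k)//= big1 => [|l lk].
    by rewrite !D eqxx [ly _ == _]eq_sym (negbTE (lxy _ _)) mulr1 mulr0 subr0 addr0 => /eqP.
  by rewrite !D lx_inj (negbTE lk) [ly _ == _]eq_sym (negbTE (lxy _ _)) !mulr0 subr0.
have Zx k : Z 0 (lx k) = 0.
  have := H (delta_mx 0 (ly k)); rewrite /contact_form Z0 Zz !mul0r subr0 sub0r => /eqP.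
  rewrite oppr_eq0 (bigD1 k)//= big1 => [|l lk].
    by rewrite !D eqxx (negbTE (lxy _ _)) mulr1 mulr0 sub0r addr0 oppr_eq0 => /eqP.
  by rewrite !D ly_inj (negbTE lk) (negbTE (lxy _ _)) !mulr0 subr0.
apply/rowP => i; rewrite mxE; case: (unliftP ord0 i) => [j ->|->]//.
have := ltn_ord j; rewrite ltnS leq_eqVlt => /orP[/eqP jm|jm].
  by rewrite (_ : j = ord_max)//; apply/val_inj.
have h2 : (j./2 < m)%N by rewrite -ltn_double -[(m.*2)%N]addn0 addn0 (leq_ltn_trans _ jm)// -[leqRHS]odd_double_half leq_addl.
case oj : (odd j).
  rewrite (_ : lift _ _ = ly (Ordinal h2))//; apply/val_inj; rewrite /ly /= inordK.
    by rewrite -[in LHS](odd_double_half j) oj.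
  by rewrite ltnS; apply: ltnW; exact: (ky (Ordinal h2)).
rewrite (_ : lift _ _ = lx (Ordinal h2))//; apply/val_inj; rewrite /lx /= inordK.
  by rewrite -[in LHS](odd_double_half j) oj.
by rewrite ltnS; apply: ltnW; exact: (kx (Ordinal h2)).
Qed.

Definition contact_xi (i : 'I_n.+1) (u : 'rV[K]_n) : set 'rV[K]_n :=
  [set v | contact_form (homogenize i u) (dhomogenize i v) = 0].

Lemma dhomogenize_sum i (v : 'rV[K]_n) (Z : 'rV[K]_n.+1) :
  contact_form Z (dhomogenize i v) = \sum_k contact_form Z (dhomogenize i (delta_mx 0 k)) * v 0 k.
Proof.
have cf0 : contact_form Z 0 = 0 by rewrite -(scale0r 0) cflZ mul0r.
have cfD A B : contact_form Z (A + B) = contact_form Z A + contact_form Z B.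
  by rewrite -[A]scale1r -[B]scale1r cfl !mul1r !scale1r.
have E (I : finType) (f : I -> 'rV[K]_n.+1) : contact_form Z (\sum_k f k) = \sum_k contact_form Z (f k).
  by elim/big_ind2 : _ => // x a y b <- <-.
rewrite (_ : dhomogenize i v = \sum_k v 0 k *: dhomogenize i (delta_mx 0 k)).
  by rewrite E; apply: eq_bigr => k _; rewrite cflZ mulrC.
apply/rowP => j; rewrite summxE mxE; case: (unliftP i j) => [l ->|->].
  rewrite (bigD1 l)//= big1 => [|k kl]; rewrite !mxE liftK !mxE ?eqxx.
    by rewrite mulr1 addr0.
  by rewrite [l == k]eq_sym (negbTE kl) mulr0.
by rewrite big1// => k _; rewrite !mxE unlift_none mulr0.
Qed.

Lemma contact_xiP : @is_contact_distribution K m contact_xi.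
Proof.
split; last first.
  move=> u; apply/seteqP.
  have E v : contact_form (homogenize ord0 u) (dhomogenize ord0 v) =
   v 0 ord_max - \sum_(k < m) (u 0 (inord k.*2.+1) * v 0 (inord k.*2)
                     - u 0 (inord k.*2) * v 0 (inord k.*2.+1)).
    rewrite /contact_form !mxE unlift_none ?liftK mul1r mulr0 subr0.
    by congr (_ - _); apply: eq_bigr => k _; rewrite !mxE !liftK.
  split=> v; rewrite /contact_xi /= E.
    by move/eqP; rewrite subr_eq0 => /eqP.
  by move=> ->; rewrite subrr.
split.
  move=> i j u v /range_chart h0 T.
  have [dT TE] := diff_transition h0; rewrite -/T in dT TE.
  have -> : T u = CP_change i j u by exact: transitionE.
  have [_ /(_ v)[a Ea]] := diff_CP_change h0.
  have E1 : 'd T u v = 'd (CP_change i j) u v := congr1 (fun h : _ -> _ => h v) TE.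
  rewrite E1.
  suff : contact_form (homogenize i u) (dhomogenize i v) = 0 <->
    contact_form (homogenize j (CP_change i j u)) (dhomogenize j ('d (CP_change i j) u v)) = 0 by [].
  rewrite Ea (homogenize_CP_change h0).
  rewrite cfrZ cfl cfZZ mulr0 add0r.
  split=> [->|/eqP]; first by rewrite !mulr0.
  by rewrite mulf_eq0 mulf_eq0 invr_eq0 (negbTE h0) /= => /eqP.
move=> i u.
exists setT, (fun w => \row_k contact_form (homogenize i w) (dhomogenize i (delta_mx 0 k))).
split=> //.
- exact: openT.
- move=> w _.
  have [] // := @diff_row K n (fun w => \row_k contact_form (homogenize i w) (dhomogenize i (delta_mx 0 k))) w.
  move=> k.
  have -> : (fun w0 : 'rV[K]_n => (\row_k0 contact_form (homogenize i w0) (dhomogenize i (delta_mx 0 k0))) 0 k : K)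
    = \sum_j (fun w0 => homogenize i w0 0 j : K) * cst (contact_form (delta_mx 0 j) (dhomogenize i (delta_mx 0 k))).
    apply/funext => w0; rewrite mxE fct_sumE /= cfN {1}(row_sum_delta (homogenize i w0)).
    set Z := dhomogenize i _.
    have cf0 : contact_form Z 0 = 0 by rewrite -(scale0r 0) cflZ mul0r.
    have cfD A B : contact_form Z (A + B) = contact_form Z A + contact_form Z B.
      by rewrite -[A]scale1r -[B]scale1r cfl !mul1r !scale1r.
    have E (I : finType) (f : I -> 'rV[K]_n.+1) : contact_form Z (\sum_k f k) = \sum_k contact_form Z (f k).
      by elim/big_ind2 : _ => // x a y b <- <-.
    rewrite E -sumrN; apply: eq_bigr => j _; rewrite cflZ -mulrN -cfN.
    by [].
  apply: differentiable_sum => j; apply: differentiableM; last exact: differentiable_cst.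
  exact: (diff_homogenize i j w).1.
- move=> w _; split; last first.
    apply/seteqP; split=> v; rewrite /contact_xi /= dhomogenize_sum.
      by move=> e; rewrite -[RHS]e; apply: eq_bigr => k _; rewrite mxE.
    by move=> e; rewrite -[RHS]e; apply: eq_bigr => k _; rewrite mxE.
  apply/eqP => /rowP a0.
  have : homogenize i w = 0.
    apply: cf_nondeg => V.
    have -> : V = V 0 i *: homogenize i w + 1 *: dhomogenize i (\row_k (V 0 (lift i k) - V 0 i * w 0 k)).
      apply/rowP => j; rewrite comb_entry; case: (unliftP i j) => [l ->|->].
        rewrite !mxE !liftK !mxE; ring.
      rewrite !mxE unlift_none; ring.
    rewrite cfl cfZZ mulr0 add0r mul1r dhomogenize_sum big1// => k _.
    by have := a0 k; rewrite !mxE => ->; rewrite mul0r.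
  move=> h; have := homogenize_diag i w; rewrite h mxE => /esym/eqP.
  by rewrite oner_eq0.
Qed.
End Contact.

(* Main.v *)
(* Write omega_i = N_i / Q with a common denominator, and choose a <> b and a
   point eta off the poles where d_b omega_a <> d_a omega_b. In C^M take the
   curves
     x_a = eta_a + t, x_b = eta_b + W_b(t) / t, x_j = eta_j + W_j(t) (j <> a, b),
   where W_i' is a fixed rational function of t, holomorphic at 0, with simple
   poles at four positive integers, different for different i. They are the
   leaves of a polynomial vector field, which is lifted to dz = omega. The
   residues are such that W_i is translated by 1, -sqrt 2, i or -i sqrt 2 along
   loops around its poles; as n - m sqrt 2 (n, m natural numbers) is dense in
   the reals, each leaf is dense in C^M.
   The lift is invariant under translations of z, so that the T for which (u, z)
   and (u, z + T) lie on the same leaf form a group, which only depends on the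
   leaf of u. A small loop around t = 0 is closed in each leaf; it gives a
   period f(w), where w = W(0) is the state of the leaf, and
     f(w) - f(0) = 2 pi i (d_b omega_a - d_a omega_b)(eta) w_b + small error.
   The states of a given leaf are dense, hence the differences of its periods
   approximate all small numbers up to a relative error 1/2, which makes the
   group of periods dense. So the leaf of the lift is dense in C^(M+1).
   On CP^(2m+1) the field is homogenised; at infinity the result is Legendrian by
   continuity.
   No Cauchy theory is needed: holomorphic functions enter through a uniform
   second-order estimate on a convex set, and integrals along segments are limits
   of dyadic trapezoidal sums. *)

Require Import Defs.
From mathcomp Require Import all_boot all_order all_algebra.
From mathcomp Require Import all_classical all_reals all_analysis.
From mathcomp Require Import complex ring lra.
From mathcomp Require Import -(notations) mpoly.

Set Implicit Arguments.
Unset Strict Implicit.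
Unset Printing Implicit Defensive.

Import Order.TTheory GRing.Theory Num.Theory.
Import numFieldNormedType.Exports.

Local Open Scope ring_scope.
Local Open Scope classical_set_scope.

(** The summand W_b / t is what makes the loop around t = 0 feel the form. Changing the state by w
    displaces the loop by w_b / t in the direction b, and by Stokes' formula the integral of omega
    then changes, to first order, by the curvature at eta times the residue of w_b / t. Two
    obstacles shape the rest. A leaf may run into zeros of S * Q, which are singular points of the
    field. Along a curve in t they are isolated, so the leaf can go around them; but winding around
    one may change z. Transport is therefore stated for projected leaves only, and z is recovered at
    the end from the periods. Secondly, the error of the period has a part linear in w_b, which a
    smaller w does not improve. Its constant in the integrand does not depend on the size e of the
    loop, whose length is 8 e. So e is fixed before w and makes this part at most 1/8 of the main
    term; then w is taken small against the remaining error. Finally, the state 0 need not belong to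
    the given leaf, so f(w) is compared with f(w') for a state w' of the leaf close to 0. *)

Section Modulus.
Variable R : realType.
Local Notation K := (CC R).
Implicit Types (x y z : K) (r s : R).

(** The norm of K takes its values in K itself; a modulus with values in R makes the estimates
    accessible to [lra] and [nra]. *)
Definition modulus x : R := complex.Re (`|x| : R[i]).
Definition rc r : K := real_complex R r.
Definition re x : R := complex.Re (x : R[i]).
Definition im x : R := complex.Im (x : R[i]).

Lemma rcD r s : rc (r + s) = rc r + rc s. Proof. exact: (rmorphD (real_complex R)). Qed.
Lemma rcN r : rc (- r) = - rc r. Proof. exact: (rmorphN (real_complex R)). Qed.
Lemma rcB r s : rc (r - s) = rc r - rc s. Proof. by rewrite rcD rcN. Qed.
Lemma rcM r s : rc (r * s) = rc r * rc s. Proof. exact: (rmorphM (real_complex R)). Qed.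
Lemma rc1 : rc 1 = 1. Proof. exact: (rmorph1 (real_complex R)). Qed.
Lemma rc0 : rc 0 = 0. Proof. exact: (rmorph0 (real_complex R)). Qed.
Lemma rc_nat n : rc n%:R = n%:R. Proof. exact: (rmorph_nat (real_complex R)). Qed.
Lemma rcV r : rc r^-1 = (rc r)^-1. Proof. exact: (fmorphV (real_complex R)). Qed.
Lemma rc_eq0 r : (rc r == 0) = (r == 0). Proof. exact: (fmorph_eq0 (real_complex R)). Qed.
Lemma rc_le r s : (rc r <= rc s) = (r <= s). Proof. exact: (lecR r s). Qed.
Lemma rc_lt r s : (rc r < rc s) = (r < s). Proof. exact: (ltcR r s). Qed.

Lemma reD x y : re (x + y) = re x + re y. Proof. by case: x => ? ?; case: y. Qed.
Lemma reN x : re (- x) = - re x. Proof. by case: x. Qed.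
Lemma reB x y : re (x - y) = re x - re y. Proof. by rewrite reD reN. Qed.
Lemma imD x y : im (x + y) = im x + im y. Proof. by case: x => ? ?; case: y. Qed.
Lemma imN x : im (- x) = - im x. Proof. by case: x. Qed.
Lemma imB x y : im (x - y) = im x - im y. Proof. by rewrite imD imN. Qed.
Lemma reM x y : re (x * y) = re x * re y - im x * im y.
Proof. by case: x => ? ?; case: y. Qed.
Lemma imM x y : im (x * y) = re x * im y + im x * re y.
Proof. by case: x => ? ?; case: y. Qed.
Lemma re_rc r : re (rc r) = r. Proof. by []. Qed.
Lemma im_rc r : im (rc r) = 0. Proof. by []. Qed.

Definition ii : K := (Complex 0 1 : R[i]).
Lemma re_ii : re ii = 0. Proof. by []. Qed.
Lemma im_ii : im ii = 1. Proof. by []. Qed.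
Lemma ii2 : ii * ii = -1. Proof. exact: (sqr_i R). Qed.
Lemma reimE x : x = rc (re x) + ii * rc (im x). Proof. exact: complexE. Qed.
Lemma eq_reim x y : re x = re y -> im x = im y -> x = y.
Proof. by move=> e1 e2; rewrite [x]reimE [y]reimE e1 e2. Qed.

Lemma normE x : `|x| = rc (modulus x).
Proof. by rewrite /modulus [`|x|]normc_def. Qed.
Lemma modulusE x : modulus x = Num.sqrt (re x ^+ 2 + im x ^+ 2).
Proof. by rewrite /modulus [`|x|]normc_def. Qed.

Lemma modulus_ge0 x : 0 <= modulus x.
Proof. by rewrite -rc_le rc0 -normE. Qed.
Lemma modulus_sqr x : modulus x ^+ 2 = re x ^+ 2 + im x ^+ 2.
Proof. by rewrite modulusE sqr_sqrtr// addr_ge0// sqr_ge0. Qed.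
Lemma modulusM x y : modulus (x * y) = modulus x * modulus y.
Proof. by apply: (@complexI R); rewrite -[LHS]normE normrM !normE -rcM. Qed.
Lemma modulus0 : modulus 0 = 0.
Proof. by apply: (@complexI R); rewrite -[LHS]normE normr0. Qed.
Lemma modulus1 : modulus 1 = 1.
Proof. by apply: (@complexI R); rewrite -[LHS]normE normr1. Qed.
Lemma modulusV x : modulus x^-1 = (modulus x)^-1.
Proof. by apply: (@complexI R); rewrite -[LHS]normE normfV normE -rcV. Qed.
Lemma modulusX x n : modulus (x ^+ n) = modulus x ^+ n.
Proof. by elim: n => [|n IH]; rewrite ?expr0 ?modulus1// !exprS modulusM IH. Qed.
Lemma modulusN x : modulus (- x) = modulus x.
Proof. by rewrite /modulus normrN. Qed.
Lemma modulusB x y : modulus (x - y) = modulus (y - x).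
Proof. by rewrite /modulus distrC. Qed.
Lemma modulusD x y : modulus (x + y) <= modulus x + modulus y.
Proof. by rewrite -rc_le rcD -!normE ler_normD. Qed.
Lemma modulusBD x y : modulus (x - y) <= modulus x + modulus y.
Proof. by rewrite (le_trans (modulusD _ _))// modulusN. Qed.
Lemma modulus_tri x y z : modulus (x - z) <= modulus (x - y) + modulus (y - z).
Proof. by rewrite (_ : x - z = (x - y) + (y - z)) ?modulusD//; ring. Qed.
Lemma modulus_lb x y : modulus x - modulus y <= modulus (x + y).
Proof. by have := modulusBD (x + y) y; rewrite addrK; lra. Qed.
Lemma modulus_eq0 x : (modulus x == 0) = (x == 0).
Proof. by rewrite -rc_eq0 -normE normr_eq0. Qed.
Lemma modulus_gt0 x : (0 < modulus x) = (x != 0).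
Proof. by rewrite lt_def modulus_eq0 modulus_ge0 andbT. Qed.
Lemma modulus_rc r : modulus (rc r) = `|r|.
Proof. by rewrite modulusE re_rc im_rc expr0n addr0 sqrtr_sqr. Qed.
Lemma modulus_nat n : modulus n%:R = n%:R.
Proof. by rewrite -rc_nat modulus_rc ger0_norm. Qed.
Lemma modulus_ii : modulus ii = 1.
Proof. by rewrite modulusE re_ii im_ii expr0n add0r expr1n sqrtr1. Qed.
Lemma re_le x : `|re x| <= modulus x.
Proof. by rewrite modulusE -sqrtr_sqr ler_wsqrtr// lerDl sqr_ge0. Qed.
Lemma im_le x : `|im x| <= modulus x.
Proof. by rewrite modulusE -sqrtr_sqr ler_wsqrtr// lerDr sqr_ge0. Qed.
Lemma modulus_reim x : modulus x <= `|re x| + `|im x|.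
Proof.
rewrite {1}[x]reimE (le_trans (modulusD _ _))// modulusM modulus_ii mul1r.
by rewrite !modulus_rc.
Qed.
Lemma modulus_sum (I : Type) (s : seq I) (P : pred I) (F : I -> K) :
  modulus (\sum_(i <- s | P i) F i) <= \sum_(i <- s | P i) modulus (F i).
Proof.
elim/big_ind2 : _ => [|a b c d h1 h2|//]; first by rewrite modulus0.
by apply: le_trans (modulusD _ _) _; exact: lerD.
Qed.
Lemma modulus_small0 x : (forall e, 0 < e -> modulus x <= e) -> x = 0.
Proof.
move=> h; apply/eqP; rewrite -modulus_eq0 eq_le modulus_ge0 andbT.
by apply/ler_addgt0Pr => e e0; rewrite add0r h.
Qed.

Lemma half_pow_small (C e : R) : 0 < e -> exists n : nat, C / 2 ^+ n <= e.
Proof.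
move=> e0; have [n Cn] : exists n : nat, C / e < n%:R.
  exists (Num.bound `|C / e|); apply: le_lt_trans (ler_norm _) _.
  exact: archi_boundP.
exists n; rewrite ler_pdivrMr ?exprn_gt0// -ler_pdivrMl// mulrC.
apply: (le_trans (ltW Cn)); rewrite -natrX ler_nat.
by rewrite ltnW// ltn_expl.
Qed.

(** The intervals of radius 2 C / 2 ^ n around u n are nested; the limit is the supremum of their
    left ends. *)
Lemma real_geometric_cauchy (u : nat -> R) (C : R) :
  (forall n, `|u n.+1 - u n| <= C / 2 ^+ n) ->
  exists l, forall n, `|u n - l| <= 2 * C / 2 ^+ n.
Proof.
move=> H.
have C0 : 0 <= C by have := H 0; rewrite expr0 divr1; apply: le_trans.
have p2 n : 0 < (2 ^+ n : R) by rewrite exprn_gt0.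
have hS n : 2 * C / 2 ^+ n.+1 = C / 2 ^+ n.
  by rewrite exprS invfM; field; rewrite ?gt_eqF.
have hS2 n : 2 * C / 2 ^+ n = C / 2 ^+ n + C / 2 ^+ n by ring.
pose a n := u n - 2 * C / 2 ^+ n; pose b n := u n + 2 * C / 2 ^+ n.
have aS n : a n <= a n.+1.
  by rewrite /a hS hS2; have := H n; rewrite ler_norml; lra.
have bS n : b n.+1 <= b n.
  by rewrite /b hS hS2; have := H n; rewrite ler_norml; lra.
have aM m n : (m <= n)%N -> a m <= a n.
  by move=> /subnK <-; elim: (n - m)%N => // k IH; rewrite addSn (le_trans IH).
have bM m n : (m <= n)%N -> b n <= b m.
  by move=> /subnK <-; elim: (n - m)%N => // k IH; rewrite addSn (le_trans _ IH).
have ab m n : a m <= b n.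
  have abk k : a k <= b k.
    have : 0 <= C / 2 ^+ k by apply: divr_ge0 => //; exact: ltW.
    by rewrite /a /b hS2; lra.
  by case: (leqP m n) => [/aM h|/ltnW/bM h];
    [exact: le_trans h (abk n)|exact: le_trans (abk m) h].
pose A := [set x | exists n, x = a n].
have supA : has_sup A.
  by split; [exists (a 0), 0|exists (b 0) => _ [n ->]].
exists (sup A) => n; rewrite ler_norml.
have h1 : a n <= sup A by apply: ub_le_sup; [exact: supA.2|exists n].
have h2 : sup A <= b n by apply: ge_sup => [|_ [m ->]//]; exact: supA.1.
by move: h1 h2; rewrite /a /b; lra.
Qed.

Lemma geometric_cauchy (u : nat -> K) (C : R) :
  (forall n, modulus (u n.+1 - u n) <= C / 2 ^+ n) ->
  exists l, forall n, modulus (u n - l) <= 4 * C / 2 ^+ n.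
Proof.
move=> H.
have [a Ha] : exists l, forall n, `|re (u n) - l| <= 2 * C / 2 ^+ n.
  apply: real_geometric_cauchy => n; rewrite -reB.
  by apply: le_trans (H n); exact: re_le.
have [b Hb] : exists l, forall n, `|im (u n) - l| <= 2 * C / 2 ^+ n.
  apply: real_geometric_cauchy => n; rewrite -imB.
  by apply: le_trans (H n); exact: im_le.
exists (rc a + ii * rc b) => n; apply: le_trans (modulus_reim _) _.
rewrite reB imB reD imD reM imM re_ii im_ii !re_rc !im_rc.
have := Ha n; have := Hb n.
rewrite !(mul0r, mul1r, mulr0, mulr1, addr0, add0r, subr0).
have -> : 4 * C / 2 ^+ n = 2 * C / 2 ^+ n + 2 * C / 2 ^+ n by ring.
lra.
Qed.

(** Keeps an L-Lipschitz function away from 0 near a point where its value x is nonzero. The [+ 1]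
    covers L = 0. *)
Lemma half_modulus_le x y (L c : R) : 0 <= L -> 0 <= c ->
  c <= modulus x / (2 * (L + 1)) -> modulus (y - x) <= L * c -> modulus x / 2 <= modulus y.
Proof.
move=> L0 c0; have L1 : 0 < 2 * (L + 1) by lra.
rewrite ler_pdivlMr// => cx yx.
have := modulus_lb x (y - x); rewrite addrCA subrr addr0; lra.
Qed.

End Modulus.
Arguments ii {R}.

(** * Integration along segments *)

Section QuadraticDifferentiability.
Variable R : realType.
Local Notation K := (CC R).
Variables (T : Type) (dist : T -> T -> R).
Hypothesis dist_ge0 : forall x y, 0 <= dist x y.
Implicit Types (E : T -> Prop) (F G : T -> K) (DF DG : T -> T -> K).

(* DF x y stands for the derivative of F at x, applied to the increment from x
   to y. *)
Definition qdiff E F DF := exists2 C, 0 <= C & forall x y, E x -> E y ->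
  [/\ modulus (F x) <= C, modulus (DF x y) <= C * dist x y &
      modulus (F y - F x - DF x y) <= C * dist x y ^+ 2].

Lemma qdiff_bounded E F DF : qdiff E F DF ->
  exists2 C, 0 <= C & forall x, E x -> modulus (F x) <= C.
Proof. by move=> [C C0 H]; exists C => // x Ex; have [] := H x x Ex Ex. Qed.

(** At distance at most 1 the quadratic remainder is absorbed by the linear bound; at a larger
    distance the bound of F itself suffices. *)
Lemma qdiff_lip E F DF : qdiff E F DF ->
  exists2 C, 0 <= C & forall x y, E x -> E y -> modulus (F y - F x) <= C * dist x y.
Proof.
move=> [C C0 H]; exists (2 * C); first by rewrite mulr_ge0.
move=> x y Ex Ey; have [h1 h2 h3] := H x y Ex Ey; have [h4 _ _] := H y y Ey Ey.
have d0 := dist_ge0 x y; have [d1|d1] := leP (dist x y) 1.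
  have : modulus (F y - F x) <= modulus (F y - F x - DF x y) + modulus (DF x y).
    by rewrite -{1}[F y - F x](subrK (DF x y)) modulusD.
  have : C * dist x y ^+ 2 <= C * dist x y.
    by rewrite ler_wpM2l// expr2 ler_piMr.
  lra.
have := modulusBD (F y) (F x).
have : C <= C * dist x y by rewrite ler_peMr// ltW.
lra.
Qed.

Lemma qdiffW E E' F DF : (forall x, E' x -> E x) -> qdiff E F DF -> qdiff E' F DF.
Proof. by move=> s [C C0 H]; exists C => // x y /s Ex /s Ey; exact: H. Qed.

Lemma qdiff_ext E F DF G DG : qdiff E F DF -> (forall x, E x -> F x = G x) ->
  (forall x y, E x -> E y -> DF x y = DG x y) -> qdiff E G DG.
Proof.
move=> [C C0 H] e1 e2; exists C => // x y Ex Ey.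
by rewrite -!e1// -e2//; exact: H.
Qed.

Lemma qdiff_cst E (c : K) : qdiff E (fun=> c) (fun _ _ => 0).
Proof.
exists (modulus c) => [|x y _ _]; first exact: modulus_ge0.
by rewrite subrr subr0 modulus0 !mulr_ge0 ?exprn_ge0 ?modulus_ge0.
Qed.

Lemma qdiffD E F DF G DG : qdiff E F DF -> qdiff E G DG ->
  qdiff E (fun x => F x + G x) (fun x y => DF x y + DG x y).
Proof.
move=> [C C0 H] [C' C'0 H']; exists (C + C') => [|x y Ex Ey]; first exact: addr_ge0.
have [h1 h2 h3] := H x y Ex Ey; have [h1' h2' h3'] := H' x y Ex Ey.
rewrite !mulrDl; split.
- by have := modulusD (F x) (G x); lra.
- by have := modulusD (DF x y) (DG x y); lra.
- rewrite (_ : _ - _ = (F y - F x - DF x y) + (G y - G x - DG x y)); last by ring.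
  by apply: le_trans (modulusD _ _) _; lra.
Qed.

(** The remainder of a product is F times that of G, plus G times that of F, plus the product of
    both increments, which is quadratic because F and G are Lipschitz. *)
Lemma qdiffM E F DF G DG : qdiff E F DF -> qdiff E G DG ->
  qdiff E (fun x => F x * G x) (fun x y => F x * DG x y + G x * DF x y).
Proof.
move=> FH GH; have [L L0 HL] := qdiff_lip FH; have [L' L'0 HL'] := qdiff_lip GH.
move: FH GH => [C C0 H] [C' C'0 H'].
exists (2 * C * C' + L * L') => [|x y Ex Ey]; first by rewrite addr_ge0 ?mulr_ge0.
have [h1 h2 h3] := H x y Ex Ey; have [h1' h2' h3'] := H' x y Ex Ey.
have := HL x y Ex Ey; have := HL' x y Ex Ey; move: (dist_ge0 x y).
move: (dist x y) h2 h3 h2' h3' => d h2 h3 h2' h3' d0 l' l.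
have prod a b (p q : R) : modulus a <= p -> modulus b <= q ->
    modulus (a * b) <= p * q.
  by move=> *; rewrite modulusM ler_pM ?modulus_ge0.
have LL : 0 <= L * L' by rewrite mulr_ge0.
have CC0 : 0 <= C * C' by rewrite mulr_ge0.
split.
- by have := prod _ _ _ _ h1 h1'; lra.
- apply: le_trans (modulusD _ _) _.
  have := prod _ _ _ _ h1 h2'; have := prod _ _ _ _ h1' h2.
  have : 0 <= L * L' * d by rewrite mulr_ge0.
  by move=> *; lra.
- rewrite (_ : _ - _ = F x * (G y - G x - DG x y) + G x * (F y - F x - DF x y)
     + (F y - F x) * (G y - G x)); last by ring.
  apply: le_trans (modulusD _ _) _.
  have := modulusD (F x * (G y - G x - DG x y)) (G x * (F y - F x - DF x y)).
  have := prod _ _ _ _ h1 h3'; have := prod _ _ _ _ h1' h3.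
  by have := prod _ _ _ _ l l'; move=> *; lra.
Qed.

Lemma qdiff_sum (I : eqType) (s : seq I) E (F : I -> T -> K) (DF : I -> T -> T -> K) :
  (forall i, i \in s -> qdiff E (F i) (DF i)) ->
  qdiff E (fun x => \sum_(i <- s) F i x) (fun x y => \sum_(i <- s) DF i x y).
Proof.
elim: s => [_|i s IH H].
  apply: (qdiff_ext (@qdiff_cst E 0)) => [x _|x y _ _]; by rewrite big_nil.
apply: (qdiff_ext (qdiffD (H i _) (IH _))).
- by rewrite mem_head.
- by move=> j js; apply: H; rewrite inE js orbT.
- by move=> x _; rewrite big_cons.
- by move=> x y _ _; rewrite big_cons.
Qed.

Lemma qdiffV E F DF (c : R) : qdiff E F DF ->
  0 < c -> (forall x, E x -> c <= modulus (F x)) ->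
  qdiff E (fun x => (F x)^-1) (fun x y => - DF x y / F x ^+ 2).
Proof.
move=> FH c0 Fc; have [L L0 HL] := qdiff_lip FH.
move: FH => [C C0 H].
have F0 x : E x -> F x != 0.
  by move=> Ex; rewrite -modulus_gt0; exact: lt_le_trans (Fc x Ex).
have Vb x : E x -> modulus (F x)^-1 <= c^-1.
  by move=> Ex; rewrite modulusV lef_pV2 ?posrE// ?Fc// modulus_gt0 F0.
have V2b x : E x -> modulus ((F x)^-1 * (F x)^-1) <= c^-1 * c^-1.
  by move=> Ex; rewrite modulusM ler_pM ?modulus_ge0// Vb.
have cV : 0 <= c^-1 by rewrite invr_ge0 ltW.
have c2V : 0 <= c^-1 * c^-1 by rewrite mulr_ge0.
exists (c^-1 + C * (c^-1 * c^-1) + (C * C + C * L) * (c^-1 * c^-1 * c^-1)) => [|x y Ex Ey].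
  by rewrite !addr_ge0 ?mulr_ge0// addr_ge0 ?mulr_ge0.
have [h1 h2 h3] := H x y Ex Ey; have h4 := HL x y Ex Ey.
have d0 := dist_ge0 x y; have d2 : 0 <= dist x y ^+ 2 by rewrite sqr_ge0.
set A := C * (c^-1 * c^-1).
have A0 : 0 <= A by rewrite mulr_ge0.
set B := (C * C + C * L) * (c^-1 * c^-1 * c^-1).
have B0 : 0 <= B by rewrite mulr_ge0 ?addr_ge0 ?mulr_ge0.
have Fx0 := F0 _ Ex; have Fy0 := F0 _ Ey.
split.
- by have := Vb x Ex; lra.
- have -> : - DF x y / F x ^+ 2 = - DF x y * ((F x)^-1 * (F x)^-1) by field.
  rewrite modulusM modulusN.
  have : modulus (DF x y) * modulus ((F x)^-1 * (F x)^-1) <= C * dist x y * (c^-1 * c^-1).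
    by rewrite ler_pM ?modulus_ge0// V2b.
  rewrite (_ : C * dist x y * (c^-1 * c^-1) = A * dist x y); last by rewrite /A; ring.
  have : 0 <= c^-1 * dist x y by rewrite mulr_ge0.
  have : 0 <= B * dist x y by rewrite mulr_ge0.
  lra.
- have -> : (F y)^-1 - (F x)^-1 - - DF x y / F x ^+ 2 =
     ((F x)^-1 * (F x)^-1 * (F y)^-1) *
     (DF x y * (F y - F x) - F x * (F y - F x - DF x y)) by field; rewrite Fx0 Fy0.
  have e1 : modulus ((F x)^-1 * (F x)^-1 * (F y)^-1) <= c^-1 * c^-1 * c^-1.
    by rewrite modulusM ler_pM ?modulus_ge0// ?V2b ?Vb.
  have e2 : modulus (DF x y * (F y - F x) - F x * (F y - F x - DF x y)) <=
      (C * C + C * L) * dist x y ^+ 2.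
    apply: le_trans (modulusBD _ _) _; rewrite !modulusM.
    have := ler_pM (modulus_ge0 _) (modulus_ge0 _) h2 h4.
    have := ler_pM (modulus_ge0 _) (modulus_ge0 _) h1 h3.
    by move: (dist x y) => d *; lra.
  rewrite modulusM; have := ler_pM (modulus_ge0 _) (modulus_ge0 _) e1 e2.
  have -> : c^-1 * c^-1 * c^-1 * ((C * C + C * L) * dist x y ^+ 2) =
     B * dist x y ^+ 2 by rewrite /B; ring.
  have : 0 <= c^-1 * dist x y ^+ 2 by rewrite mulr_ge0.
  have : 0 <= A * dist x y ^+ 2 by rewrite mulr_ge0.
  lra.
Qed.

End QuadraticDifferentiability.

Section OneVariable.
Variable R : realType.
Local Notation K := (CC R).
Implicit Types (x y z : K) (E : K -> Prop) (h g : K -> K).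

Definition cdist x y : R := modulus (y - x).
Lemma cdist_ge0 x y : 0 <= cdist x y. Proof. exact: modulus_ge0. Qed.

Definition hol E h h' := qdiff cdist E h (fun x y => h' x * (y - x)).

Definition bounded E := exists B : R, forall x, E x -> modulus x <= B.
Definition convex E := forall x y (t : R), 0 <= t <= 1 -> E x -> E y ->
  E (x + rc t * (y - x)).

Lemma holW E E' h h' : (forall x, E' x -> E x) -> hol E h h' -> hol E' h h'.
Proof. exact: qdiffW. Qed.

Lemma hol_ext E h h' g g' : hol E h h' -> (forall x, E x -> h x = g x) ->
  (forall x, E x -> h' x = g' x) -> hol E g g'.
Proof. by move=> H e e'; apply: (qdiff_ext H) => // x y Ex _; rewrite e'. Qed.

Lemma hol_cst E (c : K) : hol E (fun=> c) (fun=> 0).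
Proof.
by apply: (qdiff_ext (qdiff_cst cdist_ge0 E c)) => // x y _ _; rewrite mul0r.
Qed.

Lemma hol_id E : bounded E -> hol E id (fun=> 1).
Proof.
move=> [B HB]; exists (`|B| + 1) => [|x y Ex Ey]; first by rewrite addr_ge0.
have := HB x Ex; have := ler_norm B; have := cdist_ge0 x y.
have := sqr_ge0 (cdist x y); rewrite /cdist => *; split.
- by lra.
- by rewrite mul1r ler_peMl ?modulus_ge0// lerDr.
- by rewrite mul1r subrr modulus0 mulr_ge0.
Qed.

Lemma holD E h h' g g' : hol E h h' -> hol E g g' ->
  hol E (fun x => h x + g x) (fun x => h' x + g' x).
Proof.
move=> H G; apply: (qdiff_ext (qdiffD H G)) => // x y _ _; ring.
Qed.

Lemma holM E h h' g g' : hol E h h' -> hol E g g' ->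
  hol E (fun x => h x * g x) (fun x => h x * g' x + g x * h' x).
Proof.
move=> H G; apply: (qdiff_ext (qdiffM cdist_ge0 H G)) => // x y _ _; ring.
Qed.

Lemma holZ E (c : K) g g' : hol E g g' ->
  hol E (fun x => c * g x) (fun x => c * g' x).
Proof.
move=> G; apply: (hol_ext (holM (hol_cst E c) G)) => // x _; ring.
Qed.

Lemma holN E g g' : hol E g g' -> hol E (fun x => - g x) (fun x => - g' x).
Proof.
move=> G; apply: (hol_ext (holZ (-1) G)) => x _; ring.
Qed.

Lemma hol_sum (I : eqType) (s : seq I) E (h h' : I -> K -> K) :
  (forall i, i \in s -> hol E (h i) (h' i)) ->
  hol E (fun x => \sum_(i <- s) h i x) (fun x => \sum_(i <- s) h' i x).
Proof.
move=> H; apply: (qdiff_ext (qdiff_sum cdist_ge0 H)) => // x y _ _.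
by rewrite mulr_suml.
Qed.

Lemma holV E h h' (c : R) : hol E h h' -> 0 < c ->
  (forall x, E x -> c <= modulus (h x)) ->
  hol E (fun x => (h x)^-1) (fun x => - h' x / h x ^+ 2).
Proof.
move=> H c0 hc; apply: (qdiff_ext (qdiffV cdist_ge0 H c0 hc)) => // x y Ex _.
by field; rewrite -modulus_gt0; exact: lt_le_trans (hc x Ex).
Qed.

Lemma hol_shift E E' (a : K) h h' : (forall x, E' x -> E (x - a)) -> hol E h h' ->
  hol E' (fun x => h (x - a)) (fun x => h' (x - a)).
Proof.
move=> s [C C0 H]; exists C => // x y /s Ex /s Ey; have := H _ _ Ex Ey.
by rewrite /cdist (_ : y - a - (x - a) = y - x)//; ring.
Qed.

(** The trapezoidal rule with 2 ^ n equal panels; the recursion on halves makes additivity at the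
    midpoint immediate. *)
Fixpoint trapezoid n h x y : K :=
  if n is m.+1 then
    trapezoid m h x ((x + y) / 2) + trapezoid m h ((x + y) / 2) y
  else (h x + h y) / 2 * (y - x).

Lemma trapezoidS n h x y : trapezoid n.+1 h x y =
  trapezoid n h x ((x + y) / 2) + trapezoid n h ((x + y) / 2) y.
Proof. by []. Qed.

(** Convergence is required with a geometric rate, which gives uniqueness of the limit and lets
    rates be added. *)
Definition is_prim h x y l := exists C : R,
  forall n, modulus (trapezoid n h x y - l) <= C / 2 ^+ n.

Definition prim h x y : K := xget 0 [set l | is_prim h x y l].

Lemma is_prim_uniq h x y l l' : is_prim h x y l -> is_prim h x y l' -> l = l'.
Proof.
move=> [C H] [C' H']; apply/eqP; rewrite -subr_eq0; apply/eqP.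
apply: modulus_small0 => e e0; have [n hn] := half_pow_small (C + C') e0.
apply: le_trans hn; rewrite mulrDl.
have := modulus_tri l (trapezoid n h x y) l'.
by rewrite [modulus (l - trapezoid _ _ _ _)]modulusB; have := H n; have := H' n; lra.
Qed.

Lemma primP h x y l : is_prim h x y l -> prim h x y = l.
Proof.
move=> H; apply: (is_prim_uniq _ H); exact: (@xgetI _ _ _ l).
Qed.

Lemma midE x y : (x + y) / 2 = x + rc 2^-1 * (y - x).
Proof. by rewrite rcV rc_nat; field. Qed.
Lemma mid_subl x y : (x + y) / 2 - x = (y - x) / 2.
Proof. by field. Qed.
Lemma mid_subr x y : y - (x + y) / 2 = (y - x) / 2.
Proof. by field. Qed.
Lemma modulus_half x : modulus (x / 2) = modulus x / 2.
Proof. by rewrite modulusM modulusV modulus_nat. Qed.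

Lemma convex_mid E x y : convex E -> E x -> E y -> E ((x + y) / 2).
Proof. by move=> c Ex Ey; rewrite midE; apply: c => //; apply/andP; split; lra. Qed.

Lemma trapezoid_anti n h x y : trapezoid n h y x = - trapezoid n h x y.
Proof.
elim: n x y => [|n IH] x y /=; first by ring.
by rewrite [y + x]addrC (IH _ y) (IH x); ring.
Qed.

Lemma trapezoid_bound n E h g B x y : convex E -> E x -> E y ->
  (forall z, E z -> modulus (h z - g z) <= B) ->
  modulus (trapezoid n h x y - trapezoid n g x y) <= B * modulus (y - x).
Proof.
move=> cE; elim: n x y => [|n IH] x y Ex Ey H /=.
  rewrite -mulrBl modulusM ler_wpM2r ?modulus_ge0//.
  rewrite (_ : _ - _ = ((h x - g x) + (h y - g y)) / 2); last by ring.
  rewrite modulus_half; have := modulusD (h x - g x) (h y - g y).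
  by have := H x Ex; have := H y Ey; lra.
have Em := convex_mid cE Ex Ey.
rewrite (_ : _ - _ = (trapezoid n h x ((x + y) / 2) - trapezoid n g x ((x + y) / 2))
 + (trapezoid n h ((x + y) / 2) y - trapezoid n g ((x + y) / 2) y)); last by ring.
apply: le_trans (modulusD _ _) _.
have := IH _ _ Ex Em H; have := IH _ _ Em Ey H.
by rewrite mid_subl mid_subr modulus_half; lra.
Qed.

Section Primitive.
Variables (E : K -> Prop) (h h' : K -> K).
Hypothesis cE : convex E.
Hypothesis hE : hol E h h'.

(** The rule is exact on affine functions, so halving a single panel of length d changes it by O(d ^
    3), the remainder of h being O(d ^ 2). *)
Lemma trapezoid_step : exists2 C, 0 <= C & forall n x y, E x -> E y ->
  modulus (trapezoid n.+1 h x y - trapezoid n h x y) <= C * modulus (y - x) ^+ 3 / 2 ^+ n.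
Proof.
have [C C0 H] := hE; exists C => // n x y Ex Ey.
(* Passing to the two halves divides the cubic bound by 8 and doubles the number of terms: the
   induction gives 4 ^ n, weakened to the 2 ^ n that [geometric_cauchy] expects. *)
suff le1 : modulus (trapezoid n.+1 h x y - trapezoid n h x y)
    <= C * modulus (y - x) ^+ 3 / 4 ^+ n.
  apply: le_trans le1 _; rewrite ler_wpM2l ?mulr_ge0 ?exprn_ge0 ?modulus_ge0//.
  by rewrite lef_pV2 ?posrE ?exprn_gt0// lerXn2r ?nnegrE//; lra.
elim: n x y Ex Ey => [|n IH] x y Ex Ey; have Em := convex_mid cE Ex Ey; last first.
  rewrite (trapezoidS n.+1 h x y) (trapezoidS n h x y).
  set a := trapezoid n.+1 h x _; set b := trapezoid n.+1 h _ y.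
  set c := trapezoid n h x _; set d := trapezoid n h _ y.
  rewrite (_ : _ - _ = (a - c) + (b - d)); last by ring.
  apply: le_trans (modulusD _ _) _.
  have := IH _ _ Ex Em; have := IH _ _ Em Ey; rewrite -/a -/b -/c -/d.
  rewrite mid_subl mid_subr modulus_half expr_div_n.
  have -> : C * modulus (y - x) ^+ 3 / 4 ^+ n.+1 =
    C * (modulus (y - x) ^+ 3 / 2 ^+ 3) / 4 ^+ n +
    C * (modulus (y - x) ^+ 3 / 2 ^+ 3) / 4 ^+ n.
    by rewrite [4 ^+ n.+1]exprS; field; rewrite expf_neq0.
  lra.
rewrite /= expr0 divr1; set m := (x + y) / 2.
have [_ _ h1] := H x m Ex Em; have [_ _ h2] := H x y Ex Ey.
have -> : (h x + h m) / 2 * (m - x) + (h m + h y) / 2 * (y - m) -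
   (h x + h y) / 2 * (y - x) = (y - x) / 4 *
   ((h m - h x - h' x * (m - x)) + (h m - h x - h' x * (m - x)) -
    (h y - h x - h' x * (y - x))).
  by rewrite /m; field.
rewrite !modulusM modulusV modulus_nat.
move: h1 h2; rewrite /cdist [modulus (m - x)](_ : _ = modulus (y - x) / 2); last first.
  by rewrite /m mid_subl modulus_half.
set A := h m - _ - _; set B := h y - _ - _; set d := modulus (y - x) => h1 h2.
have d0 : 0 <= d by exact: modulus_ge0.
have h3 : modulus (A + A - B) <= 2 * C * d ^+ 2.
  have := modulusBD (A + A) B; have := modulusD A A; move: h1; rewrite expr_div_n.
  by have := mulr_ge0 C0 (sqr_ge0 d); lra.
have : d / 4 * modulus (A + A - B) <= d / 4 * (2 * C * d ^+ 2).
  by rewrite ler_wpM2l// divr_ge0.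
have : 0 <= C * d ^+ 3 by rewrite mulr_ge0 ?exprn_ge0.
have -> : d / 4 * (2 * C * d ^+ 2) = 2^-1 * (C * d ^+ 3).
  by field.
lra.
Qed.

Lemma prim_approx : exists2 C, 0 <= C & forall x y, E x -> E y ->
  is_prim h x y (prim h x y) /\
  modulus ((h x + h y) / 2 * (y - x) - prim h x y) <= C * modulus (y - x) ^+ 3.
Proof.
have [C C0 H] := trapezoid_step; exists (4 * C) => [|x y Ex Ey]; first exact: mulr_ge0.
have [l Hl] := geometric_cauchy (fun n => H n x y Ex Ey).
have pl : is_prim h x y l by exists (4 * (C * modulus (y - x) ^+ 3)).
rewrite (primP pl); split=> //.
by have := Hl 0; rewrite /= expr0 divr1 mulrA.
Qed.

Lemma is_prim_succ f x y l (C : R) :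
  (forall n, modulus (trapezoid n.+1 f x y - l) <= C / 2 ^+ n) -> is_prim f x y l.
Proof.
move=> H; exists (2 * C + modulus (trapezoid 0 f x y - l)) => n.
have C0 : 0 <= C.
  by have := H 0; rewrite expr0 divr1; apply: le_trans; exact: modulus_ge0.
have m0 := modulus_ge0 (trapezoid 0 f x y - l).
case: n => [|n]; first by rewrite expr0 divr1; lra.
apply: le_trans (H n) _; rewrite exprS invfM mulrA ler_wpM2r ?invr_ge0 ?exprn_ge0//.
by rewrite ler_pdivlMr//; lra.
Qed.

Lemma prim_mid x y : E x -> E y ->
  prim h x y = prim h x ((x + y) / 2) + prim h ((x + y) / 2) y.
Proof.
move=> Ex Ey; have Em := convex_mid cE Ex Ey; apply: primP.
have [C _ H] := prim_approx.
have [[[a Ha] _] [[b Hb] _]] := (H _ _ Ex Em, H _ _ Em Ey).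
apply: (@is_prim_succ _ _ _ _ (a + b)) => n /=.
set m := (x + y) / 2 in Ha Hb *.
rewrite (_ : _ - _ = (trapezoid n h x m - prim h x m) + (trapezoid n h m y - prim h m y)).
  by apply: le_trans (modulusD _ _) _; have := Ha n; have := Hb n; lra.
by ring.
Qed.

Lemma prim_anti x y : E x -> E y -> prim h y x = - prim h x y.
Proof.
move=> Ex Ey; apply: primP; have [C _ H] := prim_approx.
have [[a Ha] _] := H _ _ Ex Ey; exists a => n.
by rewrite trapezoid_anti -opprD modulusN.
Qed.

(** On an affine function the trapezoidal values of the three sides cancel exactly; what is left is
    two quadratic remainders multiplied by side lengths, and three trapezoidal errors, all cubic in
    d. *)
Lemma prim_triangle : exists2 C, 0 <= C & forall x y z d, E x -> E y -> E z ->
  modulus (y - x) <= d -> modulus (z - y) <= d -> modulus (x - z) <= d ->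
  modulus (prim h x y + prim h y z + prim h z x) <= C * d ^+ 3.
Proof.
have [C C0 H] := hE; have [C' C'0 H'] := prim_approx.
exists (2 * C + 3 * C') => [|x y z d Ex Ey Ez d1 d2 d3].
  by rewrite addr_ge0// mulr_ge0.
have [[[_ h1] [_ h2]] [_ h3]] := (H' _ _ Ex Ey, H' _ _ Ey Ez, H' _ _ Ez Ex).
have [_ _ k1] := H _ _ Ex Ey; have [_ _ k2] := H _ _ Ex Ez.
have d0 : 0 <= d by exact: le_trans (modulus_ge0 _) d1.
have cube t : modulus t <= d -> modulus t ^+ 3 <= d ^+ 3.
  by move=> td; rewrite lerXn2r ?nnegrE ?modulus_ge0.
have sqr t : modulus t <= d -> modulus t ^+ 2 <= d ^+ 2.
  by move=> td; rewrite lerXn2r ?nnegrE ?modulus_ge0.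
have {}h1 : modulus ((h x + h y) / 2 * (y - x) - prim h x y) <= C' * d ^+ 3.
  by apply: le_trans h1 _; rewrite ler_wpM2l ?cube.
have {}h2 : modulus ((h y + h z) / 2 * (z - y) - prim h y z) <= C' * d ^+ 3.
  by apply: le_trans h2 _; rewrite ler_wpM2l ?cube.
have {}h3 : modulus ((h z + h x) / 2 * (x - z) - prim h z x) <= C' * d ^+ 3.
  by apply: le_trans h3 _; rewrite ler_wpM2l ?cube.
move: k1 k2; rewrite /cdist [modulus (z - x)]modulusB.
set A := h y - h x - _; set B := h z - h x - _ => k1 k2.
have {}k1 : modulus A <= C * d ^+ 2 by apply: le_trans k1 _; rewrite ler_wpM2l ?sqr.
have {}k2 : modulus B <= C * d ^+ 2 by apply: le_trans k2 _; rewrite ler_wpM2l ?sqr.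
set p := prim h x y in h1 *; set q := prim h y z in h2 *; set r := prim h z x in h3 *.
have -> : p + q + r = (A * (z - x) / 2 + B * (x - y) / 2) -
   (((h x + h y) / 2 * (y - x) - p) + ((h y + h z) / 2 * (z - y) - q) +
    ((h z + h x) / 2 * (x - z) - r)).
  by rewrite /A /B; field.
apply: le_trans (modulusBD _ _) _.
have e1 : modulus (A * (z - x) / 2) <= C * d ^+ 3 / 2.
  rewrite modulus_half modulusM ler_pM2r// exprSr mulrA ler_pM ?modulus_ge0//.
  by rewrite modulusB.
have e2 : modulus (B * (x - y) / 2) <= C * d ^+ 3 / 2.
  rewrite modulus_half modulusM ler_pM2r// exprSr mulrA ler_pM ?modulus_ge0//.
  by rewrite modulusB.
have e3 := modulusD (A * (z - x) / 2) (B * (x - y) / 2).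
set u := _ - p in h1 *; set v := _ - q in h2 *; set w := _ - r in h3 *.
have e4 := modulusD (u + v) w; have e5 := modulusD u v.
have : 0 <= C * d ^+ 3 by rewrite mulr_ge0 ?exprn_ge0.
lra.
Qed.

(* A triangle splits into four of half the size, while the defect of additivity
   on a triangle of size d is O(d^3). *)
Lemma prim_add x y z : E x -> E y -> E z -> prim h x y + prim h y z = prim h x z.
Proof.
have [C C0 H] := prim_triangle => Ex Ey Ez.
suff tri0 : prim h x y + prim h y z + prim h z x = 0.
  by apply/eqP; rewrite -subr_eq0 -prim_anti// tri0.
(* At each level there are four times as many triangles, each with an eighth of the cubic bound;
   hence the factor 1/2. *)
have {}H n a b c d : E a -> E b -> E c -> modulus (b - a) <= d ->
    modulus (c - b) <= d -> modulus (a - c) <= d ->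
    modulus (prim h a b + prim h b c + prim h c a) <= C * d ^+ 3 / 2 ^+ n.
  elim: n a b c d => [|n IH] a b c d Ea Eb Ec ab bc ca.
    by rewrite expr0 divr1; exact: H.
  have Em := convex_mid cE Ea Eb; have En := convex_mid cE Eb Ec.
  have Ep := convex_mid cE Ec Ea.
  have two0 : (2 : K) != 0 by rewrite pnatr_eq0.
  rewrite (prim_mid Ea Eb) (prim_mid Eb Ec) (prim_mid Ec Ea).
  set m := (a + b) / 2 in Em *; set u := (b + c) / 2 in En *; set p := (c + a) / 2 in Ep *.
  have -> : prim h a m + prim h m b + (prim h b u + prim h u c) + (prim h c p + prim h p a) =
    (prim h a m + prim h m p + prim h p a) + (prim h m b + prim h b u + prim h u m) +
    (prim h p u + prim h u c + prim h c p) + (prim h m u + prim h u p + prim h p m).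
    by rewrite (prim_anti Em Ep) (prim_anti Em En) (prim_anti Ep En); ring.
  have hd t t' : t' = t / 2 -> modulus t <= d -> modulus t' <= d / 2.
    by move=> -> td; rewrite modulus_half ler_pM2r.
  have hB s t : modulus (s - t) <= d -> modulus (t - s) <= d by rewrite modulusB.
  have k1 := IH a m p (d / 2) Ea Em Ep.
  have k2 := IH m b u (d / 2) Em Eb En.
  have k3 := IH p u c (d / 2) Ep En Ec.
  have k4 := IH m u p (d / 2) Em En Ep.
  have {}k1 := k1 (hd (b - a) (m - a) ltac:(rewrite /m; by field) ab)
     (hd (c - b) (p - m) ltac:(rewrite /m /p; by field) bc)
     (hd (a - c) (a - p) ltac:(rewrite /p; by field) ca).
  have {}k2 := k2 (hd (b - a) (b - m) ltac:(rewrite /m; by field) ab)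
     (hd (c - b) (u - b) ltac:(rewrite /u; by field) bc)
     (hd (a - c) (m - u) ltac:(rewrite /m /u; by field) ca).
  have {}k3 := k3 (hd (b - a) (u - p) ltac:(rewrite /u /p; by field) ab)
     (hd (c - b) (c - u) ltac:(rewrite /u; by field) bc)
     (hd (a - c) (p - c) ltac:(rewrite /p; by field) ca).
  have {}k4 := k4 (hd (c - a) (u - m) ltac:(rewrite /u /m; by field) (hB _ _ ca))
     (hd (a - b) (p - u) ltac:(rewrite /u /p; by field) (hB _ _ ab))
     (hd (b - c) (m - p) ltac:(rewrite /m /p; by field) (hB _ _ bc)).
  have e : C * (d / 2) ^+ 3 / 2 ^+ n = C * d ^+ 3 / 2 ^+ n.+1 / 4.
    by rewrite [2 ^+ n.+1]exprS; field; rewrite expf_neq0.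
  move: k1 k2 k3 k4; rewrite e.
  set A := _ + prim h p a; set B := _ + prim h u m; set D := _ + prim h c p.
  set F := _ + prim h p m => k1 k2 k3 k4.
  have := modulusD (A + B + D) F; have := modulusD (A + B) D; have := modulusD A B.
  lra.
apply: modulus_small0 => e e0.
set d := modulus (y - x) + modulus (z - y) + modulus (x - z).
have [n hn] := half_pow_small (C * d ^+ 3) e0; apply: le_trans hn.
have [[a0 b0] c0] := (modulus_ge0 (y - x), modulus_ge0 (z - y), modulus_ge0 (x - z)).
by apply: H => //; rewrite /d; lra.
Qed.

Lemma prim_refl x : E x -> prim h x x = 0.
Proof.
by move=> Ex; have /eqP := prim_add Ex Ex Ex; rewrite -subr_eq0 addrK => /eqP.
Qed.

(** By additivity only short increments matter, and there the trapezoidal approximation and the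
    Lipschitz bound of h give a quadratic error. Boundedness of E turns the cubic error into a
    quadratic one. *)
Lemma hol_prim x0 : bounded E -> E x0 -> hol E (prim h x0) h.
Proof.
move=> [B HB] E0; have [C C0 H] := prim_approx.
have [D D0 HD] := qdiff_bounded hE; have [L L0 HL] := qdiff_lip cdist_ge0 hE.
have B0 : 0 <= B by apply: le_trans (modulus_ge0 _) (HB _ E0).
have dB x y : E x -> E y -> modulus (y - x) <= 2 * B.
  by move=> /HB xB /HB yB; have := modulusBD y x; lra.
pose L' := L / 2 + C * (2 * B).
have L'0 : 0 <= L' by rewrite addr_ge0 ?mulr_ge0// invr_ge0.
have hloc x y : E x -> E y ->
    modulus (prim h x y - h x * (y - x)) <= L' * modulus (y - x) ^+ 2.
  move=> Ex Ey; have [_ h1] := H x y Ex Ey; have := HL x y Ex Ey; rewrite /cdist.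
  move: (dB x y Ex Ey) (modulus_ge0 (y - x)).
  rewrite (_ : prim h x y - _ = (h y - h x) * (y - x) / 2 -
     ((h x + h y) / 2 * (y - x) - prim h x y)); last by field.
  move: h1; set u := _ - prim h x y; set d := modulus (y - x) => h1 dB' d0 lip.
  apply: le_trans (modulusBD _ _) _; rewrite modulus_half modulusM -/d.
  have : modulus (h y - h x) * d <= L * d * d by rewrite ler_wpM2r.
  have : C * d ^+ 3 <= C * (2 * B) * d ^+ 2.
    by rewrite exprS -mulrA ler_wpM2l// ler_wpM2r ?sqr_ge0.
  by rewrite /L'; lra.
exists (D * (2 * B) + L' * (2 * B) ^+ 2 + D + L') => [|x y Ex Ey].
  by rewrite !addr_ge0 ?mulr_ge0 ?sqr_ge0.
have DB0 : 0 <= D * (2 * B) by rewrite !mulr_ge0.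
have LB0 : 0 <= L' * (2 * B) ^+ 2 by rewrite mulr_ge0 ?sqr_ge0.
have d0 := cdist_ge0 x y; have d2 := sqr_ge0 (cdist x y).
split.
- have := hloc _ _ E0 Ex; have xB := dB _ _ E0 Ex.
  have : L' * modulus (x - x0) ^+ 2 <= L' * (2 * B) ^+ 2.
    by rewrite ler_wpM2l// lerXn2r ?nnegrE ?modulus_ge0// (le_trans (modulus_ge0 _) xB).
  have : modulus (h x0 * (x - x0)) <= D * (2 * B).
    by rewrite modulusM ler_pM ?modulus_ge0// HD.
  have := modulusD (prim h x0 x - h x0 * (x - x0)) (h x0 * (x - x0)).
  rewrite subrK; lra.
- rewrite modulusM -/(cdist x y).
  have : modulus (h x) * cdist x y <= D * cdist x y by rewrite ler_wpM2r// HD.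
  have := mulr_ge0 DB0 d0; have := mulr_ge0 LB0 d0; have := mulr_ge0 L'0 d0.
  by move=> *; lra.
- rewrite -(prim_add E0 Ex Ey) (_ : _ + _ - _ - _ = prim h x y - h x * (y - x)); last by ring.
  apply: le_trans (hloc _ _ Ex Ey) _; rewrite -/(cdist x y).
  have := mulr_ge0 DB0 d2; have := mulr_ge0 LB0 d2; have := mulr_ge0 D0 d2.
  by move=> *; lra.
Qed.

End Primitive.

Lemma prim_le E h h' g g' B x y : convex E -> E x -> E y -> hol E h h' -> hol E g g' ->
  (forall z, E z -> modulus (h z - g z) <= B) ->
  modulus (prim h x y - prim g x y) <= B * modulus (y - x).
Proof.
move=> cE Ex Ey hE gE H.
have [_ _ /(_ _ _ Ex Ey)[[a Ha] _]] := prim_approx cE hE.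
have [_ _ /(_ _ _ Ex Ey)[[b Hb] _]] := prim_approx cE gE.
apply/ler_addgt0Pr => e e0; have [n hn] := half_pow_small (a + b) e0.
have := trapezoid_bound n cE Ex Ey H.
set p := prim h x y in Ha *; set q := prim g x y in Hb *.
have := Ha n; have := Hb n; rewrite modulusB.
move: hn; rewrite mulrDl; set u := trapezoid n h x y; set v := trapezoid n g x y => *.
rewrite (_ : p - q = (p - u) + (u - v) + (v - q)); last by ring.
have := modulusD (p - u + (u - v)) (v - q); have := modulusD (p - u) (u - v).
rewrite [modulus (p - u)]modulusB [modulus (v - q)]modulusB; lra.
Qed.

(** With zero derivative the increment is quadratic in the distance, so each bisection of the
    segment halves the bound. *)
Lemma hol_eq0_const E g : convex E -> hol E g (fun=> 0) ->
  forall x y, E x -> E y -> g x = g y.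
Proof.
move=> cE [C C0 H] x y Ex Ey; apply/eqP; rewrite -subr_eq0; apply/eqP.
have {}H n a b : E a -> E b -> modulus (g a - g b) <= C * modulus (b - a) ^+ 2 / 2 ^+ n.
  elim: n a b => [|n IH] a b Ea Eb.
    have [_ _] := H a b Ea Eb; rewrite mul0r subr0 expr0 divr1 /cdist.
    by rewrite [modulus (g b - _)]modulusB.
  have Em := convex_mid cE Ea Eb; have := modulus_tri (g a) (g ((a + b) / 2)) (g b).
  have := IH _ _ Ea Em; have := IH _ _ Em Eb.
  rewrite mid_subl mid_subr modulus_half expr_div_n.
  have -> : C * (modulus (b - a) ^+ 2 / 2 ^+ 2) / 2 ^+ n =
     C * modulus (b - a) ^+ 2 / 2 ^+ n.+1 / 2.
    by rewrite [2 ^+ n.+1]exprS; field; rewrite expf_neq0.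
  lra.
apply: modulus_small0 => e e0.
have [n hn] := half_pow_small (C * modulus (y - x) ^+ 2) e0.
exact: le_trans (H n _ _ Ex Ey) hn.
Qed.

Lemma hol_same_deriv E f g h : convex E -> hol E f h -> hol E g h ->
  forall x y, E x -> E y -> f y - f x = g y - g x.
Proof.
move=> cE fE gE x y Ex Ey.
have H : hol E (fun x => f x - g x) (fun=> 0).
  by apply: (hol_ext (holD fE (holN gE))) => // z _; rewrite subrr.
have /eqP := hol_eq0_const cE H Ex Ey; rewrite -subr_eq0 => /eqP e.
apply/eqP; rewrite -subr_eq0 -oppr_eq0; apply/eqP; rewrite -[RHS]e; ring.
Qed.

Lemma prim_ftc E f h h' x y : convex E -> bounded E -> hol E f h -> hol E h h' ->
  E x -> E y -> prim h x y = f y - f x.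
Proof.
move=> cE bE fE hE Ex Ey; rewrite (hol_same_deriv cE fE (hol_prim cE hE bE Ex) Ex Ey).
by rewrite (prim_refl cE hE Ex) subr0.
Qed.

(** The mean value inequality: the increment of f is the integral of h, compared with the integral
    of 0 by [prim_le]. *)
Lemma hol_mvi E f h h' B x y : convex E -> bounded E -> hol E f h ->
  hol E h h' -> E x -> E y -> (forall z, E z -> modulus (h z) <= B) ->
  modulus (f y - f x) <= B * modulus (y - x).
Proof.
move=> cE bE fE hE Ex Ey H.
have := prim_le cE Ex Ey hE (hol_cst E 0) (B := B).
rewrite (prim_ftc cE bE fE hE Ex Ey).
rewrite (prim_ftc cE bE (hol_cst E 0) (hol_cst E 0) Ex Ey) subrr subr0; apply=> z Ez.
by rewrite subr0; exact: H.
Qed.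

End OneVariable.

(** * Polynomials in several variables *)

Section MpolyGenerators.
Variables (K : comNzRingType) (n : nat).
Implicit Types p q : mpoly n K.

Definition mvar i : mpoly n K := mpolyX K (mnm1 i).

Lemma mpoly_gen_ind (P : mpoly n K -> Prop) :
  (forall c, P (mpolyC n c)) -> (forall i, P (mvar i)) ->
  (forall p q, P p -> P q -> P (p + q)) ->
  (forall p q, P p -> P q -> P (p * q)) -> forall p, P p.
Proof.
move=> Pc Px Pa Pm p; rewrite [p]mpolyE.
have P0 : P 0 by rewrite -[0]mpolyC0; exact: Pc.
have P1 : P 1 by exact: (Pc 1).
have PX m : P (mpolyX K m).
  rewrite mpolyXE_id; elim/big_ind : _ => // i _.
  by elim: (m i) => [|k IH]; rewrite ?expr0// exprS; exact: Pm (Px i) IH.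
elim/big_ind : _ => // m _; rewrite -mul_mpolyC; exact: Pm.
Qed.
End MpolyGenerators.

Section PolyEval.
Variables (K : numClosedFieldType) (n : nat).
Implicit Types (p q : mpoly n K) (u : 'rV[K]_n).
Lemma poly_evalD p q u : poly_eval (p + q) u = poly_eval p u + poly_eval q u.
Proof. by rewrite /poly_eval mevalD. Qed.
Lemma poly_evalB p q u : poly_eval (p - q) u = poly_eval p u - poly_eval q u.
Proof. by rewrite /poly_eval mevalB. Qed.
Lemma poly_evalM p q u : poly_eval (p * q) u = poly_eval p u * poly_eval q u.
Proof. by rewrite /poly_eval mevalM. Qed.
Lemma poly_eval0 u : poly_eval 0 u = 0.
Proof. by rewrite /poly_eval meval0. Qed.
Lemma poly_eval1 u : poly_eval 1 u = 1.
Proof. by rewrite /poly_eval meval1. Qed.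
Lemma poly_evalC c u : poly_eval (mpolyC n c) u = c.
Proof. by rewrite /poly_eval mevalC. Qed.
Lemma poly_eval_var i u : poly_eval (mvar K i) u = u 0 i.
Proof. by rewrite /poly_eval mevalXU. Qed.
Lemma poly_eval_sum (I : Type) (s : seq I) (P : pred I) (p : I -> mpoly n K) u :
  poly_eval (\sum_(i <- s | P i) p i) u = \sum_(i <- s | P i) poly_eval (p i) u.
Proof. by apply: (big_morph (fun p => poly_eval p u)) => [x y|]; rewrite ?poly_evalD ?poly_eval0. Qed.
Lemma poly_eval_prod (I : Type) (s : seq I) (P : pred I) (p : I -> mpoly n K) u :
  poly_eval (\prod_(i <- s | P i) p i) u = \prod_(i <- s | P i) poly_eval (p i) u.
Proof. by apply: (big_morph (fun p => poly_eval p u)) => [x y|]; rewrite ?poly_evalM ?poly_eval1. Qed.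
Lemma mderiv_var i j : mderiv i (mvar K j) = (j == i)%:R :> mpoly n K.
Proof.
rewrite /mvar mderivX mnm1E; case: eqP => [->|_]; last by rewrite scale0r.
rewrite scale1r (_ : mnm_sub _ _ = mnm0) ?mpolyX0//.
by apply/mnmP => k; rewrite mnmBE mnm0E subnn.
Qed.
End PolyEval.

Section SeveralVariables.
Variables (R : realType) (M : nat).
Local Notation K := (CC R).
Implicit Types (u v w : 'rV[K]_M) (E : 'rV[K]_M -> Prop) (F : 'rV[K]_M -> K)
  (G : 'I_M -> 'rV[K]_M -> K) (p q : mpoly M K).

Definition vdist u v : R := \sum_i modulus (v 0 i - u 0 i).

Lemma vdist_ge0 u v : 0 <= vdist u v.
Proof. by apply: sumr_ge0 => i _; exact: modulus_ge0. Qed.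

Lemma vdist_coord u v i : modulus (v 0 i - u 0 i) <= vdist u v.
Proof.
rewrite /vdist (bigD1 i)//= lerDl sumr_ge0// => j _; exact: modulus_ge0.
Qed.

(** The partial derivatives are bounded separately, since [qdiff] only controls their combinations
    with increments between points of E. *)
Definition mhol E F G :=
  qdiff vdist E F (fun u v => \sum_i G i u * (v 0 i - u 0 i)) /\
  exists2 C, 0 <= C & forall i u, E u -> modulus (G i u) <= C.

Definition vbounded E := exists B : R, forall u i, E u -> modulus (u 0 i) <= B.

Lemma mhol_ext E F G F' G' : mhol E F G -> (forall u, E u -> F u = F' u) ->
  (forall i u, E u -> G i u = G' i u) -> mhol E F' G'.
Proof.
move=> [h [C C0 b]] e e'; split.
  by apply: (qdiff_ext h) => // u v Eu _; apply: eq_bigr => i _; rewrite e'.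
by exists C => // i u Eu; rewrite -e'//; exact: b.
Qed.

Lemma mholM E F G F' G' : mhol E F G -> mhol E F' G' ->
  mhol E (fun u => F u * F' u) (fun i u => F u * G' i u + F' u * G i u).
Proof.
move=> [h [C C0 b]] [h' [C' C'0 b']].
have [D D0 HD] := qdiff_bounded h; have [D' D'0 HD'] := qdiff_bounded h'.
split.
  apply: (qdiff_ext (qdiffM vdist_ge0 h h')) => // u v _ _.
  by rewrite !mulr_sumr -big_split; apply: eq_bigr => i _ /=; ring.
exists (D * C' + D' * C) => [|i u Eu]; first by rewrite addr_ge0 ?mulr_ge0.
apply: le_trans (modulusD _ _) _; rewrite !modulusM.
by apply: lerD; apply: ler_pM; rewrite ?modulus_ge0 ?HD ?HD' ?b ?b'.
Qed.

Lemma mholV E F G (c : R) : mhol E F G -> 0 < c ->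
  (forall u, E u -> c <= modulus (F u)) ->
  mhol E (fun u => (F u)^-1) (fun i u => - G i u / F u ^+ 2).
Proof.
move=> [h [C C0 b]] c0 hc; split.
  apply: (qdiff_ext (qdiffV vdist_ge0 h c0 hc)) => // u v _ _.
  by rewrite -sumrN mulr_suml; apply: eq_bigr => i _ /=; ring.
exists (C * (c^-1 ^+ 2)) => [|i u Eu].
  by rewrite mulr_ge0// exprn_ge0// invr_ge0 ltW.
rewrite modulusM modulusN modulusV modulusX -exprVn.
apply: ler_pM; rewrite ?modulus_ge0 ?exprn_ge0 ?invr_ge0 ?modulus_ge0 ?b//.
have Fu := hc u Eu; have F0 := lt_le_trans c0 Fu.
have Vc : (modulus (F u))^-1 <= c^-1 by rewrite lef_pV2 ?posrE.
by rewrite lerXn2r ?nnegrE ?invr_ge0 ?modulus_ge0 ?(ltW c0).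
Qed.

Lemma mhol_poly E p : vbounded E ->
  mhol E (poly_eval p) (fun i => poly_eval (mderiv i p)).
Proof.
move=> [B HB]; elim/mpoly_gen_ind : p => [c|j|p q hp hq|p q hp hq].
- split.
    apply: (qdiff_ext (qdiff_cst vdist_ge0 E c)) => [u _|u v _ _].
      by rewrite poly_evalC.
    by rewrite big1// => i _; rewrite mderivC poly_eval0 mul0r.
  by exists 0 => // i u _; rewrite mderivC poly_eval0 modulus0.
- split.
    exists (`|B| + 1) => [|u v Eu Ev]; first by rewrite addr_ge0.
    have := HB u j Eu; have := ler_norm B; have := vdist_coord u v j.
    have := vdist_ge0 u v; have := sqr_ge0 (vdist u v).
    rewrite !poly_eval_var (bigD1 j)//= big1 => [|i ij]; last first.
      by rewrite mderiv_var eq_sym (negbTE ij) poly_eval0 mul0r.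
    rewrite mderiv_var eqxx poly_eval1 mul1r addr0 => *; split.
    + by lra.
    + by have : 0 <= `|B| * vdist u v; [rewrite mulr_ge0|lra].
    + by rewrite subrr modulus0 mulr_ge0// addr_ge0.
  exists 1 => // i u _; rewrite mderiv_var; case: eqP => _.
    by rewrite poly_eval1 modulus1.
  by rewrite poly_eval0 modulus0.
- move: hp hq => [hp [C C0 bp]] [hq [C' C'0 bq]]; split.
    apply: (qdiff_ext (qdiffD hp hq)) => [u _|u v _ _]; first by rewrite poly_evalD.
    by rewrite -big_split; apply: eq_bigr => i _ /=; rewrite mderivD poly_evalD mulrDl.
  exists (C + C') => [|i u Eu]; first exact: addr_ge0.
  rewrite mderivD poly_evalD (le_trans (modulusD _ _))// lerD ?bp ?bq//.
- apply: (mhol_ext (mholM hp hq)) => [u _|i u _]; first by rewrite poly_evalM.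
  by rewrite mderivM poly_evalD !poly_evalM addrC; congr (_ + _); rewrite mulrC.
Qed.

Lemma hol_comp E F G (E' : K -> Prop) (phi phi' : K -> 'rV[K]_M) : mhol E F G ->
  (forall x, E' x -> E (phi x)) ->
  (forall i, hol E' (fun x => phi x 0 i) (fun x => phi' x 0 i)) ->
  hol E' (fun x => F (phi x)) (fun x => \sum_i G i (phi x) * phi' x 0 i).
Proof.
move=> [[C C0 h] [C' C'0 b]] s hphi.
have [L L0 lip] : exists2 L, 0 <= L & forall x y, E' x -> E' y ->
    vdist (phi x) (phi y) <= L * modulus (y - x) /\
    forall i, modulus (phi y 0 i - phi x 0 i - phi' x 0 i * (y - x)) <=
      L * modulus (y - x) ^+ 2 /\ modulus (phi' x 0 i * (y - x)) <= L * modulus (y - x).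
  have /choice[D HD] : forall i, exists D, 0 <= D /\ forall x y, E' x -> E' y ->
      [/\ modulus (phi y 0 i - phi x 0 i) <= D * modulus (y - x),
      modulus (phi y 0 i - phi x 0 i - phi' x 0 i * (y - x)) <= D * modulus (y - x) ^+ 2
      & modulus (phi' x 0 i * (y - x)) <= D * modulus (y - x)].
    move=> i; have [L L0 H] := qdiff_lip (@cdist_ge0 R) (hphi i).
    have [D D0 H'] := hphi i; exists (L + D); split; first exact: addr_ge0.
    move=> x y Ex Ey; have := H x y Ex Ey; have [_ h2 h1] := H' x y Ex Ey.
    move: h1 h2; rewrite /cdist; have d0 := modulus_ge0 (y - x).
    have := mulr_ge0 L0 d0; have := mulr_ge0 D0 d0; have := mulr_ge0 L0 (sqr_ge0 (modulus (y - x))).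
    by move=> *; split; lra.
  exists (\sum_i D i) => [|x y Ex Ey]; first by apply: sumr_ge0 => i _; have [] := HD i.
  split.
    rewrite mulr_suml; apply: ler_sum => i _.
    by have [_ /(_ x y Ex Ey)[]] := HD i.
  move=> i; have [D0 /(_ x y Ex Ey)[_ hD hD']] := HD i.
  have D1 : D i <= \sum_i D i.
    by rewrite (bigD1 i)//= lerDl sumr_ge0// => j _; have [] := HD j.
  split; [apply: le_trans hD _|apply: le_trans hD' _].
    by rewrite ler_wpM2r// sqr_ge0.
  by rewrite ler_wpM2r// modulus_ge0.
exists (C + M%:R * C' * L + C * L ^+ 2 + M%:R * C' * L) => [|x y Ex Ey].
  by rewrite !addr_ge0 ?mulr_ge0 ?sqr_ge0.
have [h1 h2 h3] := h _ _ (s _ Ex) (s _ Ey).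
have [l1 l2] := lip _ _ Ex Ey.
have d0 := modulus_ge0 (y - x).
have MCL : 0 <= M%:R * C' * L by rewrite !mulr_ge0.
have CL : 0 <= C * L ^+ 2 by rewrite !mulr_ge0 ?sqr_ge0.
rewrite /cdist; split.
- by lra.
- rewrite mulr_suml; apply: le_trans (modulus_sum _ _ _) _.
  have : \sum_(i < M) modulus (G i (phi x) * phi' x 0 i * (y - x)) <=
     \sum_(i < M) C' * (L * modulus (y - x)).
    apply: ler_sum => i _; rewrite -mulrA modulusM.
    apply: ler_pM; rewrite ?modulus_ge0//; last by have [] := l2 i.
    exact: b (s _ Ex).
  rewrite sumr_const card_ord -[X in _ <= X]mulr_natl.
  have := mulr_ge0 C0 d0; have := mulr_ge0 MCL d0; have := mulr_ge0 CL d0.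
  by move=> *; lra.
- set A := \sum_(i < M) G i (phi x) * (phi y 0 i - phi x 0 i) in h2 h3.
  have -> : F (phi y) - F (phi x) - (\sum_(i < M) G i (phi x) * phi' x 0 i) * (y - x) =
    (F (phi y) - F (phi x) - A) +
    \sum_(i < M) G i (phi x) * (phi y 0 i - phi x 0 i - phi' x 0 i * (y - x)).
    have -> : \sum_(i < M) G i (phi x) * (phi y 0 i - phi x 0 i - phi' x 0 i * (y - x)) =
        A - (\sum_(i < M) G i (phi x) * phi' x 0 i) * (y - x).
      by rewrite /A mulr_suml -sumrB; apply: eq_bigr => i _; ring.
    by ring.
  apply: le_trans (modulusD _ _) _.
  have e1 : modulus (F (phi y) - F (phi x) - A) <= C * L ^+ 2 * modulus (y - x) ^+ 2.
    apply: le_trans h3 _; rewrite -mulrA ler_wpM2l// -exprMn lerXn2r ?nnegrE//.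
    + exact: vdist_ge0.
    + exact: mulr_ge0.
  have e2 : modulus (\sum_(i < M) G i (phi x) * (phi y 0 i - phi x 0 i - phi' x 0 i * (y - x)))
     <= M%:R * C' * L * modulus (y - x) ^+ 2.
    apply: le_trans (modulus_sum _ _ _) _.
    have : \sum_(i < M) modulus (G i (phi x) * (phi y 0 i - phi x 0 i - phi' x 0 i * (y - x)))
       <= \sum_(i < M) C' * (L * modulus (y - x) ^+ 2).
      apply: ler_sum => i _; rewrite modulusM.
      apply: ler_pM; rewrite ?modulus_ge0//; last by have [] := l2 i.
    exact: b (s _ Ex).
    by rewrite sumr_const card_ord -[X in _ <= X]mulr_natl !mulrA.
  have d2 := sqr_ge0 (modulus (y - x)).
  have := mulr_ge0 C0 d2; have := mulr_ge0 MCL d2.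
  by move=> *; lra.
Qed.

Lemma hol_poly_comp p (E' : K -> Prop) (phi phi' : K -> 'rV[K]_M) :
  (forall i, hol E' (fun x => phi x 0 i) (fun x => phi' x 0 i)) ->
  hol E' (fun x => poly_eval p (phi x))
    (fun x => \sum_i poly_eval (mderiv i p) (phi x) * phi' x 0 i).
Proof.
(* Polynomials satisfy the uniform estimate on bounded sets only; the image of phi is one, its
   coordinates being bounded. *)
move=> h; pose E u := exists2 s, E' s & u = phi s.
suff vE : vbounded E.
  by apply: (hol_comp (mhol_poly p vE)) => // s Es; exists s.
have /choice[B HB] : forall i, exists B, 0 <= B /\ forall s, E' s -> modulus (phi s 0 i) <= B.
  by move=> i; have [B B0 HB] := qdiff_bounded (h i); exists B.
exists (\sum_i B i) => u i [s Es ->]; apply: le_trans ((HB i).2 s Es) _.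
by rewrite (bigD1 i)//= lerDl sumr_ge0// => j _; exact: (HB j).1.
Qed.

(* If p vanishes on a box, so do its partial derivatives; conclude by induction
   on the size of p. *)
Lemma poly_nonvanishing p u (e : R) : 0 < e -> p != 0 ->
  exists2 v : 'rV[K]_M, (forall i, modulus (v 0 i - u 0 i) < e) & poly_eval p v != 0.
Proof.
move=> e0 p0; apply: contrapT => H.
have {}H (v : 'rV[K]_M) : (forall i, modulus (v 0 i - u 0 i) < e) -> poly_eval p v = 0.
  by move=> hv; apply: contrapT => /eqP pv; apply: H; exists v.
move: p0; suff -> : p = 0 by rewrite eqxx.
have [k hk] : exists k, forall m, (k <= mdeg m)%N -> mcoeff m p = 0.
  exists (msize p) => m hm; apply/eqP; rewrite mcoeff_eq0.
  exact: msize_mdeg_ge.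
elim: k p H hk => [|k IH] p H hk.
  by apply/mpolyP => m; rewrite hk// mcoeff0.
pose E (v : 'rV[K]_M) := forall i, modulus (v 0 i - u 0 i) < e.
have bE : vbounded E.
  exists (e + \sum_i modulus (u 0 i)) => v i Ev.
  have : modulus (u 0 i) <= \sum_i modulus (u 0 i).
    by rewrite (bigD1 i)//= lerDl sumr_ge0// => j _; exact: modulus_ge0.
  have := ltW (Ev i); have := modulus_lb (v 0 i) (- u 0 i).
  by rewrite modulusN; lra.
have D i : mderiv i p = 0.
  apply: IH => [v Ev|m hm]; last first.
    by rewrite mcoeff_mderiv hk ?mul0rn// mdegD mdeg1 addn1.
  have [[C C0 h] _] := mhol_poly p bE.
  apply: modulus_small0 => d d0.
  (* The first bound keeps the displaced point in the box, the second makes the difference quotient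
     of p, which is 0, approximate the derivative within d. *)
  pose t := Num.min ((e - modulus (v 0 i - u 0 i)) / 2) (d / (C + 1)).
  have C1 : 0 < C + 1 by lra.
  have t0 : 0 < t by rewrite lt_min !divr_gt0 ?subr_gt0.
  pose w : 'rV[K]_M := \row_j (v 0 j + (if j == i then rc t else 0)).
  have wv j : w 0 j - v 0 j = if j == i then rc t else 0.
    by rewrite mxE; ring.
  have Ew : E w.
    move=> j; have := modulusD (w 0 j - v 0 j) (v 0 j - u 0 j).
    rewrite subrKA wv; case: (eqVneq j i) => [->|_]; last first.
      by rewrite modulus0; have := Ev j; lra.
    rewrite modulus_rc gtr0_norm//.
    have : t <= (e - modulus (v 0 i - u 0 i)) / 2 by rewrite ge_min lexx.
    have := Ev i; lra.
  have [_ _] := h v w Ev Ew.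
  have S (f : 'I_M -> K -> R) : (forall j, f j 0 = 0) ->
      \sum_j f j (w 0 j - v 0 j) = f i (rc t).
    move=> f0; rewrite (bigD1 i)//= big1 ?addr0 ?wv ?eqxx// => j ji.
    by rewrite wv (negbTE ji).
  have -> : vdist v w = t.
    have := S (fun=> @modulus R) (fun=> modulus0 R); rewrite /vdist => ->.
    by rewrite modulus_rc gtr0_norm.
  rewrite (H w Ew) (H v Ev) subrr sub0r modulusN (bigD1 i)//= big1 => [|j ji]; last first.
    by rewrite wv (negbTE ji) mulr0.
  rewrite addr0 wv eqxx modulusM modulus_rc gtr0_norm// expr2 mulrA ler_pM2r// => h'.
  apply: le_trans h' _.
  have : t <= d / (C + 1) by rewrite ge_min lexx orbT.
  by rewrite ler_pdivlMr//; have := ltW t0; lra.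
(* In characteristic 0 the vanishing of all partial derivatives kills every coefficient except the
   constant one. *)
have pC : p = mpolyC M (mcoeff mnm0 p).
  apply/mpolyP => m; rewrite mcoeffC; case: eqP => [->|/eqP m0]; first by rewrite mulr1.
  rewrite mulr0; have [i mi] : exists i, m i != 0%N.
    apply: contrapT => hm; case/eqP: m0; apply/mnmP => i; rewrite mnm0E.
    by apply: contrapT => /eqP mi; apply: hm; exists i.
  have := mcoeff_mderiv i p (mnm_sub m (mnm1 i)).
  rewrite D mcoeff0 (_ : mnm_add _ _ = m); last first.
    apply/mnmP => j; rewrite mnmDE mnmBE mnm1E; case: eqP => [<-|_].
      by rewrite subnK// lt0n.
    by rewrite subn0 addn0.
  by move/esym/eqP; rewrite mulrn_eq0 => /eqP.
move: pC; set c := mcoeff _ _ => pC; have c0 : c = 0.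
  rewrite -[c](poly_evalC _ u) -pC H// => i; by rewrite subrr modulus0.
by rewrite pC c0 mpolyC0.
Qed.

End SeveralVariables.

(** * Neighbourhoods and derivatives in terms of the modulus *)

Section Topology.
Variable R : realType.
Local Notation K := (CC R).

Lemma gt0_rc (e : K) : 0 < e -> exists2 r : R, 0 < r & e = rc r.
Proof.
move=> e0; exists (modulus e); first by rewrite modulus_gt0 gt_eqF.
by rewrite -normE gtr0_norm.
Qed.

Lemma ball_modulus (x y : K) (r : R) : ball x (rc r) y <-> modulus (x - y) < r.
Proof. by rewrite -ball_normE /ball_ /= normE rc_lt. Qed.

Lemma ball_row n (u v : 'rV[K]_n) (r : R) :
  ball u (rc r) v <-> 0 < r /\ forall i, modulus (u 0 i - v 0 i) < r.
Proof.
split=> [[r0 h]|[r0 h]].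
  by split=> [|i]; [rewrite -rc_lt rc0|apply/ball_modulus; exact: h].
by split=> [|i j]; [rewrite -rc0 rc_lt|rewrite ord1; apply/ball_modulus].
Qed.

Lemma nbhs_modulus (x : K) (P : set K) :
  nbhs x P <-> exists2 r : R, 0 < r & forall y, modulus (y - x) < r -> P y.
Proof.
split=> [/nbhs_ballP[e /= /gt0_rc[r r0 ->] h]|[r r0 h]].
  by exists r => // y xy; apply: h; apply/ball_modulus; rewrite modulusB.
apply/nbhs_ballP; exists (rc r) => /=; first by rewrite -rc0 rc_lt.
by move=> y /ball_modulus; rewrite modulusB; exact: h.
Qed.

Lemma nbhs_row n (u : 'rV[K]_n) (P : set 'rV[K]_n) :
  nbhs u P <-> exists2 r : R, 0 < r &
    forall v : 'rV[K]_n, (forall i, modulus (v 0 i - u 0 i) < r) -> P v.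
Proof.
split=> [/nbhs_ballP[e /= /gt0_rc[r r0 ->] h]|[r r0 h]].
  exists r => // v uv; apply: h; apply/ball_row; split=> // i.
  by rewrite modulusB.
apply/nbhs_ballP; exists (rc r) => /=; first by rewrite -rc0 rc_lt.
by move=> v /ball_row[_ uv]; apply: h => i; rewrite modulusB.
Qed.

(** The bridge from the quadratic estimates to the derivative that occurs in the definition of a
    leaf. *)
Lemma is_derive_quadratic n (gamma : K -> 'rV[K]_n) s (v : 'rV[K]_n) (r C : R) : 0 < r ->
  (forall t i, modulus (t - s) < r ->
     modulus (gamma t 0 i - gamma s 0 i - v 0 i * (t - s)) <= C * modulus (t - s) ^+ 2) ->
  is_derive s (1 : K) gamma v.
Proof.
move=> r0 H.
have H1 : (fun h : K => h^-1 *: ((gamma \o shift s) (h *: 1) - gamma s)) @ 0^' --> v.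
  apply/cvg_ballP => _ /gt0_rc[e e0 ->].
  have C1 : 0 < `|C| + 1 by have := normr_ge0 C; lra.
  apply/nbhs_modulus; exists (Num.min r (e / (`|C| + 1))).
    by rewrite lt_min r0 divr_gt0.
  move=> h; rewrite subr0 lt_min => /andP[hr he] h0; apply/ball_row; split=> // i.
  have m0 : 0 < modulus h by rewrite modulus_gt0.
  have := H (h + s) i; rewrite addrK => /(_ hr) H'.
  rewrite /= !mxE /shift /= [h *: 1]mulr1 modulusB.
  have -> : h^-1 * (gamma (h + s) 0 i - gamma s 0 i) - v 0 i =
    h^-1 * (gamma (h + s) 0 i - gamma s 0 i - v 0 i * h) by field.
  rewrite modulusM modulusV mulrC ltr_pdivrMr//; apply: le_lt_trans H' _.
  rewrite expr2 mulrA ltr_pM2r//; move: he; rewrite ltr_pdivlMr// => he.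
  have := ler_norm C; have : C * modulus h <= `|C| * modulus h.
    by rewrite ler_wpM2r ?modulus_ge0 ?ler_norm.
  lra.
apply: DeriveDef; first by apply/cvg_ex; exists v.
by apply/cvg_lim => //; exact: norm_hausdorff.
Qed.

End Topology.

(** * Convex open regions: balls and half-planes *)

Section Balls.
Variable R : realType.
Local Notation K := (CC R).
Implicit Types (s z : K) (r : R).

Lemma ball_convex s r : convex (fun z => modulus (z - s) < r).
Proof.
move=> x y t /andP[t0 t1] xr yr.
rewrite (_ : _ - s = rc (1 - t) * (x - s) + rc t * (y - s)); last by rewrite rcB rc1; ring.
apply: le_lt_trans (modulusD _ _) _; rewrite !modulusM !modulus_rc.
rewrite !ger0_norm ?subr_ge0//.
have [->|t'] := eqVneq t 0; first by rewrite subr0 mul1r mul0r addr0.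
have t'0 : 0 < t by rewrite lt_def t'.
have : t * modulus (y - s) < t * r by rewrite ltr_pM2l.
have : (1 - t) * modulus (x - s) <= (1 - t) * r.
  by rewrite ler_wpM2l ?subr_ge0// ltW.
lra.
Qed.

Lemma ball_bounded s r : bounded (fun z => modulus (z - s) < r).
Proof.
exists (r + modulus s) => x xr; have := modulus_lb x (- s).
by rewrite modulusN; lra.
Qed.

Definition is_open (E : K -> Prop) :=
  forall s, E s -> exists2 r : R, 0 < r & forall z, modulus (z - s) < r -> E z.

Lemma ball_open s r : is_open (fun z => modulus (z - s) < r).
Proof.
move=> x xr; exists (r - modulus (x - s)); first by rewrite subr_gt0.
by move=> z zx; have := modulus_tri z x s; lra.
Qed.

Lemma is_openI (E F : K -> Prop) : is_open E -> is_open F ->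
  is_open (fun z => E z /\ F z).
Proof.
move=> oE oF s [/oE[r r0 h] /oF[r' r'0 h']]; exists (Num.min r r').
  by rewrite lt_min r0.
by move=> z; rewrite lt_min => /andP[/h zE /h' zF].
Qed.

Lemma convexI (E F : K -> Prop) : convex E -> convex F ->
  convex (fun z => E z /\ F z).
Proof. by move=> cE cF x y t t01 [Ex Fx] [Ey Fy]; split; [exact: cE|exact: cF]. Qed.

Lemma boundedI (E F : K -> Prop) : bounded E -> bounded (fun z => E z /\ F z).
Proof. by move=> [B HB]; exists B => x [/HB]. Qed.

Definition half_plane (w : K) (r : R) (z : K) := r < re (w * z).

Lemma half_plane_convex w r : convex (half_plane w r).
Proof.
move=> x y t /andP[t0 t1]; rewrite /half_plane => xr yr.
have -> : w * (x + rc t * (y - x)) = rc (1 - t) * (w * x) + rc t * (w * y).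
  by rewrite rcB rc1; ring.
rewrite reD [re (rc (1 - t) * _)]reM [re (rc t * _)]reM !re_rc !im_rc !mul0r !subr0.
have [->|t'] := eqVneq t 0; first by rewrite subr0 mul1r mul0r addr0.
have t'0 : 0 < t by rewrite lt_def t'.
have : t * r < t * re (w * y) by rewrite ltr_pM2l.
have : (1 - t) * r <= (1 - t) * re (w * x).
  by rewrite ler_wpM2l ?subr_ge0// ltW.
lra.
Qed.

Lemma half_plane_open w r : is_open (half_plane w r).
Proof.
move=> x; rewrite /half_plane => xr.
have D0 : 0 < modulus w + 1 by have := modulus_ge0 w; lra.
exists ((re (w * x) - r) / (modulus w + 1)); first by rewrite divr_gt0// subr_gt0.
move=> z; rewrite ltr_pdivlMr// => zx.
have -> : w * z = w * x + w * (z - x) by ring.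
rewrite reD; have := re_le (w * (z - x)); rewrite modulusM ler_norml.
have := modulus_ge0 (z - x); have := modulus_ge0 w; nra.
Qed.

End Balls.

(** * Local inversion of holomorphic functions *)

Section LocalInverse.
Variable R : realType.
Local Notation K := (CC R).

(* The inverse is obtained as the fixed point of z - (H z - H s0 - t) / h s0. *)
Lemma local_inverse (s0 : K) (rho : R) (H h h' : K -> K) : 0 < rho ->
  hol (fun z => modulus (z - s0) < rho) H h ->
  hol (fun z => modulus (z - s0) < rho) h h' -> h s0 != 0 ->
  exists (r : R) (tau : K -> K), [/\ 0 < r, tau 0 = s0,
    forall t, modulus t < r -> modulus (tau t - s0) < rho /\ h (tau t) != 0,
    exists C, forall t t', modulus t < r -> modulus t' < r ->
      modulus (tau t' - tau t) <= C * modulus (t' - t) &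
    (forall t, modulus t < r -> H (tau t) = H s0 + t) /\
    exists2 r' : R, 0 < r' & forall s, modulus (s - s0) < r' ->
      exists2 t, modulus t < r & tau t = s].
Proof.
move=> rho0 HH hh h0.
set c := h s0 in h0; pose E z := modulus (z - s0) < rho.
have Es0 : E s0 by rewrite /E subrr modulus0.
have c0 : 0 < modulus c by rewrite modulus_gt0.
have [L L0 lip] := qdiff_lip (@cdist_ge0 R) hh.
have [C C0 HC] := HH.
(* On the disc of radius q the variation of h and the quadratic error of H each cost at most a
   quarter of |c|, so that the iteration contracts by 1/2. *)
pose q := Num.min (rho / 2) (modulus c / (4 * (2 * C + L + 1))).
have D0 : 0 < 2 * C + L + 1 by lra.
have q0 : 0 < q by rewrite lt_min !divr_gt0// mulr_gt0.
have qrho : q < rho.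
  by rewrite (@le_lt_trans _ _ (rho / 2))// ?ge_min ?lexx//; lra.
have qc : (2 * C + L) * q <= modulus c / 4.
  have : q <= modulus c / (4 * (2 * C + L + 1)) by rewrite ge_min lexx orbT.
  rewrite ler_pdivlMr ?mulr_gt0//; have := ltW q0; lra.
have small z : modulus (z - s0) <= q -> E z.
  by move=> zq; rewrite /E (le_lt_trans zq).
have near_c z : modulus (z - s0) <= q -> modulus (h z - c) <= modulus c / 4.
  move=> zq; have := lip _ _ Es0 (small _ zq); rewrite /cdist -/c.
  have : L * modulus (z - s0) <= L * q by rewrite ler_wpM2l.
  have := mulr_ge0 C0 (ltW q0); lra.
have contr x y : modulus (x - s0) <= q -> modulus (y - s0) <= q ->
    modulus (H y - H x - c * (y - x)) <= modulus c / 2 * modulus (y - x).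
  move=> xq yq; have [_ _] := HC x y (small _ xq) (small _ yq); rewrite /cdist => h1.
  rewrite (_ : H y - H x - c * (y - x) =
    (H y - H x - h x * (y - x)) + (h x - c) * (y - x)); last by ring.
  apply: le_trans (modulusD _ _) _; rewrite modulusM.
  have h2 : modulus (h x - c) * modulus (y - x) <= modulus c / 4 * modulus (y - x).
    by rewrite ler_wpM2r ?modulus_ge0// near_c.
  suff : C * modulus (y - x) ^+ 2 <= modulus c / 4 * modulus (y - x) by lra.
  rewrite expr2 mulrA ler_wpM2r ?modulus_ge0//.
  have : C * modulus (y - x) <= C * (2 * q).
    rewrite ler_wpM2l// (le_trans (modulus_tri _ s0 _))// [modulus (s0 - x)]modulusB; lra.
  have := mulr_ge0 L0 (ltW q0); lra.
have inj x y : modulus (x - s0) <= q -> modulus (y - s0) <= q ->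
    modulus (y - x) <= 2 / modulus c * modulus (H y - H x).
  move=> xq yq; rewrite mulrAC ler_pdivlMr//.
  have := contr x y xq yq; have := modulusBD (H y - H x) (H y - H x - c * (y - x)).
  by rewrite opprB addrCA subrr addr0 modulusM; lra.
(* The first step t / c then has length at most q / 4, and the halving steps stay in the disc of
   radius q. *)
pose r := modulus c * q / 4.
have r0 : 0 < r by rewrite divr_gt0 ?mulr_gt0.
have sol t : modulus t < r -> exists z, modulus (z - s0) <= q /\ H z = H s0 + t.
  move=> tr; pose T z := z - (H z - H s0 - t) / c.
  have TL x y : modulus (x - s0) <= q -> modulus (y - s0) <= q ->
      modulus (T y - T x) <= modulus (y - x) / 2.
    move=> xq yq; rewrite (_ : T y - T x = - ((H y - H x - c * (y - x)) / c)).
      rewrite modulusN modulusM modulusV ler_pdivrMr//.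
      by have := contr x y xq yq; lra.
    by rewrite /T; field.
  pose z n := iter n T s0.
  have z1 : modulus (z 1%N - z 0%N) <= q / 4.
    rewrite /z /= /T subrr sub0r (_ : _ - _ = t / c); last by ring.
    rewrite modulusM modulusV ler_pdivrMr//; move: tr; rewrite /r; lra.
  have zq n : modulus (z n - s0) <= q / 2 * (1 - 1 / 2 ^+ n) /\
      modulus (z n.+1 - z n) <= q / 4 / 2 ^+ n.
    elim: n => [|n [IH1 IH2]].
      rewrite !expr0 !divr1 subrr modulus0 subrr mulr0; split=> //.
    have p2 : 0 < (2 ^+ n)^-1 :> R by rewrite invr_gt0 exprn_gt0.
    have e2 : (2 ^+ n.+1)^-1 = (2 ^+ n)^-1 / 2 :> R by rewrite exprS invfM mulrC.
    have qp : 0 < q * (2 ^+ n)^-1 by rewrite mulr_gt0.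
    have A : modulus (z n.+1 - s0) <= q / 2 * (1 - 1 / 2 ^+ n.+1).
      have := modulus_tri (z n.+1) (z n) s0; rewrite e2; lra.
    split=> //; have := TL (z n) (z n.+1); rewrite -/(z n.+2) -/(z n.+1) => TL'.
    rewrite e2; apply: le_trans (TL' _ _) _; last by lra.
      by move: IH1; lra.
    by move: A; rewrite e2; lra.
  have [l Hl] := geometric_cauchy (fun n => (zq n).2).
  have lq : modulus (l - s0) <= q.
    apply/ler_addgt0Pr => e e0; have [n hn] := half_pow_small (4 * (q / 4)) e0.
    have := modulus_tri l (z n) s0; have := Hl n; rewrite [modulus (z n - l)]modulusB.
    have := (zq n).1; have : 0 < (2 ^+ n)^-1 :> R by rewrite invr_gt0 exprn_gt0.
    move=> p2; have := mulr_gt0 q0 p2; lra.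
  exists l; split=> //; apply/eqP; rewrite -subr_eq0; apply/eqP.
  have Tl : T l = l.
    apply/eqP; rewrite -subr_eq0; apply/eqP; apply: modulus_small0 => e e0.
    have [n hn] := half_pow_small (8 * (q / 4)) e0; apply: le_trans hn.
    have zn : modulus (z n - s0) <= q.
      have := (zq n).1; have : 0 < (2 ^+ n)^-1 :> R by rewrite invr_gt0 exprn_gt0.
      move=> p2; have := mulr_gt0 q0 p2; lra.
    have := modulus_tri (T l) (z n.+1) l; have := TL _ _ zn lq.
    have := Hl n; have := Hl n.+1; rewrite [modulus (l - z n)]modulusB.
    rewrite [modulus (T l - z n.+1)]/(modulus (T l - T (z n))).
    have e2 : (2 ^+ n.+1)^-1 = (2 ^+ n)^-1 / 2 :> R by rewrite exprS invfM mulrC.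
    have : 0 < (2 ^+ n)^-1 :> R by rewrite invr_gt0 exprn_gt0.
    move=> p2; have := mulr_gt0 q0 p2; rewrite e2; lra.
  move/eqP: Tl; rewrite /T -subr_eq0 addrC addKr oppr_eq0 mulf_eq0 invr_eq0 (negbTE h0) orbF.
  by rewrite opprD addrA => /eqP.
have /choice[tau Htau] : forall t, exists z, modulus t < r ->
    modulus (z - s0) <= q /\ H z = H s0 + t.
  move=> t; case: (ltP (modulus t) r) => tr; last by exists 0.
  by have [z hz] := sol t tr; exists z.
have uniq x y : modulus (x - s0) <= q -> modulus (y - s0) <= q -> H x = H y -> x = y.
  move=> xq yq e; apply/eqP; rewrite -subr_eq0 -modulus_eq0 eq_le modulus_ge0 andbT.
  by have := inj y x yq xq; rewrite e subrr modulus0 mulr0.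
exists r, tau; split=> //.
- have [tq tH] : modulus (tau 0 - s0) <= q /\ H (tau 0) = H s0 + 0.
    by apply: Htau; rewrite modulus0.
  by apply: uniq => //; rewrite ?subrr ?modulus0 ?ltW// tH addr0.
- move=> t tr; have [tq _] := Htau t tr; split; first exact: small.
  rewrite -modulus_gt0; have := near_c _ tq; have := modulusBD (h (tau t)) (h (tau t) - c).
  by rewrite opprB addrCA subrr addr0; lra.
- exists (2 / modulus c) => t t' tr tr'.
  have [tq tH] := Htau t tr; have [tq' tH'] := Htau t' tr'.
  have := inj _ _ tq tq'; rewrite tH tH' (_ : H s0 + t' - (H s0 + t) = t' - t) //.
  by ring.
- split=> [t tr|]; first by have [] := Htau t tr.
  (* Since |H s - H s0| is at most 3/2 |c| |s - s0|, this radius makes H s - H s0 an admissible t;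
     injectivity then identifies s with its image under tau. *)
  pose r' := Num.min q (r / (2 * modulus c)).
  exists r' => [|s]; first by rewrite lt_min q0 divr_gt0 ?mulr_gt0.
  rewrite lt_min => /andP[sq]; rewrite ltr_pdivlMr ?mulr_gt0// => sr.
  have tr : modulus (H s - H s0) < r.
    have := contr s0 s; rewrite subrr modulus0 => /(_ (ltW q0) (ltW sq)).
    have := modulusD (H s - H s0 - c * (s - s0)) (c * (s - s0)).
    rewrite subrK modulusM; have := mulr_ge0 (ltW c0) (modulus_ge0 (s - s0)); lra.
  exists (H s - H s0) => //; have [tq tH] := Htau _ tr.
  by apply: uniq => //; [exact: ltW|rewrite tH addrC subrK].
Qed.

End LocalInverse.

(** * Orbits of polynomial vector fields *)

Section Connectedness.
Variable R : realType.
Local Notation K := (CC R).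

(** Bisection: if P 0 1 failed, transitivity would make P fail on a half of each interval, and the
    nested dyadic intervals would shrink to a point contradicting the local hypothesis. As P is
    merely transitive, implications can be propagated along segments. *)
Lemma unit_interval_connect (P : R -> R -> Prop) :
  (forall x y z, P x y -> P y z -> P x z) ->
  (forall t, 0 <= t <= 1 -> exists2 r, 0 < r & forall x y, 0 <= x <= 1 ->
     0 <= y <= 1 -> `|x - t| < r -> `|y - t| < r -> P x y) -> P 0 1.
Proof.
move=> tr loc; apply: contrapT => P01.
(* The right half is taken when P holds on the left one, the left half otherwise. *)
pose next n x : R := if `[< P x (x + (2 ^+ n.+1)^-1) >] then x + (2 ^+ n.+1)^-1 else x.
pose fix u n : R := if n is m.+1 then next m (u m) else 0.
have p2 n : 0 < (2 ^+ n)^-1 :> R by rewrite invr_gt0 exprn_gt0.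
have p2S n : (2 ^+ n)^-1 = (2 ^+ n.+1)^-1 + (2 ^+ n.+1)^-1 :> R.
  by rewrite exprS; field; rewrite expf_neq0.
have uS n : u n.+1 = u n \/ u n.+1 = u n + (2 ^+ n.+1)^-1.
  by rewrite /= /next; case: asboolP; [right|left].
have uP n : ~ P (u n) (u n + (2 ^+ n)^-1).
  elim: n => [|n IH]; first by rewrite expr0 invr1 add0r.
  rewrite /= /next; case: asboolP => [h h'|h]; last exact: h.
  by apply: IH; rewrite p2S addrA; exact: tr h h'.
have u01 n : 0 <= u n /\ u n + (2 ^+ n)^-1 <= 1.
  elim: n => [|n [h1 h2]]; first by rewrite /= expr0 invr1 add0r.
  by have := p2S n; have := p2 n.+1; case: (uS n) => ->; lra.
have [|l Hl] := @real_geometric_cauchy R u 1.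
  move=> n; rewrite div1r; have := p2 n.+1; have := p2S n.
  by case: (uS n) => -> *; rewrite ler_norml; lra.
have l01 : 0 <= l <= 1.
  apply/andP; split; apply/ler_addgt0Pr => e e0;
    have [n hn] := half_pow_small 2 e0; have [h1 h2] := u01 n;
    have := Hl n; have := p2 n; rewrite mulr1 ler_norml; lra.
have [r r0 Hr] := loc l l01.
have r2 : 0 < r / 2 by lra.
have [n hn] := half_pow_small 3 r2.
have [h1 h2] := u01 n; have h3 := p2 n; have := Hl n; rewrite mulr1 => h4.
by apply: (uP n); apply: Hr; rewrite ?ltr_norml; move: h4; rewrite ?ler_norml; lra.
Qed.

Lemma convex_connect (E : K -> Prop) (P : K -> K -> Prop) : convex E ->
  (forall x y z, P x y -> P y z -> P x z) ->
  (forall s, E s -> exists2 r : R, 0 < r & forall x y, E x -> E y ->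
     modulus (x - s) < r -> modulus (y - s) < r -> P x y) ->
  forall a b, E a -> E b -> P a b.
Proof.
move=> cE tr loc a b Ea Eb.
have := @unit_interval_connect (fun s t => P (a + rc s * (b - a)) (a + rc t * (b - a))).
rewrite rc0 rc1 mul0r addr0 mul1r (_ : a + (b - a) = b); last by ring.
apply=> [x y z|t t01]; first exact: tr.
have [r r0 Hr] := loc _ (cE a b t t01 Ea Eb).
have D0 : 0 < modulus (b - a) + 1 by have := modulus_ge0 (b - a); lra.
exists (r / (modulus (b - a) + 1)) => [|x y x01 y01]; first exact: divr_gt0.
have near z : `|z - t| < r / (modulus (b - a) + 1) ->
    modulus (a + rc z * (b - a) - (a + rc t * (b - a))) < r.
  rewrite ltr_pdivlMr//.
  rewrite (_ : _ - (a + rc t * (b - a)) = rc (z - t) * (b - a)); last by rewrite rcB; ring.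
  rewrite modulusM modulus_rc; have := normr_ge0 (z - t); lra.
by move=> /near xt /near yt; apply: Hr => //; exact: cE.
Qed.

End Connectedness.

Section Orbits.
Variables (R : realType) (n : nat).
Local Notation K := (CC R).
Variable Y : 'I_n -> mpoly n K.

Definition same_leaf : 'rV[K]_n -> 'rV[K]_n -> Prop :=
  Relation_Operators.clos_refl_sym_trans _ (@fol_step K n _ (generated Y)).

Lemma same_leaf_refl p : same_leaf p p.
Proof. exact: Relation_Operators.rst_refl. Qed.
Lemma same_leaf_sym p q : same_leaf p q -> same_leaf q p.
Proof. exact: Relation_Operators.rst_sym. Qed.
Lemma same_leaf_trans p q r : same_leaf p q -> same_leaf q r -> same_leaf p r.
Proof. exact: Relation_Operators.rst_trans. Qed.

(** The velocity of gamma is h times the field. Reparametrised by the local inverse tau of a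
    primitive of h, the curve has the field itself as velocity, hence is an integral curve. *)
Lemma orbit_local (gamma : K -> 'rV[K]_n) (h h' : K -> K) s0 (rho : R) :
  0 < rho ->
  (forall i, hol (fun z => modulus (z - s0) < rho) (fun s => gamma s 0 i) (fun s => h s * poly_eval (Y i) (gamma s))) ->
  hol (fun z => modulus (z - s0) < rho) h h' -> h s0 != 0 ->
  exists2 r : R, 0 < r & forall s, modulus (s - s0) < r -> same_leaf (gamma s0) (gamma s).
Proof.
move=> rho0; set E := fun z => _; move=> Hg hh h0.
have Es0 : E s0 by rewrite /E subrr modulus0.
have cE : convex E := @ball_convex R s0 rho.
have bE : bounded E := @ball_bounded R s0 rho.
have HH := hol_prim cE hh bE Es0.
have [r [tau [r0 tau0 tauE [C HC] [tauH cover]]]] := local_inverse rho0 HH hh h0.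
have [r' r'0 Hr'] := cover; exists r' => // s /Hr'[t1 t1r <-].
apply: Relation_Operators.rst_step.
exists tt, (fun t => gamma (tau t)), (rc r), t1; split=> //; last 2 first.
- by rewrite normE rc_lt.
- by rewrite /= tau0.
move=> t; rewrite normE rc_lt => tr; split=> //.
have [Et ht] := tauE t tr.
have D0 : 0 < r - modulus t by rewrite subr_gt0.
have [D1 D10 H1] := HH.
have /choice[D HD] : forall i, exists D, forall t', modulus (t' - t) < r - modulus t ->
   modulus (gamma (tau t') 0 i - gamma (tau t) 0 i - poly_eval (Y i) (gamma (tau t)) * (t' - t))
   <= D * modulus (t' - t) ^+ 2.
  move=> i; have [D D'0 H] := Hg i.
  set y := poly_eval (Y i) (gamma (tau t)).
  exists (D * C ^+ 2 + modulus y * (D1 * C ^+ 2)) => t' t't.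
  have tr' : modulus t' < r.
    by have := modulusD (t' - t) t; rewrite subrK; lra.
  have [Et' _] := tauE t' tr'.
  have [_ _] := H _ _ Et Et'; have [_ _] := H1 _ _ Et Et'; rewrite /cdist -/y.
  have -> : prim h s0 (tau t') - prim h s0 (tau t) = t' - t.
    by rewrite !tauH//; ring.
  clearbody y; move=> e1 e2; have Ctt := HC _ _ tr tr'.
  have Ctt2 : modulus (tau t' - tau t) ^+ 2 <= C ^+ 2 * modulus (t' - t) ^+ 2.
    by rewrite -exprMn lerXn2r ?nnegrE ?modulus_ge0// (le_trans (modulus_ge0 _) Ctt).
  (* The error of gamma minus y times the error of the primitive of h: only the Lipschitz bound of
     tau enters, not its derivative. *)
  have -> : gamma (tau t') 0 i - gamma (tau t) 0 i - y * (t' - t) =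
    (gamma (tau t') 0 i - gamma (tau t) 0 i - h (tau t) * y * (tau t' - tau t))
    - y * (t' - t - h (tau t) * (tau t' - tau t)).
    by ring.
  apply: le_trans (modulusBD _ _) _; rewrite modulusM.
  have e3 : D * modulus (tau t' - tau t) ^+ 2 <= D * (C ^+ 2 * modulus (t' - t) ^+ 2).
    by rewrite ler_wpM2l.
  have e4 : D1 * modulus (tau t' - tau t) ^+ 2 <= D1 * (C ^+ 2 * modulus (t' - t) ^+ 2).
    by rewrite ler_wpM2l.
  have e5 := le_trans e1 e4.
  have : modulus y * modulus (t' - t - h (tau t) * (tau t' - tau t)) <=
     modulus y * (D1 * (C ^+ 2 * modulus (t' - t) ^+ 2)).
    by rewrite ler_wpM2l ?modulus_ge0.
  have := le_trans e2 e3; lra.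
apply: (is_derive_quadratic (r := r - modulus t) (C := \sum_i `|D i|)) => // t' i t't.
rewrite mxE; apply: le_trans (HD i t' t't) _.
rewrite ler_wpM2r ?sqr_ge0//; apply: le_trans (ler_norm _) _.
by rewrite (bigD1 i)//= lerDl sumr_ge0.
Qed.

Lemma orbit_convex (E : K -> Prop) (gamma : K -> 'rV[K]_n) (h h' : K -> K) :
  convex E -> is_open E ->
  (forall i, hol E (fun s => gamma s 0 i) (fun s => h s * poly_eval (Y i) (gamma s))) ->
  hol E h h' -> (forall s, E s -> h s != 0) ->
  forall a b, E a -> E b -> same_leaf (gamma a) (gamma b).
Proof.
move=> cE oE Hg hh h0 a b Ea Eb.
apply: (convex_connect (P := fun x y => same_leaf (gamma x) (gamma y)) cE) => //.
  by move=> x y z; exact: same_leaf_trans.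
move=> s Es; have [rho rho0 sE] := oE s Es.
have Hl i := holW sE (Hg i).
have [r r0 Hr] := orbit_local rho0 Hl (holW sE hh) (h0 s Es).
exists r => // x y _ _ /Hr xs /Hr ys.
exact: same_leaf_trans (same_leaf_sym xs) ys.
Qed.

End Orbits.

(** * Isolated zeros *)

Section AnalyticGerms.
Variable R : realType.
Local Notation K := (CC R).
Implicit Types (f g : K -> K) (s t : K).

(* The functions F n are the shifted tails of the Taylor expansion of f at s,
   with coefficients a. *)
Definition analytic_at f s := exists (r C rho : R) (a : nat -> K) (F : nat -> K -> K),
  [/\ 0 < r, 0 <= C, 0 <= rho & forall t, modulus t < r -> F 0%N t = f (s + t) /\
     forall n, F n t = a n + t * F n.+1 t /\ modulus (F n t) <= C * rho ^+ n].

Lemma analytic_coef_le (r C rho : R) (a : nat -> K) (F : nat -> K -> K) : 0 < r ->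
  (forall t, modulus t < r -> forall n, F n t = a n + t * F n.+1 t /\
     modulus (F n t) <= C * rho ^+ n) -> forall n, modulus (a n) <= C * rho ^+ n.
Proof.
move=> r0 H n; have [|e] := H 0 _ n; first by rewrite modulus0.
by rewrite e mul0r addr0.
Qed.

Lemma analytic_cst (c : K) s : analytic_at (fun=> c) s.
Proof.
exists 1, (modulus c), 1, (fun n => if n is 0%N then c else 0),
  (fun n _ => if n is 0%N then c else 0); split=> //; first exact: modulus_ge0.
move=> t _; split=> // -[|n].
  by rewrite mulr0 addr0 expr0 mulr1.
by rewrite mulr0 addr0 modulus0 expr1n mulr1; split=> //; exact: modulus_ge0.
Qed.

Lemma analytic_id s : analytic_at id s.
Proof.
exists 1, (modulus s + 1), 1, (fun n => if n is 0%N then s else (n == 1%N)%:R),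
  (fun n t => if n is 0%N then s + t else (n == 1%N)%:R).
have s0 := modulus_ge0 s.
split=> //; first by lra.
move=> t t1; split=> // -[|[|n]] /=; rewrite ?expr1n ?mulr1 ?mulr0 ?addr0.
- by split=> //; have := modulusD s t; lra.
- by split=> //; rewrite modulus1; lra.
- by split=> //; rewrite modulus0; lra.
Qed.

Lemma analytic_ext f g s : analytic_at f s -> (forall x, f x = g x) -> analytic_at g s.
Proof.
move=> [r [C [rho [a [F [r0 C0 h0 H]]]]]] e.
by exists r, C, rho, a, F; split=> // t tr; rewrite -e; exact: H.
Qed.

Lemma analyticD f g s : analytic_at f s -> analytic_at g s ->
  analytic_at (fun x => f x + g x) s.
Proof.
move=> [r [C [rho [a [F [r0 C0 h0 H]]]]]] [r' [C' [rho' [a' [F' [r'0 C'0 h'0 H']]]]]].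
exists (Num.min r r'), (C + C'), (rho + rho'), (fun n => a n + a' n),
  (fun n t => F n t + F' n t); split; rewrite ?addr_ge0//; first by rewrite lt_min r0.
move=> t; rewrite lt_min => /andP[/H[e0 e] /H'[e'0 e']]; rewrite e0 e'0; split=> // n.
have [[e1 e2] [e'1 e'2]] := (e n, e' n); split; first by rewrite [F n t]e1 [F' n t]e'1; ring.
apply: le_trans (modulusD _ _) _; rewrite mulrDl; apply: lerD.
  by apply: le_trans e2 _; rewrite ler_wpM2l// lerXn2r ?nnegrE ?addr_ge0// lerDl.
by apply: le_trans e'2 _; rewrite ler_wpM2l// lerXn2r ?nnegrE ?addr_ge0// lerDr.
Qed.

Lemma analyticM f g s : analytic_at f s -> analytic_at g s ->
  analytic_at (fun x => f x * g x) s.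
Proof.
move=> [r [C [rho1 [a [F [r0 C0 h1 H]]]]]] [r' [C' [rho2 [b [G [r'0 C'0 h2 H']]]]]].
pose rho := rho1 + rho2.
have rho0 : 0 <= rho by rewrite addr_ge0.
have {}H t : modulus t < r -> F 0%N t = f (s + t) /\
     forall n, F n t = a n + t * F n.+1 t /\ modulus (F n t) <= C * rho ^+ n.
  move=> /H[-> e]; split=> // n; have [e1 e2] := e n; split=> //.
  by apply: le_trans e2 _; rewrite ler_wpM2l// lerXn2r ?nnegrE// lerDl.
have {}H' t : modulus t < r' -> G 0%N t = g (s + t) /\
     forall n, G n t = b n + t * G n.+1 t /\ modulus (G n t) <= C' * rho ^+ n.
  move=> /H'[-> e]; split=> // n; have [e1 e2] := e n; split=> //.
  by apply: le_trans e2 _; rewrite ler_wpM2l// lerXn2r ?nnegrE// lerDr.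
have ha := analytic_coef_le r0 (fun t tr => (H t tr).2).
(* The coefficients form the Cauchy product. The n-th tail has n + 1 terms, each bounded by C C' rho
   ^ n; doubling rho absorbs their number, as n + 1 <= 2 ^ n. *)
exists (Num.min r r'), (C * C'), (2 * rho), (fun n => \sum_(k < n.+1) a k * b (n - k)%N),
  (fun n t => \sum_(k < n) a k * G (n - k)%N t + F n t * G 0%N t).
split; rewrite ?mulr_ge0//; first by rewrite lt_min r0.
move=> t; rewrite lt_min => /andP[/H[e0 e] /H'[e'0 e']]; split.
  by rewrite big_ord0 add0r e0 e'0.
move=> n; split.
  rewrite !big_ord_recr /= subnn subSnn mulrDr mulrDr mulr_sumr.
  rewrite (eq_bigr (fun k : 'I_n => a k * b (n - k)%N + t * (a k * G (n.+1 - k)%N t))).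
    rewrite big_split /=; rewrite [F n t](e n).1 [G 0%N t](e' 0%N).1.
    move: (\sum_(i < n) _) (\sum_(i < n) _) (F n.+1 t) (G 1%N t) (a n) (b 0%N) => *; ring.
  by move=> k _; rewrite [G (n - k)%N t](e' _).1 subSn ?(ltnW (ltn_ord k))//; ring.
apply: le_trans (modulusD _ _) _.
have p0 : 0 <= C * C' * rho ^+ n by rewrite mulr_ge0 ?exprn_ge0// mulr_ge0.
apply: (@le_trans _ _ (\sum_(k < n) C * C' * rho ^+ n + C * C' * rho ^+ n)).
  apply: lerD.
    apply: le_trans (modulus_sum _ _ _) _; apply: ler_sum => k _; rewrite modulusM.
    rewrite -[in leRHS](subnKC (ltnW (ltn_ord k))) exprD mulrACA.
    by apply: ler_pM; rewrite ?modulus_ge0//; exact: (e' _).2.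
  rewrite modulusM mulrAC; apply: ler_pM; rewrite ?modulus_ge0//; first exact: (e n).2.
  by have := (e' 0%N).2; rewrite expr0 mulr1.
rewrite sumr_const card_ord -[X in X + _]mulr_natl exprMn.
have : (n.+1%:R : R) <= 2 ^+ n by rewrite -natrX ler_nat ltn_expl.
move=> h; have := ler_wpM2r p0 h; rewrite -natr1; lra.
Qed.

Lemma analytic_sum (I : Type) (l : seq I) (f : I -> K -> K) s :
  (forall i, analytic_at (f i) s) -> analytic_at (fun x => \sum_(i <- l) f i x) s.
Proof.
move=> H; elim: l => [|i l IH].
  by apply: (analytic_ext (analytic_cst 0 s)) => x; rewrite big_nil.
by apply: (analytic_ext (analyticD (H i) IH)) => x; rewrite big_cons.
Qed.

(** The tails of the geometric series are again multiples of 1 / (s + t - d), hence bounded on half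
    the distance to the pole. *)
Lemma analytic_inv_sub (d s : K) : s != d -> analytic_at (fun x => (x - d)^-1) s.
Proof.
move=> sd; have sd0 : s - d != 0 by rewrite subr_eq0.
have m0 : 0 < modulus (s - d) by rewrite modulus_gt0.
exists (modulus (s - d) / 2), (2 / modulus (s - d)), (modulus (s - d))^-1,
  (fun n => (-1) ^+ n / (s - d) ^+ n.+1),
  (fun n t => (-1) ^+ n / (s - d) ^+ n / (s + t - d)).
split; rewrite ?divr_gt0 ?invr_ge0 ?divr_ge0 ?modulus_ge0//.
move=> t tr; split; first by rewrite !expr0 divr1 mul1r.
have std : modulus (s - d) / 2 <= modulus (s + t - d).
  have := modulus_lb (s - d) t; rewrite (_ : s - d + t = s + t - d); last by ring.
  by lra.
have st0 : s + t - d != 0 by rewrite -modulus_gt0; lra.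
move=> n; split; first by rewrite !exprS; field; rewrite st0 sd0 expf_neq0.
rewrite !modulusM !modulusV !modulusX modulusN modulus1 expr1n mul1r exprVn mulrC.
rewrite ler_wpM2r ?invr_ge0 ?exprn_ge0 ?modulus_ge0//.
have -> : 2 / modulus (s - d) = (modulus (s - d) / 2)^-1 by field; rewrite gt_eqF.
by rewrite lef_pV2 ?posrE ?divr_gt0//; lra.
Qed.

Lemma holX E n : bounded E -> hol E (fun z : K => z ^+ n.+1) (fun z => n.+1%:R * z ^+ n).
Proof.
move=> bE; elim: n => [|n IH].
  by apply: (hol_ext (hol_id bE)) => x _; rewrite ?expr0 ?mulr1.
apply: (hol_ext (holM IH (hol_id bE))) => x _; first by rewrite -exprSr.
by rewrite -[n.+2%:R]natr1 !exprS; ring.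
Qed.

Lemma disc_convex (s : K) (r : R) : convex (fun z => modulus (z - s) <= r).
Proof.
move=> x y t /andP[t0 t1] Ex Ey.
rewrite (_ : _ - s = rc (1 - t) * (x - s) + rc t * (y - s)); last by rewrite rcB rc1; ring.
apply: le_trans (modulusD _ _) _; rewrite !modulusM !modulus_rc.
rewrite !ger0_norm ?subr_ge0//.
have := ler_wpM2l t0 Ey; have t1' : 0 <= 1 - t by rewrite subr_ge0.
have := ler_wpM2l t1' Ex; lra.
Qed.

(** The coefficients are integrated termwise. The tail bound comes from the mean value inequality on
    the disc of radius |t|, applied to f minus the integrated polynomial, whose derivative is a tail
    of h. *)
Lemma analytic_prim f h h' s (r0 : R) : 0 < r0 ->
  hol (fun z => modulus (z - s) < r0) f h -> hol (fun z => modulus (z - s) < r0) h h' ->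
  analytic_at h s -> analytic_at f s.
Proof.
move=> r00 Hf Hh [r1 [C [rho [b [H [r10 C0 rho0 HH]]]]]].
have [C1 C10 fb] := qdiff_bounded Hf.
pose a n := if n is m.+1 then b m / m.+1%:R else f s.
pose r := Num.min r0 r1.
have r_gt0 : 0 < r by rewrite lt_min r00.
(* Integration shifts the index by one, so rho ^ n has to be bounded by a multiple of rho' ^ (n +
   1), also when rho is small. *)
pose rho' := rho + 1.
have rho'0 : 0 <= rho' by rewrite addr_ge0.
pose P n t : K := \sum_(k < n) a k * t ^+ k.
(* At t = 0 the quotient by t ^ n has no meaning and the tail is its constant coefficient. *)
exists r, (C + C1), rho', a, (fun n t => if t == 0 then a n else (f (s + t) - P n t) / t ^+ n).
split=> //; first exact: addr_ge0.
move=> t; rewrite lt_min => /andP[tr0 tr1]; split.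
  by case: eqP => [->|_]; rewrite ?addr0// /P big_ord0 subr0 expr0 divr1.
have hb := analytic_coef_le r10 (fun t tr => (HH t tr).2).
have le1 n : C * rho ^+ n <= (C + C1) * rho' ^+ n.+1.
  rewrite exprS; have -> : (C + C1) * (rho' * rho' ^+ n) = (C + C1) * rho' * rho' ^+ n by ring.
  apply: ler_pM; rewrite ?exprn_ge0//; last first.
    by rewrite lerXn2r ?nnegrE// lerDl.
  rewrite /rho' mulrDr mulr1; have := mulr_ge0 C0 rho0; have := mulr_ge0 C10 rho0; lra.
have natV n : (n.+1%:R : R)^-1 <= 1 by rewrite invf_le1 ?ltr0n// ler1n.
case: (eqVneq t 0) => [t0|t0] n.
  rewrite t0 mul0r addr0; split=> //; case: n => [|n]; rewrite /a.
    rewrite expr0 mulr1; have := fb s; rewrite subrr modulus0 => /(_ r00); lra.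
  apply: le_trans (le1 n); rewrite modulusM modulusV modulus_nat.
  by apply: le_trans (hb n); rewrite ler_piMr ?modulus_ge0.
split.
  rewrite /P big_ord_recr /= exprS; field.
  by rewrite expf_neq0.
case: n => [|n].
  rewrite /P big_ord0 subr0 expr0 divr1 expr0 mulr1.
  by have := fb (s + t); rewrite addrC addKr => /(_ tr0); lra.
apply: le_trans (le1 n).
rewrite modulusM modulusV modulusX ler_pdivrMr ?exprn_gt0 ?modulus_gt0//.
pose E z := modulus (z - 0) <= modulus t.
have cE : convex E by exact: disc_convex.
have bE : bounded E by exists (modulus t) => x; rewrite /E subr0.
have Es z : E z -> modulus (s + z - s) < r0.
  by rewrite /E subr0 addrC addKr => /le_lt_trans; apply.
have shift k k' : hol (fun z => modulus (z - s) < r0) k k' ->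
    hol E (fun z => k (s + z)) (fun z => k' (s + z)).
  move=> hk; have := @hol_shift _ _ E (- s) _ _ _ hk.
  have e z : z - - s = s + z by ring.
  move=> /(_ _)/hol_ext; apply=> [z Ez|z Ez|z Ez]; rewrite e//; exact: Es.
have Q m : hol E (fun z => \sum_(k < m) b k / k.+1%:R * z ^+ k.+1)
    (fun z => \sum_(k < m) b k * z ^+ k).
  apply: (hol_ext (hol_sum (s := index_enum 'I_m) (fun k _ => holZ (b k / k.+1%:R) (holX k bE)))) => //.
  move=> z _; apply: eq_bigr => k _; field.
  by rewrite ?pnatr_eq0.
have Q' m : exists q', hol E (fun z => \sum_(k < m) b k * z ^+ k) q'.
  elim: m => [|m [q' IH]].
    exists (fun=> 0); apply: (hol_ext (hol_cst E 0)) => // z _; by rewrite big_ord0.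
  have [q2 hq2] : exists q2, hol E (fun z => z ^+ m) q2.
    case: (m) => [|k]; last by exists (fun z => k.+1%:R * z ^+ k); exact: holX.
    by exists (fun=> 0); apply: (hol_ext (hol_cst E 1)).
  exists (fun z => q' z + b m * q2 z).
  by apply: (hol_ext (holD IH (holZ (b m) hq2))) => // z _; rewrite big_ord_recr.
have [q' Hq'] := Q' n.
have tail m z : modulus z < r1 -> h (s + z) - \sum_(k < m) b k * z ^+ k = z ^+ m * H m z.
  move=> /HH[<- e]; elim: m => [|m IH]; first by rewrite big_ord0 subr0 expr0 mul1r.
  rewrite big_ord_recr /= opprD addrA IH (e m).1 exprSr; ring.
have bd z : E z -> modulus (h (s + z) - \sum_(k < n) b k * z ^+ k) <=
    modulus t ^+ n * (C * rho ^+ n).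
  rewrite /E subr0 => zt; have zr1 := le_lt_trans zt tr1.
  rewrite tail// modulusM modulusX; apply: ler_pM; rewrite ?exprn_ge0 ?modulus_ge0//.
    by rewrite lerXn2r ?nnegrE ?modulus_ge0.
  by have [_ /(_ n)[]] := HH z zr1.
have E0 : E 0 by rewrite /E subrr modulus0 modulus_ge0.
have Et : E t by rewrite /E subr0.
have := hol_mvi cE bE (holD (shift _ _ Hf) (holN (Q n)))
  (holD (shift _ _ Hh) (holN Hq')) E0 Et bd.
rewrite subr0 addr0 (_ : \sum_(k < n) b k / k.+1%:R * 0 ^+ k.+1 = 0); last first.
  by rewrite big1// => k _; rewrite exprS mul0r mulr0.
rewrite /P big_ord_recl expr0 mulr1 /a oppr0 addr0 opprD addrA.
have -> : f (s + t) - f s - \sum_(i < n) match bump 0 i with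
   | 0%N => f s | m.+1 => b m / m.+1%:R end * t ^+ bump 0 i =
   f (s + t) - \sum_(k < n) b k / k.+1%:R * t ^+ k.+1 - f s by rewrite addrAC.
by move=> h1; apply: le_trans h1 _; rewrite exprSr le_eqVlt; apply/orP; left; apply/eqP; ring.
Qed.

(** Either a first nonzero coefficient dominates its tail near s, or f (s + t) = t ^ n F n t for all
    n, which tends to 0 when |t| rho <= 1/2. *)
Lemma analytic_dichotomy f s : analytic_at f s ->
  (exists2 r : R, 0 < r & forall x, x != s -> modulus (x - s) < r -> f x != 0) \/
  (exists2 r : R, 0 < r & forall x, modulus (x - s) < r -> f x = 0).
Proof.
move=> [r [C [rho [a [F [r0 C0 rho0 H]]]]]].
have tail n t : modulus t < r -> (forall k, (k < n)%N -> a k = 0) ->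
    f (s + t) = t ^+ n * F n t.
  move=> /H[<- e] a0; elim: n a0 => [|n IH] a0; first by rewrite expr0 mul1r.
  rewrite IH => [|k kn]; last by apply: a0; exact: ltnW.
  by rewrite (e n).1 a0// add0r exprSr mulrA.
have sE x : s + (x - s) = x by ring.
have [[n an]|a0] := pselect (exists n, a n != 0).
  left; have [m am mmin] := ex_minnP (ex_intro (fun n => a n != 0) n an).
  have D0 : 0 < C * rho ^+ m.+1 + 1 by have := mulr_ge0 C0 (exprn_ge0 m.+1 rho0); lra.
  have am0 : 0 < modulus (a m) by rewrite modulus_gt0.
  exists (Num.min r (modulus (a m) / (C * rho ^+ m.+1 + 1))).
    by rewrite lt_min r0 divr_gt0.
  move=> x xs; rewrite lt_min => /andP[xr]; rewrite ltr_pdivlMr// => xa.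
  rewrite -[x]sE (@tail m)//; last first.
    by move=> k km; apply/eqP/negPn/negP => /mmin; rewrite leqNgt km.
  have xs0 : x - s != 0 by rewrite subr_eq0.
  rewrite mulf_neq0 ?expf_neq0//.
  have [_ e] := H _ xr; rewrite (e m).1 -modulus_gt0.
  have := modulus_lb (a m) ((x - s) * F m.+1 (x - s)); rewrite modulusM.
  have := ler_wpM2l (modulus_ge0 (x - s)) (e m.+1).2.
  have := modulus_ge0 (x - s); lra.
right; exists (Num.min r (2 * (rho + 1))^-1).
  by rewrite lt_min r0 invr_gt0 mulr_gt0//; lra.
move=> x; rewrite lt_min => /andP[xr].
have D0 : 0 < 2 * (rho + 1) by lra.
rewrite -[(2 * (rho + 1))^-1]div1r ltr_pdivlMr// => x2.
apply: modulus_small0 => e e0; have [n hn] := half_pow_small C e0.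
apply: le_trans hn; rewrite -[x in f x]sE (@tail n)//; last first.
  by move=> k _; apply/eqP/negPn/negP => ak; apply: a0; exists k.
rewrite modulusM modulusX; have [_ /(_ n)[_ h]] := H _ xr.
apply: le_trans (ler_wpM2l (exprn_ge0 n (modulus_ge0 _)) h) _.
rewrite mulrCA ler_wpM2l// -exprMn -exprVn lerXn2r ?nnegrE ?mulr_ge0 ?modulus_ge0//.
have m0 := modulus_ge0 (x - s); rewrite -[2^-1]div1r ler_pdivlMr//; lra.
Qed.

(** The value at s itself is free: it may also be nonzero. *)
Definition isolated_zero_at f s :=
  exists2 r : R, 0 < r & forall x, x != s -> modulus (x - s) < r -> f x != 0.

Lemma other_point s (r : R) : 0 < r -> exists2 x, x != s & modulus (x - s) < r.
Proof.
move=> r0; have e : s + rc (r / 2) - s = rc (r / 2) by ring.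
exists (s + rc (r / 2)); last by rewrite e modulus_rc gtr0_norm; lra.
by rewrite -subr_eq0 e rc_eq0; lra.
Qed.

(** The property is propagated from s0 along E. Near a point where f vanishes on a whole disc no
    zero is isolated, so the implication to be propagated holds vacuously there. *)
Lemma analytic_isolated_zeros (E : K -> Prop) f : convex E ->
  (forall s, E s -> analytic_at f s) -> (exists2 s, E s & f s != 0) ->
  forall s, E s -> isolated_zero_at f s.
Proof.
move=> cE anf [s0 Es0 fs0] s Es.
have iso_of x : E x -> f x != 0 -> isolated_zero_at f x.
  move=> /anf/analytic_dichotomy[//|[r r0 h]] fx.
  by have := h x; rewrite subrr modulus0 => /(_ r0) fx0; rewrite fx0 eqxx in fx.
have := @convex_connect R E (fun x y => isolated_zero_at f x -> isolated_zero_at f y) cE.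
move=> /(_ _ _ s0 s Es0 Es); apply; last exact: iso_of.
  by move=> x y z h1 h2 /h1/h2.
move=> t Et; have [[r r0 h]|[r r0 h]] := analytic_dichotomy (anf t Et).
  exists r => // x y _ Ey _ yr _; have [->|yt] := eqVneq y t; first by exists r.
  exact/iso_of/h.
exists r => // x y _ _ xr _ [r' r'0 h']; exfalso.
have m0 : 0 < Num.min r' (r - modulus (x - t)) by rewrite lt_min r'0 subr_gt0.
have [z zx] := other_point x m0; rewrite lt_min => /andP[zr' zr].
have := h' z zx zr'; rewrite h ?eqxx//.
by have := modulus_tri z x t; lra.
Qed.

End AnalyticGerms.

(** * Lifts and periods *)

Section Widening.
Variables (K : numClosedFieldType) (M : nat).

Lemma widen_lift (i : 'I_M) : widen_ord (leqnSn M) i = lift ord_max i.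
Proof. by apply: val_inj; rewrite /= /bump leqNgt ltn_ord. Qed.

Lemma poly_eval_mwiden (p : mpoly M K) (w : 'rV[K]_M.+1) :
  poly_eval (mwiden p) w = poly_eval p (x_part w).
Proof.
elim/mpoly_gen_ind : p => [c|i|p q hp hq|p q hp hq].
- by rewrite mwidenC !poly_evalC.
- by rewrite /mvar /mwiden mmapX mmap1U -/(mvar _ _) poly_eval_var poly_eval_var mxE.
- by rewrite mwidenD !poly_evalD hp hq.
- by rewrite mwidenM !poly_evalM hp hq.
Qed.

End Widening.

Section Lift.
Variables (R : realType) (M : nat).
Local Notation K := (CC R).
Variables (N P : 'I_M -> mpoly M K) (Q S : mpoly M K).
Implicit Types (u v : 'rV[K]_M) (z t T : K).

(* The lift to dz = \sum_i (N i / Q) dx_i of the vector field with components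
   Q * P i. *)
Definition lift_field (i : 'I_M.+1) : mpoly M.+1 K :=
  if unlift ord_max i is Some j then mwiden (Q * P j)
  else mwiden (\sum_j N j * P j).

Definition ext u z : 'rV[K]_M.+1 :=
  \row_i if unlift ord_max i is Some j then u 0 j else z.

Lemma ext_lift u z j : ext u z 0 (lift ord_max j) = u 0 j.
Proof. by rewrite mxE liftK. Qed.
Lemma ext_max u z : ext u z 0 ord_max = z.
Proof. by rewrite mxE unlift_none. Qed.

Lemma x_part_ext u z : x_part (ext u z) = u.
Proof. by apply/rowP => i; rewrite mxE widen_lift ext_lift. Qed.

Lemma ext_x_part (w : 'rV[K]_M.+1) : ext (x_part w) (w 0 ord_max) = w.
Proof.
apply/rowP => i; rewrite mxE; case: unliftP => [j ->|-> //].
by rewrite mxE widen_lift.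
Qed.

Lemma lift_field_lift j (w : 'rV[K]_M.+1) :
  poly_eval (lift_field (lift ord_max j)) w = poly_eval (Q * P j) (x_part w).
Proof. by rewrite /lift_field liftK poly_eval_mwiden. Qed.

Lemma lift_field_max (w : 'rV[K]_M.+1) :
  poly_eval (lift_field ord_max) w = poly_eval (\sum_j N j * P j) (x_part w).
Proof. by rewrite /lift_field unlift_none poly_eval_mwiden. Qed.

Local Notation leaf := (same_leaf lift_field).

(** The lifted field does not depend on z, so translating an integral curve in z gives an integral
    curve. *)
Lemma same_leaf_translate u z u' z' t : leaf (ext u z) (ext u' z') ->
  leaf (ext u (z + t)) (ext u' (z' + t)).
Proof.
have extD v y : ext v (y + t) = ext v y + ext 0 t.
  apply/rowP => i; rewrite !mxE; case: unliftP => [j _|_]; rewrite ?mxE ?addr0//.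
have x0 w : x_part (w + ext 0 t) = x_part w.
  by apply/rowP => i; rewrite !mxE widen_lift liftK mxE addr0.
rewrite !extD; elim => [p q st|p|p q _ IH|p q r _ IH1 _ IH2].
- apply: Relation_Operators.rst_step.
  move: st => [a [gamma [r [s [H sr g0 gt]]]]].
  exists a, (fun x => gamma x + ext 0 t), r, s; split=> //.
  + move=> x /H[h1 h2]; split=> //.
    have := is_deriveD h2 (is_derive_cst (ext 0 t) x (1 : K)).
    rewrite addr0 (_ : fol_field _ (_ + _) = fol_field a (gamma x))//.
    apply/rowP => i; rewrite !mxE; case: (unliftP ord_max i) => [j ->|->].
      by rewrite !lift_field_lift x0.
    by rewrite !lift_field_max x0.
  + by rewrite /= -g0.
  + by rewrite /= -gt.
- exact: same_leaf_refl.
- exact: same_leaf_sym IH.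
- exact: same_leaf_trans IH1 IH2.
Qed.

(** The leaf relation on C^M, obtained by projecting leaves of the lift; by translation invariance
    the height of the starting point can be prescribed. *)
Definition proj_leaf u u' := exists z z', leaf (ext u z) (ext u' z').

Lemma proj_leafP u u' : proj_leaf u u' -> forall z, exists z', leaf (ext u z) (ext u' z').
Proof.
move=> [z0 [z1 h]] z; exists (z1 + (z - z0)).
by have := same_leaf_translate (z - z0) h; rewrite addrC subrK.
Qed.

Lemma proj_leaf_refl u : proj_leaf u u.
Proof. by exists 0, 0; exact: same_leaf_refl. Qed.
Lemma proj_leaf_sym u v : proj_leaf u v -> proj_leaf v u.
Proof. by move=> [z [z' h]]; exists z', z; exact: same_leaf_sym. Qed.
Lemma proj_leaf_trans u v w : proj_leaf u v -> proj_leaf v w -> proj_leaf u w.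
Proof.
move=> /proj_leafP/(_ 0)[z h] /proj_leafP/(_ z)[z' h'].
by exists 0, z'; exact: same_leaf_trans h h'.
Qed.

Definition period u T := forall z, leaf (ext u z) (ext u (z + T)).

Lemma period1 u T z : leaf (ext u z) (ext u (z + T)) -> period u T.
Proof.
move=> h z'; have := same_leaf_translate (z' - z) h.
by rewrite [z + T + _]addrAC [z + (z' - z)]addrC subrK.
Qed.

Lemma period0 u : period u 0.
Proof. by move=> z; rewrite addr0; exact: same_leaf_refl. Qed.
Lemma periodD u T T' : period u T -> period u T' -> period u (T + T').
Proof. by move=> h h' z; rewrite addrA; apply: same_leaf_trans (h z) (h' _). Qed.
Lemma periodN u T : period u T -> period u (- T).
Proof.
by move=> h z; apply: same_leaf_sym; have := h (z - T); rewrite subrK.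
Qed.

Lemma period_proj_leaf u v T : proj_leaf u v -> period u T -> period v T.
Proof.
move=> /proj_leafP/(_ 0)[z h] pT; apply: (@period1 _ _ z).
apply: same_leaf_trans (same_leaf_sym h) _; apply: same_leaf_trans (pT 0) _.
exact: same_leaf_translate.
Qed.

Definition lift_integrand (phi phi' : K -> 'rV[K]_M) s : K :=
  \sum_i poly_eval (N i) (phi s) / poly_eval Q (phi s) * phi' s 0 i.

(** Adding to z the integral of omega along phi gives a curve tangent to the lift; its velocity is
    the lifted field divided by S * Q, so [orbit_convex] applies with this factor. The lower bound c
    makes its inverse uniformly holomorphic. *)
Lemma lift_convex (E : K -> Prop) (phi phi' phi'' : K -> 'rV[K]_M) (c : R) :
  convex E -> bounded E ->
  is_open E ->
  (forall i, hol E (fun s => phi s 0 i) (fun s => phi' s 0 i)) ->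
  (forall i, hol E (fun s => phi' s 0 i) (fun s => phi'' s 0 i)) ->
  (forall s i, E s -> poly_eval (P i) (phi s) = poly_eval S (phi s) * phi' s 0 i) ->
  0 < c -> (forall s, E s -> c <= modulus (poly_eval (S * Q) (phi s))) ->
  (exists R', hol E (lift_integrand phi phi') R') /\
  forall a b z, E a -> E b ->
    leaf (ext (phi a) z) (ext (phi b) (z + prim (lift_integrand phi phi') a b)).
Proof.
move=> cE bE oE h1 h2 hP c0 hc.
have hp p := hol_poly_comp p h1.
have SQ s : E s -> poly_eval S (phi s) != 0 /\ poly_eval Q (phi s) != 0.
  move=> Es; have := lt_le_trans c0 (hc s Es).
  by rewrite modulus_gt0 poly_evalM mulf_eq0 negb_or => /andP[].
have hV := holV (hp (S * Q)) c0 hc.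
have hR : exists R', hol E (lift_integrand phi phi') R'.
  have hi i := holM (holM (holM (hp (N i)) (hp S)) hV) (h2 i).
  eexists; apply: (hol_ext (hol_sum (s := index_enum 'I_M) (fun i _ => hi i))) => // s Es.
  apply: eq_bigr => i _; congr (_ * _); rewrite poly_evalM.
  have [S0 Q0] := SQ s Es.
  move: (poly_eval _ _) (poly_eval _ _) (poly_eval _ _) S0 Q0 => x y w S0 Q0.
  by field; rewrite S0 Q0.
split=> //; have [R' HR] := hR => a b z Ea Eb.
pose gamma s := ext (phi s) (z + prim (lift_integrand phi phi') a s).
have -> : ext (phi a) z = gamma a by rewrite /gamma (prim_refl cE HR Ea) addr0.
apply: (orbit_convex cE oE (gamma := gamma) (h := fun s => (poly_eval (S * Q) (phi s))^-1)) => //.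
- move=> i; case: (unliftP ord_max i) => [j ->|->].
    apply: (hol_ext (h1 j)) => s Es; first by rewrite ext_lift.
    rewrite lift_field_lift x_part_ext !poly_evalM (hP s j Es).
    have [S0 Q0] := SQ s Es.
    move: (poly_eval _ _) (poly_eval _ _) S0 Q0 => x y S0 Q0.
    by field; rewrite S0 Q0.
  apply: (hol_ext (holD (hol_cst E z) (hol_prim cE HR bE Ea))) => s Es; first by rewrite ext_max.
  rewrite add0r lift_field_max x_part_ext poly_eval_sum mulr_sumr; apply: eq_bigr => i0 _.
  rewrite !poly_evalM (hP s i0 Es); have [S0 Q0] := SQ s Es.
  move: (poly_eval _ _) (poly_eval _ _) (poly_eval _ _) (phi' s 0 i0) S0 Q0 => x y w t S0 Q0.
  by field; rewrite S0 Q0.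
- exact: hV.
- by move=> s Es; rewrite invr_eq0 -modulus_gt0; exact: lt_le_trans (hc s Es).
Qed.

End Lift.

(** * The foliation of C^M *)

Section LeafEquation.
Variables (K : numClosedFieldType) (M : nat) (a b : 'I_M) (eta : 'rV[K]_M).
Variable sigma : 'I_4 -> K.
Hypothesis ab : a != b.
Implicit Types (t : K) (W u : 'rV[K]_M) (i : 'I_M) (l : 'I_4).

(** Every pair of a coordinate and a residue gets a pole of its own, namely [(puncture i l).+1]. *)
Definition puncture i l : nat := (4 * i + l)%N.

(* With d = (puncture i l).+1, the summand is
   sigma l * ((t - d)^-1 + (t + d) / d ^ 2). *)
Definition log_form i t : K :=
  \sum_l sigma l * (t ^+ 2 / ((puncture i l).+1%:R ^+ 2 * (t - (puncture i l).+1%:R))).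

Definition leaf_point t W : 'rV[K]_M := \row_i
  if i == a then eta 0 a + t else if i == b then eta 0 b + W 0 b / t
  else eta 0 i + W 0 i.

(** The derivative of [leaf_point t W] in t when W moves with W_i' = [log_form i]. *)
Definition leaf_speed t W : 'rV[K]_M := \row_i
  if i == a then 1 else if i == b then log_form b t / t - W 0 b / t ^+ 2
  else log_form i t.

Definition tpoly : mpoly M K := mvar K a - mpolyC M (eta 0 a).
Definition puncture_poly : mpoly M K := \prod_(n < 4 * M) (tpoly - mpolyC M n.+1%:R).
(** The common denominator: [leaf_P] is [leaf_S] times the velocity of the leaves. *)
Definition leaf_S : mpoly M K := tpoly * puncture_poly.
Definition log_poly i : mpoly M K := \sum_l
  mpolyC M (sigma l / (puncture i l).+1%:R ^+ 2) * (tpoly * tpoly) *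
  \prod_(n < 4 * M | (n : nat) != puncture i l) (tpoly - mpolyC M n.+1%:R).
(** On a leaf W_b / t is x_b - eta_b, so in the component b one factor t of [leaf_S] is enough to
    clear both terms of the velocity. *)
Definition leaf_P i : mpoly M K :=
  if i == a then leaf_S
  else if i == b then log_poly b - puncture_poly * (mvar K b - mpolyC M (eta 0 b))
  else tpoly * log_poly i.

Definition regular_time t := t != 0 /\ forall n, (n < 4 * M)%N -> t != n.+1%:R.

Lemma puncture_lt i l : (puncture i l < 4 * M)%N.
Proof.
have il := ltn_ord l; have iM := ltn_ord i; rewrite /puncture.
by rewrite (@leq_trans (4 * i.+1))// ?leq_mul2l// mulnS addnC ltn_add2r.
Qed.

Lemma puncture_inj i l j k : puncture i l = puncture j k -> i = j /\ l = k.
Proof.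
move=> e; suff [e1 e2] : i = j :> nat /\ l = k :> nat.
  by split; exact: val_inj.
have H q (r : 'I_4) : ((4 * q + r) %/ 4 = q)%N /\ ((4 * q + r) %% 4 = r)%N.
  by rewrite mulnC divnMDl// modnMDl (divn_small (ltn_ord r)) modn_small// addn0.
have [h1 h2] := H i l; have [h3 h4] := H j k.
by move: e; rewrite /puncture => e; split; [rewrite -h1 e h3|rewrite -h2 e h4].
Qed.

Lemma tpolyE u : poly_eval tpoly u = u 0 a - eta 0 a.
Proof. by rewrite poly_evalB poly_eval_var poly_evalC. Qed.

Lemma puncture_polyE u : poly_eval puncture_poly u =
  \prod_(n < 4 * M) (u 0 a - eta 0 a - n.+1%:R).
Proof.
by rewrite poly_eval_prod; apply: eq_bigr => n _; rewrite poly_evalB tpolyE poly_evalC.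
Qed.

Lemma leaf_S_neq0 u : poly_eval leaf_S u != 0 <-> regular_time (u 0 a - eta 0 a).
Proof.
rewrite poly_evalM tpolyE puncture_polyE mulf_eq0 negb_or; split.
  move=> /andP[h1 /prodf_neq0 h2]; split=> // n nM.
  by rewrite -subr_eq0; exact: (h2 (Ordinal nM)).
by move=> [-> h] /=; apply/prodf_neq0 => n _; rewrite subr_eq0 h.
Qed.

Lemma log_polyE i u : regular_time (u 0 a - eta 0 a) -> poly_eval (log_poly i) u =
  poly_eval puncture_poly u * log_form i (u 0 a - eta 0 a).
Proof.
set t := u 0 a - eta 0 a => -[t0 ht]; rewrite poly_eval_sum puncture_polyE -/t mulr_sumr.
apply: eq_bigr => l _; rewrite !poly_evalM poly_evalC tpolyE -/t poly_eval_prod.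
rewrite [in RHS](bigD1 (Ordinal (puncture_lt i l)))//=.
have -> : \prod_(n < 4 * M | (n : nat) != puncture i l)
    poly_eval (tpoly - mpolyC M n.+1%:R) u =
  \prod_(n < 4 * M | n != Ordinal (puncture_lt i l)) (t - n.+1%:R).
  apply: eq_big => [n|n _]; first by rewrite -val_eqE.
  by rewrite poly_evalB poly_evalC tpolyE.
have d0 : (puncture i l).+1%:R != 0 :> K by rewrite pnatr_eq0.
have td : t - (puncture i l).+1%:R != 0 by rewrite subr_eq0 ht ?puncture_lt.
move: (\prod_(n < _ | _) _) ((puncture i l).+1%:R) d0 td => p d d0 td.
by field; rewrite td d0.
Qed.

Lemma leaf_point_a t W : leaf_point t W 0 a = eta 0 a + t.
Proof. by rewrite mxE eqxx. Qed.

Lemma leaf_point_time t W : leaf_point t W 0 a - eta 0 a = t.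
Proof. by rewrite leaf_point_a addrC addKr. Qed.

Lemma leaf_equation t W i : regular_time t ->
  poly_eval (leaf_P i) (leaf_point t W) =
  poly_eval leaf_S (leaf_point t W) * leaf_speed t W 0 i.
Proof.
move=> rt; have rt' : regular_time (leaf_point t W 0 a - eta 0 a) by rewrite leaf_point_time.
have [t0 _] := rt; rewrite /leaf_P [leaf_speed _ _ _ _]mxE.
case: eqP => [_|_]; first by rewrite mulr1.
case: eqP => [_|_]; rewrite /leaf_S.
  rewrite poly_evalB !poly_evalM log_polyE// poly_evalB poly_eval_var poly_evalC tpolyE.
  rewrite leaf_point_time [leaf_point t W 0 b]mxE eq_sym (negbTE ab) eqxx.
  move: (poly_eval _ _) (log_form _ _) => p g.
  by field.
by rewrite !poly_evalM log_polyE// tpolyE leaf_point_time mulrA.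
Qed.

Lemma leaf_pointK u : regular_time (u 0 a - eta 0 a) -> exists W,
  leaf_point (u 0 a - eta 0 a) W = u.
Proof.
move=> [t0 _]; exists (\row_i (if i == b then (u 0 b - eta 0 b) * (u 0 a - eta 0 a)
  else u 0 i - eta 0 i)).
apply/rowP => i; rewrite [LHS]mxE; case: eqP => [->|/eqP ia].
  by rewrite addrC subrK.
case: eqP => [->|/eqP ib]; rewrite mxE.
  by rewrite eqxx mulfK// addrC subrK.
by rewrite (negbTE ib) addrC subrK.
Qed.

End LeafEquation.

(** * Transport of states along the leaves *)

Section Transport.
Variables (R : realType) (M : nat) (a b : 'I_M).
Local Notation K := (CC R).
Variables (eta : 'rV[K]_M) (N : 'I_M -> mpoly M K) (Q : mpoly M K).
Variable sigma : 'I_4 -> K.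
Hypothesis ab : a != b.
Implicit Types (c s t v : K) (W u : 'rV[K]_M) (i : 'I_M) (E : K -> Prop).

Local Notation g := (log_form sigma).
Local Notation S := (leaf_S a eta).
Local Notation phi := (leaf_point a b eta).
Local Notation phi' := (leaf_speed a b sigma).
Local Notation plf := (proj_leaf N (leaf_P a b eta sigma) Q).

Definition off_punctures E := exists2 e : R, 0 < e &
  forall t n, E t -> (n < 4 * M)%N -> e <= modulus (t - n.+1%:R).

Definition off_zero E := exists2 e : R, 0 < e & forall t, E t -> e <= modulus t.

(* on such a region the functions log_form i have primitives *)
Definition region E := [/\ convex E, bounded E, is_open E & off_punctures E].

Lemma hol_log_term E c n : bounded E ->
  (exists2 e : R, 0 < e & forall t, E t -> e <= modulus (t - n.+1%:R)) ->
  exists g', hol E (fun t => c * (t ^+ 2 / (n.+1%:R ^+ 2 * (t - n.+1%:R)))) g'.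
Proof.
move=> bE [e e0 he]; set d : K := n.+1%:R.
have hd : hol E (fun t => t - d) (fun=> 1 + 0) := holD (hol_id bE) (hol_cst E (- d)).
have hdV := holV hd e0 he.
eexists; apply: (hol_ext (holZ (c / d ^+ 2) (holM (holX 1 bE) hdV))) => // t Et.
have d0 : d != 0 by rewrite pnatr_eq0.
have td : t - d != 0 by rewrite -modulus_gt0; exact: lt_le_trans (he t Et).
by clearbody d; field; apply/andP.
Qed.

Lemma hol_log_form E i : bounded E -> off_punctures E ->
  exists g', hol E (g i) g'.
Proof.
move=> bE [e e0 he].
have /choice[g' Hg'] : forall l, exists g', hol E (fun t => sigma l * (t ^+ 2 /
    ((puncture i l).+1%:R ^+ 2 * (t - (puncture i l).+1%:R)))) g'.
  move=> l; apply: hol_log_term => //; exists e => // t Et.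
  exact: he _ _ Et (puncture_lt i l).
exists (fun t => \sum_l g' l t).
exact: (hol_sum (s := index_enum 'I_4) (fun l _ => Hg' l)).
Qed.

Lemma region_ball E s : region E -> E s -> exists2 r : R, 0 < r &
  (forall z, modulus (z - s) < r -> E z) /\ region (fun z => modulus (z - s) < r).
Proof.
move=> [cE bE oE [e e0 he]] Es; have [r r0 h] := oE s Es.
exists r => //; split=> //; split.
- exact: ball_convex.
- exact: ball_bounded.
- exact: ball_open.
- by exists e => // t n /h; exact: he.
Qed.

(** Here W is the state at the base time v. *)
Definition coords v W t : 'rV[K]_M := \row_i (W 0 i + prim (g i) v t).
Definition curve v W t := phi t (coords v W t).
Definition curve' v W t := phi' t (coords v W t).

Lemma hol_coords E v W i : region E -> E v ->
  hol E (fun t => coords v W t 0 i) (g i).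
Proof.
move=> [cE bE oE pE] Ev; have [g' hg] := hol_log_form i bE pE.
apply: (hol_ext (holD (hol_cst E (W 0 i)) (hol_prim cE hg bE Ev))) => t _.
  by rewrite mxE.
by rewrite add0r.
Qed.

Lemma hol_inv_time E : bounded E -> off_zero E ->
  hol E (fun t => t^-1) (fun t => - 1 / t ^+ 2).
Proof.
move=> bE [e e0 he].
by apply: (hol_ext (holV (hol_id bE) e0 he)).
Qed.

Lemma hol_curve E v W i : region E -> off_zero E -> E v ->
  hol E (fun t => curve v W t 0 i) (fun t => curve' v W t 0 i).
Proof.
move=> rE zE Ev; have [cE bE oE pE] := rE.
have hV := hol_inv_time bE zE.
have t0 t : E t -> t != 0.
  have [e e0 he] := zE; by move=> Et; rewrite -modulus_gt0; exact: lt_le_trans (he t Et).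
have [->|ia] := eqVneq i a.
  apply: (hol_ext (holD (hol_cst E (eta 0 a)) (hol_id bE))) => t _.
    by rewrite mxE eqxx.
  by rewrite add0r mxE eqxx.
have [->|ib] := eqVneq i b.
  apply: (hol_ext (holD (hol_cst E (eta 0 b)) (holM (hol_coords W b rE Ev) hV))) => t Et.
    by rewrite [RHS]mxE eq_sym (negbTE ab) eqxx.
  rewrite [RHS]mxE eq_sym (negbTE ab) eqxx; have := t0 t Et.
  by move: (coords _ _ _ _ _) (g b t) => x y z; field.
apply: (hol_ext (holD (hol_cst E (eta 0 i)) (hol_coords W i rE Ev))) => t Et.
  by rewrite [RHS]mxE (negbTE ia) (negbTE ib).
by rewrite [RHS]mxE (negbTE ia) (negbTE ib) add0r.
Qed.

Lemma hol_curve' E v W : region E -> off_zero E -> E v ->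
  exists f : K -> 'rV[K]_M, forall i, hol E (fun t => curve' v W t 0 i) (fun t => f t 0 i).
Proof.
move=> rE zE Ev; have [cE bE oE pE] := rE.
have hV := hol_inv_time bE zE.
suff /choice[f Hf] : forall i, exists f, hol E (fun t => curve' v W t 0 i) f.
  exists (fun t => \row_i f i t) => i.
  by apply: (hol_ext (Hf i)) => // t _; rewrite mxE.
move=> i; have [->|ia] := eqVneq i a.
  exists (fun=> 0); apply: (hol_ext (hol_cst E 1)) => // t _.
  by rewrite mxE eqxx.
have [->|ib] := eqVneq i b.
  have [g' hg] := hol_log_form b bE pE.
  eexists; apply: (hol_ext (holD (holM hg hV)
    (holN (holM (hol_coords W b rE Ev) (holM hV hV))))) => // t Et.
  rewrite [RHS]mxE eq_sym (negbTE ab) eqxx expr2 invfM.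
  by [].
have [g' hg] := hol_log_form i bE pE; exists g'.
by apply: (hol_ext hg) => // t _; rewrite [RHS]mxE (negbTE ia) (negbTE ib).
Qed.

(** Off the singular times and the zeros of Q, where the lifted field does not vanish in the
    direction a. *)
Definition good u := poly_eval (S * Q) u != 0.

Lemma analytic_log_form s i : (forall n, (n < 4 * M)%N -> s != n.+1%:R) ->
  analytic_at (g i) s.
Proof.
move=> hs; apply: analytic_sum => l.
set d : K := (puncture i l).+1%:R.
have ha := analytic_inv_sub (hs _ (puncture_lt i l)); rewrite -/d in ha.
apply: (analytic_ext (analyticM (analytic_cst (sigma l / d ^+ 2) s)
  (analyticM (analyticM (analytic_id s) (analytic_id s)) ha))) => t.
by clearbody d; rewrite [in RHS]invfM; move: ((t - d)^-1) (d ^- 2) => x y; ring.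
Qed.

Lemma analytic_curve E v W s : region E -> off_zero E -> E v -> E s ->
  forall i, analytic_at (fun t => curve v W t 0 i) s.
Proof.
move=> rE [e e0 he] Ev Es i; have [cE bE oE pE] := rE.
have s0 : s != 0 by rewrite -modulus_gt0; exact: lt_le_trans (he s Es).
have sp n : (n < 4 * M)%N -> s != n.+1%:R.
  have [e' e'0 he'] := pE => nM.
  by rewrite -subr_eq0 -modulus_gt0; exact: lt_le_trans (he' s n Es nM).
have ac j : analytic_at (fun t => coords v W t 0 j) s.
  have [r r0 [rs _]] := region_ball rE Es.
  have [g' hg] := hol_log_form j bE pE.
  exact: (analytic_prim r0 (holW rs (hol_coords W j rE Ev)) (holW rs hg)
    (analytic_log_form j sp)).
have aV : analytic_at (fun t => t^-1) s.
  by apply: (analytic_ext (analytic_inv_sub s0)) => t; rewrite subr0.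
have [->|ia] := eqVneq i a.
  by apply: (analytic_ext (analyticD (analytic_cst (eta 0 a) s) (analytic_id s))) => t;
    rewrite mxE eqxx.
have [->|ib] := eqVneq i b.
  apply: (analytic_ext (analyticD (analytic_cst (eta 0 b) s) (analyticM (ac b) aV))) => t.
  by rewrite [RHS]mxE eq_sym (negbTE ab) eqxx.
apply: (analytic_ext (analyticD (analytic_cst (eta 0 i) s) (ac i))) => t.
by rewrite [RHS]mxE (negbTE ia) (negbTE ib).
Qed.

(** With p = S * Q this makes the bad points of a curve isolated as soon as one of its points is
    good. *)
Lemma analytic_poly_curve E v W s p : region E -> off_zero E -> E v -> E s ->
  analytic_at (fun t => poly_eval p (curve v W t)) s.
Proof.
move=> rE zE Ev Es; elim/mpoly_gen_ind : p => [c|i|p q hp hq|p q hp hq].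
- by apply: (analytic_ext (analytic_cst c s)) => t; rewrite poly_evalC.
- by apply: (analytic_ext (analytic_curve W rE zE Ev Es i)) => t; rewrite poly_eval_var.
- by apply: (analytic_ext (analyticD hp hq)) => t; rewrite poly_evalD.
- by apply: (analytic_ext (analyticM hp hq)) => t; rewrite poly_evalM.
Qed.

Lemma good_regular u : good u -> regular_time M (u 0 a - eta 0 a).
Proof.
rewrite /good poly_evalM mulf_eq0 negb_or => /andP[h _].
exact: (@leaf_S_neq0 _ _ a eta u).1.
Qed.

Lemma curve_leaf_equation E v W s i : region E -> off_zero E -> E s ->
  poly_eval (leaf_P a b eta sigma i) (curve v W s) =
  poly_eval S (curve v W s) * curve' v W s 0 i.
Proof.
move=> [_ _ _ [e e0 he]] [e' e'0 he'] Es; apply: leaf_equation => //; split.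
  by rewrite -modulus_gt0; exact: lt_le_trans (he' s Es).
by move=> n nM; rewrite -subr_eq0 -modulus_gt0; exact: lt_le_trans (he s n Es nM).
Qed.

Lemma coordsD E v v' W t : region E -> E v -> E v' -> E t ->
  coords v' (coords v W v') t = coords v W t.
Proof.
move=> [cE bE oE pE] Ev Ev' Et; apply/rowP => i; rewrite !mxE.
have [g' hg] := hol_log_form i bE pE.
by rewrite -addrA (prim_add cE hg).
Qed.

Lemma coords_refl E v W : region E -> E v -> coords v W v = W.
Proof.
move=> [cE bE oE pE] Ev; apply/rowP => i; rewrite mxE.
have [g' hg] := hol_log_form i bE pE.
by rewrite (prim_refl cE hg)// addr0.
Qed.

Lemma curve_local E v W s : region E -> off_zero E -> E v -> E s ->
  good (curve v W s) -> exists2 r : R, 0 < r &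
  forall t, modulus (t - s) < r -> plf (curve v W s) (curve v W t).
Proof.
move=> rE zE Ev Es gs.
have hF := hol_poly_comp (S * Q) (fun i => hol_curve W i rE zE Ev).
have [L L0 HL] := qdiff_lip (@cdist_ge0 R) hF.
set F := fun t => poly_eval (S * Q) (curve v W t).
have F0 : 0 < modulus (F s) by rewrite modulus_gt0.
have [r r0 [rs rB]] := region_ball rE Es.
have L1 : 0 < 2 * (L + 1) by lra.
pose r' := Num.min r (modulus (F s) / (2 * (L + 1))).
have r'0 : 0 < r' by rewrite lt_min r0 divr_gt0.
have sr' z : modulus (z - s) < r' -> E z.
  by rewrite lt_min => /andP[/rs].
have [cE bE oE pE] := rE.
have [f Hf] := hol_curve' W rE zE Ev.
have Fc t : modulus (t - s) < r' -> modulus (F s) / 2 <= modulus (F t).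
  move=> tr'; have Et := sr' t tr'; move: tr'; rewrite lt_min => /andP[_ tF].
  exact: (half_modulus_le L0 (modulus_ge0 (t - s)) (ltW tF) (HL s t Es Et)).
have c0 : 0 < modulus (F s) / 2 by lra.
have [_ H] := @lift_convex R M N (leaf_P a b eta sigma) Q S _ (curve v W) (curve' v W) f
  (modulus (F s) / 2) (@ball_convex R s r') (@ball_bounded R s r') (@ball_open R s r')
  (fun i => holW sr' (hol_curve W i rE zE Ev)) (fun i => holW sr' (Hf i))
  (fun t i tr => curve_leaf_equation v W i rE zE (sr' t tr)) c0 Fc.
exists r' => // t tr'; have ss : modulus (s - s) < r' by rewrite subrr modulus0.
by have h := H s t 0 ss tr'; eexists; eexists; exact: h.
Qed.

Definition good_on E v W (H : K -> Prop) := forall t, H t -> E t /\ good (curve v W t).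

Lemma curve_convex E v W (H : K -> Prop) : region E -> off_zero E -> E v ->
  convex H -> good_on E v W H ->
  forall s t, H s -> H t -> plf (curve v W s) (curve v W t).
Proof.
move=> rE zE Ev cH gH.
apply: (convex_connect cH (fun x y z => @proj_leaf_trans _ _ _ _ _ _ _ _)) => s Hs; have [Es gs] := gH s Hs.
have [r r0 h] := curve_local rE zE Ev Es gs.
exists r => // x y _ _ /h sx /h sy.
exact: proj_leaf_trans (proj_leaf_sym sx) sy.
Qed.

(** A punctured disc is not convex, but half-discs are: two points whose directions from s form an
    acute angle lie in a common one, and the other pairs are joined by quarter turns. *)
Lemma curve_punctured_ball E v W s (r : R) : region E -> off_zero E -> E v ->
  (forall t, modulus (t - s) < r -> E t) ->
  (forall t, t != s -> modulus (t - s) < r -> good (curve v W t)) ->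
  forall x y, x != s -> y != s -> modulus (x - s) < r -> modulus (y - s) < r ->
  plf (curve v W x) (curve v W y).
Proof.
move=> rE zE Ev rs gd.
pose H w t := modulus (t - s) < r /\ half_plane w (re (w * s)) t.
have cH w : convex (H w).
  by apply: convexI; [exact: ball_convex|exact: half_plane_convex].
have ne w t : H w t -> t != s.
  by move=> [_]; rewrite /half_plane; apply: contraTneq => ->; rewrite ltxx.
have gH w : good_on E v W (H w).
  by move=> t Ht; split; [exact: rs Ht.1|apply: gd; [exact: ne Ht|exact: Ht.1]].
have half (w x y : K) : 0 < re (w * (x - s)) -> 0 < re (w * (y - s)) ->
    modulus (x - s) < r -> modulus (y - s) < r -> plf (curve v W x) (curve v W y).
  move=> wx wy xr yr; apply: (curve_convex rE zE Ev (cH w) (gH w)); split=> //;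
    rewrite /half_plane -subr_gt0 -reB -mulrBr//.
(* Complex conjugation; the real part of cj z * w is the real scalar product of z and w. *)
pose cj z : K := rc (re z) - ii * rc (im z).
have cjE z w : re (cj z * w) = re z * re w + im z * im w.
  rewrite /cj reM reB imB !reM !imM !re_ii !im_ii !re_rc !im_rc; ring.
have pos (z : K) : z != 0 -> 0 < re z * re z + im z * im z.
  by move=> z0; rewrite -!expr2 -modulus_sqr exprn_gt0// modulus_gt0.
have xsE (x : K) : s + x - s = x by ring.
have re1 : re (1 : K) = 1 by [].
have im1 : im (1 : K) = 0 by [].
(* Both x and its quarter turn lie on the positive side of the bisecting direction (1 + i) x. *)
have rot (x : K) : x != 0 -> modulus x < r ->
    plf (curve v W (s + x)) (curve v W (s + ii * x)).
  move=> x0 xr; apply: (half (cj ((1 + ii) * x))); rewrite ?xsE ?modulusM ?modulus_ii ?mul1r//;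
    rewrite cjE !(reM, imM, reD, imD) re_ii im_ii re1 im1;
    have := pos x x0; lra.
have ii0 : ii != 0 :> K by rewrite -modulus_gt0 modulus_ii.
have rot2 (x : K) : x != 0 -> modulus x < r ->
    plf (curve v W (s + x)) (curve v W (s - x)).
  move=> x0 xr; apply: proj_leaf_trans (rot x x0 xr) _.
  have := rot (ii * x); rewrite mulf_neq0// modulusM modulus_ii mul1r mulrA ii2 mulN1r.
  exact.
move=> x y xs ys xr yr.
have x0 : x - s != 0 by rewrite subr_eq0.
have y0 : y - s != 0 by rewrite subr_eq0.
have key (c : K) : modulus c < r -> 0 < re (cj (y - s) * c) ->
    plf (curve v W (s + c)) (curve v W y).
  move=> cr yc; apply: (half (cj (y - s))); rewrite ?xsE// cjE.
  exact: pos.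
have sx : x = s + (x - s) by ring.
have [p|p] := ltP 0 (re (cj (y - s) * (x - s))).
  by rewrite {1}sx; exact: key.
have Nr : modulus (- (x - s)) < r by rewrite modulusN.
have [q|q] := ltP 0 (re (cj (y - s) * - (x - s))).
  by rewrite {1}sx; apply: proj_leaf_trans (rot2 _ x0 xr) _; exact: key.
(* The two directions are orthogonal: a quarter turn, followed if necessary by a half turn, brings x
   to the side of y. *)
have p0 : re (cj (y - s) * (x - s)) = 0.
  by move: q; rewrite mulrN reN => q; apply/eqP; rewrite eq_le p; lra.
have im0 : im (cj (y - s) * (x - s)) != 0.
  apply/eqP => im0; have : cj (y - s) * (x - s) = 0 by apply: eq_reim.
  move/eqP; rewrite mulf_eq0 (negbTE x0) orbF => /eqP c0.
  by have := pos _ y0; rewrite -cjE c0 mul0r; rewrite /re /= ltxx.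
have iiE (c : K) : re (cj (y - s) * (ii * c)) = - im (cj (y - s) * c).
  by rewrite mulrCA reM re_ii im_ii; ring.
have iir : modulus (ii * (x - s)) < r by rewrite modulusM modulus_ii mul1r.
have r1 := rot _ x0 xr.
have ii1 : ii * (x - s) != 0 by rewrite mulf_neq0.
rewrite {1}sx; apply: proj_leaf_trans r1 _.
have [q'|q'] := ltP 0 (re (cj (y - s) * (ii * (x - s)))); first exact: key.
apply: proj_leaf_trans (rot2 _ ii1 iir) _; apply: key; first by rewrite modulusN.
by rewrite mulrN reN lt_def oppr_ge0 q' andbT oppr_eq0 iiE oppr_eq0.
Qed.

(* The point with parameters v, W may lie on the bad locus; its neighbours on
   the leaf do not. *)
Definition reach u v W := exists2 r : R, 0 < r & forall t, t != v ->
  modulus (t - v) < r -> good (curve v W t) /\ plf u (curve v W t).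

(** One translation A serves all leaves and all states, because W_i' depends on t alone. *)
Definition transport v v' (A : 'rV[K]_M) := forall u W, reach u v W -> reach u v' (W + A).

Lemma transport_comp v v' v'' A B : transport v v' A -> transport v' v'' B ->
  transport v v'' (A + B).
Proof. by move=> h h' u W /h/h'; rewrite addrA. Qed.

Definition translation v v' : 'rV[K]_M := \row_i prim (g i) v v'.

Lemma coords_translation v v' W : coords v W v' = W + translation v v'.
Proof. by apply/rowP => i; rewrite !mxE. Qed.

(** The curve meets the zeros of S * Q in isolated points, since near v it is good. Around each of
    its points it is therefore connected through a punctured disc, and [reach] propagates along E
    even past bad points. *)
Lemma transport_link E v v' : region E -> off_zero E -> E v -> E v' ->
  transport v v' (translation v v').
Proof.
move=> rE zE Ev Ev' u W [r r0 H]; rewrite -coords_translation.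
have [cE bE oE pE] := rE.
pose F t := poly_eval (S * Q) (curve v W t).
have iso : forall s, E s -> isolated_zero_at F s.
  apply: (analytic_isolated_zeros cE) => [s Es|].
    exact: analytic_poly_curve Es.
  have [r' r'0 [h _]] := region_ball rE Ev.
  have m0 : 0 < Num.min r r' by rewrite lt_min r0.
  have [t tv] := other_point v m0; rewrite lt_min => /andP[tr tr'].
  by exists t; [exact: h|have [] := H t tv tr].
(* Reachability of the point at time s on the fixed curve based at v. *)
pose rch s := exists2 r : R, 0 < r & forall t, t != s ->
  modulus (t - s) < r -> good (curve v W t) /\ plf u (curve v W t).
suff rv' : rch v'.
  have [r1 r10 H1] := rv'; have [r2 r20 [h2 _]] := region_ball rE Ev'.
  exists (Num.min r1 r2); first by rewrite lt_min r10.
  move=> t tv'; rewrite lt_min => /andP[tr1 tr2]; rewrite /curve.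
  rewrite (coordsD _ rE Ev Ev' (h2 t tr2)); exact: H1.
have := @convex_connect R E (fun x y => rch x -> rch y) cE.
move=> /(_ _ _ v v' Ev Ev'); apply; last by exists r.
  by move=> x y z h1 h2 /h1/h2.
move=> s Es; have [r1 r10 [h1 _]] := region_ball rE Es.
have [r2 r20 h2] := iso s Es.
(* The half leaves room for points near x or y, which lie in the disc of radius 2 q. *)
pose q := Num.min r1 r2 / 2.
have q0 : 0 < q by rewrite divr_gt0// lt_min r10.
have q1 : 2 * q <= r1.
  have : Num.min r1 r2 <= r1 by rewrite ge_min lexx.
  by rewrite /q; lra.
have q2 : 2 * q <= r2.
  have : Num.min r1 r2 <= r2 by rewrite ge_min lexx orbT.
  by rewrite /q; lra.
have gq t : t != s -> modulus (t - s) < 2 * q -> good (curve v W t).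
  by move=> ts tq; apply: h2 => //; lra.
have Eq t : modulus (t - s) < 2 * q -> E t by move=> tq; apply: h1; lra.
have pb := curve_punctured_ball rE zE Ev Eq gq.
exists q => // x y _ _ xq yq [r3 r30 h3].
have [z zs [zq zu]] : exists2 z, z != s & modulus (z - s) < 2 * q /\ plf u (curve v W z).
  (* When x differs from s, the auxiliary point must also be closer to x than s is, so as not to
     fall on s. *)
  pose r4 := if x == s then Num.min r3 q else Num.min (Num.min r3 q) (modulus (x - s)).
  have r40 : 0 < r4.
    rewrite /r4; case: eqP => [_|/eqP xs]; rewrite !lt_min r30 q0//=.
    by rewrite modulus_gt0 subr_eq0.
  have r43 : r4 <= Num.min r3 q.
    by rewrite /r4; case: eqP => // _; rewrite ge_min lexx.
  have [z zx zr] := other_point x r40.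
  have /andP[zr3 zrq] : (modulus (z - x) < r3) && (modulus (z - x) < q).
    by rewrite -lt_min; exact: lt_le_trans r43.
  exists z; last by split; [have := modulus_tri z x s; lra|have [] := h3 z zx zr3].
  move: zr zx; rewrite /r4; case: eqVneq => [->//|xs]; rewrite lt_min => /andP[_ zr] _.
  by apply: contraTneq zr => ->; rewrite modulusB ltxx.
pose r5 := if y == s then q else Num.min q (modulus (y - s)).
have r50 : 0 < r5.
  rewrite /r5; case: eqP => [//|/eqP ys]; by rewrite lt_min q0 modulus_gt0 subr_eq0.
have r5q : r5 <= q by rewrite /r5; case: eqP => // _; rewrite ge_min lexx.
exists r5 => // t ty tr.
have ts : t != s.
  move: tr ty; rewrite /r5; case: eqVneq => [->//|ys]; rewrite lt_min => /andP[_ tr] _.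
  by apply: contraTneq tr => ->; rewrite modulusB ltxx.
have tq : modulus (t - s) < 2 * q by have := modulus_tri t y s; lra.
split; first exact: gq.
exact: proj_leaf_trans zu (pb z t zs ts zq tq).
Qed.

(** At a good point [reach] is plain membership in the projected leaf; this is how transport is
    entered and left. *)
Lemma reach_good E u v W : region E -> off_zero E -> E v -> good (phi v W) ->
  plf u (phi v W) <-> reach u v W.
Proof.
move=> rE zE Ev gv.
have eW : phi v W = curve v W v by rewrite /curve (coords_refl _ rE Ev).
rewrite eW in gv *; have [r r0 h] := curve_local rE zE Ev Ev gv.
have [r' r'0 [h' _]] := region_ball rE Ev.
split=> [uv|[r1 r10 h1]].
  have [] := @analytic_dichotomy R (fun t => poly_eval (S * Q) (curve v W t)) v.
  - exact: (analytic_poly_curve _ _ rE zE Ev Ev).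
  - move=> [r2 r20 h2]; exists (Num.min r r2); first by rewrite lt_min r0.
    move=> t tv; rewrite lt_min => /andP[tr tr2]; split; first exact: h2.
    exact: proj_leaf_trans uv (h t tr).
  - by move=> [r2 r20 /(_ v)]; rewrite subrr modulus0 => /(_ r20) e; rewrite /good e eqxx in gv.
have m0 : 0 < Num.min r r1 by rewrite lt_min r0.
have [t tv] := other_point v m0; rewrite lt_min => /andP[tr tr1].
have [_ ut] := h1 t tv tr1; apply: proj_leaf_trans ut (proj_leaf_sym (h t tr)).
Qed.

End Transport.

(** * Monodromy *)

Section PrimitiveAlgebra.
Variable R : realType.
Local Notation K := (CC R).
Implicit Types (f g : K -> K) (E : K -> Prop) (x y c : K).

Lemma hol_is_prim E f f' x y : convex E -> hol E f f' -> E x -> E y ->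
  is_prim f x y (prim f x y).
Proof. by move=> cE hf Ex Ey; have [C _ H] := prim_approx cE hf; have [] := H x y Ex Ey. Qed.

Lemma trapezoidD n f g x y :
  trapezoid n (fun t => f t + g t) x y = trapezoid n f x y + trapezoid n g x y.
Proof. by elim: n x y => [|m IH] x y /=; rewrite ?IH; ring. Qed.

Lemma trapezoidZ n c f x y :
  trapezoid n (fun t => c * f t) x y = c * trapezoid n f x y.
Proof. by elim: n x y => [|m IH] x y /=; rewrite ?IH; ring. Qed.

(** The form dt / (t - c) is invariant under affine maps, and so are its trapezoidal sums. All sides
    of all squares around c thus have the same integral, without any logarithm. *)
Lemma trapezoid_inv_affine n c (alpha : K) x y : alpha != 0 ->
  trapezoid n (fun t => (t - c)^-1) (c + alpha * x) (c + alpha * y) =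
  trapezoid n (fun t => t^-1) x y.
Proof.
move=> a0; have e p : c + alpha * p - c = alpha * p by ring.
elim: n x y => [|n IH] x y.
  rewrite /= !e !invfM.
  have -> : c + alpha * y - (c + alpha * x) = alpha * (y - x) by ring.
  by move: (x^-1) (y^-1) => p q; field.
rewrite !trapezoidS; have -> : (c + alpha * x + (c + alpha * y)) / 2 = c + alpha * ((x + y) / 2).
  by field.
by rewrite !IH.
Qed.

Lemma primD E f f' g g' x y : convex E -> hol E f f' -> hol E g g' -> E x -> E y ->
  prim (fun t => f t + g t) x y = prim f x y + prim g x y.
Proof.
move=> cE hf hg Ex Ey; apply: primP.
have [C HC] := hol_is_prim cE hf Ex Ey; have [D HD] := hol_is_prim cE hg Ex Ey.
exists (C + D) => n.
rewrite trapezoidD.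
rewrite (_ : _ - _ = (trapezoid n f x y - prim f x y) + (trapezoid n g x y - prim g x y)).
  by apply: le_trans (modulusD _ _) _; rewrite mulrDl lerD.
by ring.
Qed.

Lemma primZ E f f' c x y : convex E -> hol E f f' -> E x -> E y ->
  prim (fun t => c * f t) x y = c * prim f x y.
Proof.
move=> cE hf Ex Ey; apply: primP; have [C HC] := hol_is_prim cE hf Ex Ey.
exists (modulus c * C) => n.
by rewrite trapezoidZ -mulrBr modulusM -mulrA ler_wpM2l ?modulus_ge0.
Qed.

Lemma prim_ext E f g x y : convex E -> (forall t, E t -> f t = g t) -> E x -> E y ->
  prim f x y = prim g x y.
Proof.
move=> cE e Ex Ey; rewrite /prim; congr (xget _ _); apply/funext => l; apply/propext.
have et n : trapezoid n f x y = trapezoid n g x y.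
  elim: n x y Ex Ey => [|n IH] x y Ex Ey /=; first by rewrite !e.
  by have Em := convex_mid cE Ex Ey; rewrite !IH.
by split=> -[C H]; exists C => n; [rewrite -et|rewrite et].
Qed.

Lemma prim_inv_affine (E : K -> Prop) f' x y c (alpha : K) : convex E ->
  hol E (fun t => t^-1) f' -> E x -> E y -> alpha != 0 ->
  prim (fun t => (t - c)^-1) (c + alpha * x) (c + alpha * y) = prim (fun t => t^-1) x y.
Proof.
move=> cE hi Ex Ey a0; apply: primP.
have [C HC] := hol_is_prim cE hi Ex Ey; exists C => n.
by rewrite trapezoid_inv_affine.
Qed.

Definition square_loop f (q : nat -> K) : K :=
  prim f (q 0) (q 1) + prim f (q 1) (q 2) + prim f (q 2) (q 3) + prim f (q 3) (q 0).

Lemma square_loop0 E f f' q : convex E -> hol E f f' -> (forall k, E (q k)) ->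
  square_loop f q = 0.
Proof.
move=> cE hf Eq; rewrite /square_loop !(prim_add cE hf)//.
exact: (prim_refl cE hf).
Qed.

(** The vertices of the square with centre c and half-side r, counterclockwise from the upper right
    one. *)
Definition corner (c : K) (r : R) (k : nat) : K := c + rc r * (ii ^+ k * (1 + ii)).

(** The integral of dt / t along one side of the square; its value is i pi / 2, so [4 * kappa]
    stands for 2 pi i. *)
Definition kappa : K := prim (fun t => t^-1) (1 + ii) (ii * (1 + ii)).

Lemma re1 : re (1 : K) = 1. Proof. by []. Qed.
Lemma im1 : im (1 : K) = 0. Proof. by []. Qed.
Lemma re_nat n : re (n%:R : K) = n%:R. Proof. by rewrite -rc_nat re_rc. Qed.
Lemma im_nat n : im (n%:R : K) = 0. Proof. by rewrite -rc_nat im_rc. Qed.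

Definition reimE' := (reD, imD, reB, imB, reN, imN, reM, imM, re_rc, im_rc, re_ii, im_ii,
  re1, im1, re_nat, im_nat).

(** On this side the imaginary part of 1 / z runs between -1 and -1/2, and 3/4 is the midpoint in
    absolute value; the largest distance, at the ends, is sqrt 5 / 4 < 3/5. *)
Lemma top_side : exists E f', [/\ convex E, bounded E, hol E (fun t : K => t^-1) f',
   E (1 + ii) & E (ii * (1 + ii))] /\
   forall z, E z -> modulus (z^-1 - - (ii * rc (3 / 4))) <= 3 / 5.
Proof.
pose E (z : K) := im z = 1 /\ `|re z| <= 1.
have cE : convex E.
  move=> x y t /andP[t0 t1] [x1 x2] [y1 y2]; split.
    by rewrite !reimE' x1 y1; ring.
  move: x2 y2; rewrite !reimE' !ler_norml => /andP[x2 x3] /andP[y2 y3]; apply/andP; split; nra.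
have bE : bounded E.
  by exists 2 => z [h1 h2]; have := modulus_reim z; rewrite h1 normr1; lra.
have m1 z : E z -> 1 <= modulus z.
  by move=> [h1 _]; have := im_le z; rewrite h1 normr1.
have hV := holV (hol_id bE) ltr01 m1.
exists E, (fun t => - 1 / t ^+ 2); split; first split=> //.
- by rewrite /E !reimE'; split; [lra|rewrite ler_norml; lra].
- by rewrite /E !reimE'; split; [lra|rewrite ler_norml; lra].
move=> z Ez; have [h1 h2] := Ez; have mz := m1 z Ez.
have z0 : z != 0 by rewrite -modulus_gt0; lra.
have zE : z^-1 - - (ii * rc (3 / 4)) = (1 + ii * rc (3 / 4) * z) / z by field.
rewrite zE modulusM modulusV ler_pdivrMr; last by lra.
rewrite -(@ler_pXn2r _ 2)// ?nnegrE ?modulus_ge0//; last by rewrite mulr_ge0 ?modulus_ge0//; lra.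
rewrite exprMn !modulus_sqr !reimE' h1.
move: h2; rewrite ler_norml => /andP[h2 h3].
have : re z ^+ 2 <= 1 by nra.
lra.
Qed.

(** Replacing 1 / z by -3i/4 gives 3i/2 on a side of length 2, with an error of at most 6/5. *)
Lemma kappa_neq0 : kappa != 0.
Proof.
have [E [f' [[cE bE hi E1 E2] H]]] := top_side.
pose lam : K := - (ii * rc (3 / 4)).
have hf := holD (hol_prim cE hi bE E1) (holN (holZ lam (hol_id bE))).
have hh := holD hi (holN (hol_cst E (lam * 1))).
have bd z : E z -> modulus (z^-1 + - (lam * 1)) <= 3 / 5 by rewrite mulr1; exact: H.
have := hol_mvi cE bE hf hh E1 E2 bd; rewrite (prim_refl cE hi E1) -/kappa.
have e2 : (1 - ii) * (1 + ii) = 2 :> K.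
  have -> : (1 - ii) * (1 + ii) = 1 - ii * ii :> K by ring.
  by rewrite ii2; ring.
have -> : kappa + - (lam * (ii * (1 + ii))) - (0 + - (lam * (1 + ii))) =
  kappa + lam * ((1 - ii) * (1 + ii)) by ring.
have -> : ii * (1 + ii) - (1 + ii) = - ((1 - ii) * (1 + ii)) :> K by ring.
rewrite e2 => h; apply/eqP => k0; move: h; rewrite k0 add0r.
rewrite modulusN modulusM modulusN modulusM modulus_ii modulus_rc modulus_nat.
by rewrite ger0_norm; lra.
Qed.

End PrimitiveAlgebra.

(** * Convex regions off the punctures, and squares *)

Section Regions.
Variables (R : realType) (M : nat).
Local Notation K := (CC R).
Implicit Types (e B : R) (z : K).

Lemma regionP (E : K -> Prop) e : convex E -> bounded E -> is_open E -> 0 < e ->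
  (forall t n, E t -> e <= modulus (t - n%:R)) -> region M E /\ off_zero E.
Proof.
move=> cE bE oE e0 h; split; last by exists e => // t /(h t 0%N); rewrite subr0.
by split=> //; exists e => // t n Et _; exact: h.
Qed.

(* the points of modulus < B on the side s of the real axis, at distance > e *)
Definition side_region (s : bool) e B z :=
  modulus (z - 0) < B /\ half_plane ((-1) ^+ s * - ii) e z.

Lemma side_regionE s e B z : side_region s e B z <->
  modulus z < B /\ e < (-1) ^+ s * im z.
Proof.
rewrite /side_region /half_plane subr0.
suff -> : re ((-1) ^+ s * - ii * z) = (-1) ^+ s * im z by [].
by case: s; rewrite ?expr1 ?expr0 !(@reimE' R); ring.
Qed.

Lemma side_regionP s e B : 0 < e -> region M (side_region s e B) /\ off_zero (side_region s e B).
Proof.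
move=> e0; apply: (@regionP _ e) => //.
- by apply: convexI; [exact: ball_convex|exact: half_plane_convex].
- exact: boundedI (@ball_bounded R 0 B).
- by apply: is_openI; [exact: ball_open|exact: half_plane_open].
- move=> t n /side_regionE[_ h]; have := im_le (t - n%:R).
  rewrite !(@reimE' R) subr0 ler_norml => /andP[h1 h2].
  case: s h => h; move: h; rewrite ?expr1 ?expr0 => *; lra.
Qed.

(* the points with k + 1/4 < Re < k + 3/4 *)
Definition strip_region (k : nat) B z :=
  modulus (z - 0) < B /\ half_plane 1 (k%:R + 1 / 4) z /\ half_plane (-1) (- (k%:R + 3 / 4)) z.

Lemma strip_regionE k B z : strip_region k B z <->
  modulus z < B /\ k%:R + 1 / 4 < re z /\ re z < k%:R + 3 / 4.
Proof.
rewrite /strip_region /half_plane subr0 [1 * z]mul1r mulN1r reN.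
by split=> -[h1 [h2 h3]]; split=> //; split=> //; lra.
Qed.

Lemma strip_regionP k B : region M (strip_region k B) /\ off_zero (strip_region k B).
Proof.
apply: (@regionP _ (1 / 4)) => //.
- by apply: convexI; [exact: ball_convex|apply: convexI; exact: half_plane_convex].
- exact: boundedI (@ball_bounded R 0 B).
- by apply: is_openI; [exact: ball_open|apply: is_openI; exact: half_plane_open].
- move=> t n /strip_regionE[_ [h1 h2]]; have := re_le (t - n%:R).
  rewrite !(@reimE' R) ler_norml => /andP[h3 h4].
  case: (ltnP k n) => kn.
    have : (k%:R + 1 : R) <= n%:R by rewrite natr1 ler_nat.
    lra.
  have : (n%:R : R) <= k%:R by rewrite ler_nat.
  lra.
Qed.

Lemma cornerE (c : K) (r : R) k : [/\ corner c r k.*2 = c + rc r * ((-1) ^+ k * (1 + ii)) &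
  corner c r k.*2.+1 = c + rc r * ((-1) ^+ k * (ii - 1))].
Proof.
have e : (ii : K) ^+ k.*2 = (-1) ^+ k by rewrite -muln2 mulnC exprM expr2 ii2.
rewrite /corner exprSr e; split=> //; congr (_ + rc r * _).
have -> : ii - 1 = ii * (1 + ii) :> K by rewrite mulrDr ii2; ring.
by ring.
Qed.

Lemma re_im_corner (c : K) (r : R) : [/\
  re (corner c r 0) = re c + r /\ im (corner c r 0) = im c + r,
  re (corner c r 1) = re c - r /\ im (corner c r 1) = im c + r,
  re (corner c r 2) = re c - r /\ im (corner c r 2) = im c - r &
  re (corner c r 3) = re c + r /\ im (corner c r 3) = im c - r].
Proof.
have [e0 e1] := cornerE c r 0; have [e2 e3] := cornerE c r 1.
rewrite -/(0.*2) in e0 *.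
rewrite e0 e1 e2 e3 !expr0 !expr1 !(@reimE' R).
by split; split; ring.
Qed.

Lemma prim_inv_corner (c : K) (r : R) k : 0 < r ->
  prim (fun t => (t - c)^-1) (corner c r k) (corner c r k.+1) = kappa R.
Proof.
move=> r0; have [F [f' [[cF bF hF F1 F2] _]]] := top_side R.
have i0 : ii != 0 :> K by rewrite -modulus_gt0 modulus_ii.
have a0 : rc r * ii ^+ k != 0 by rewrite mulf_neq0 ?expf_neq0// rc_eq0 gt_eqF.
rewrite /kappa -(prim_inv_affine c cF hF F1 F2 a0) /corner exprSr.
by congr (prim _ (_ + _) (_ + _)); ring.
Qed.

Lemma corner4 (c : K) r k : corner c r k.+4 = corner c r k.
Proof.
rewrite /corner -addn4 exprD (_ : ii ^+ 4 = 1) ?mulr1//.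
by rewrite (exprM ii 2 2) [ii ^+ 2]ii2 expr2 mulrNN mulr1.
Qed.

Lemma square_loop_inv (c : K) (r : R) : 0 < r ->
  square_loop (fun t => (t - c)^-1) (corner c r) = 4 * kappa R.
Proof.
move=> r0; have := prim_inv_corner c 3 r0; rewrite corner4 /square_loop => ->.
by rewrite !prim_inv_corner//; ring.
Qed.

End Regions.

Section Monodromy.
Variables (R : realType) (M : nat) (a b : 'I_M).
Local Notation K := (CC R).
Variables (eta : 'rV[K]_M) (N : 'I_M -> mpoly M K) (Q : mpoly M K).
Hypothesis ab : a != b.
Implicit Types (t v : K) (W u : 'rV[K]_M) (i : 'I_M) (l : 'I_4).

Definition step l : K :=
  nth 0 [:: 1; - rc (Num.sqrt 2); ii; - (ii * rc (Num.sqrt 2))] l.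

(* the residues are normalised so that the monodromy consists of the
   translations by the numbers step l *)
Definition residue l : K := step l / (4 * kappa R).

Local Notation g := (log_form residue).
Local Notation transp := (transport a b eta N Q residue).
Local Notation transl := (@translation R M residue).

(** The base time of the monodromy, above the real axis that carries the punctures, hence joined to
    the upper corners of all squares inside a half-plane. *)
Definition home : K := rc (1 / 2) + ii * rc (1 / 2).

Lemma homeE : re home = 1 / 2 /\ im home = 1 / 2.
Proof. by rewrite /home !(@reimE' R); split; ring. Qed.

Definition bitransport v v' := exists A, transp v v' A /\ transp v' v (- A).

Lemma bitransport_comp v v' v'' :
  bitransport v v' -> bitransport v' v'' -> bitransport v v''.
Proof.
move=> [A [h1 h2]] [B [h3 h4]]; exists (A + B); split.
  exact: transport_comp h1 h3.
by rewrite opprD addrC; exact: transport_comp h4 h2.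
Qed.

Lemma translation_anti E v v' : region M E -> E v -> E v' ->
  transl v' v = - transl v v' :> 'rV[K]_M.
Proof.
move=> [cE bE oE pE] Ev Ev'; apply/rowP => i; rewrite !mxE.
have [g' hg] := hol_log_form residue i bE pE.
exact: (prim_anti cE hg).
Qed.

Lemma bitransport_link E v v' : region M E -> off_zero E -> E v -> E v' ->
  bitransport v v'.
Proof.
move=> rE zE Ev Ev'; exists (transl v v'); split.
  exact: (transport_link ab rE zE Ev Ev').
rewrite -(translation_anti rE Ev Ev').
exact: (transport_link ab rE zE Ev' Ev).
Qed.

Lemma regular_ball t : regular_time M t -> exists2 e : R, 0 < e &
  region M (fun z => modulus (z - t) < e) /\ off_zero (fun z => modulus (z - t) < e).
Proof.
move=> [t0 tn].
have [e e0 [h1 h2]] : exists2 e : R, 0 < e & e <= modulus t /\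
    forall n, (n < 4 * M)%N -> e <= modulus (t - n.+1%:R).
  elim: (4 * M)%N tn => [|m IH] tn; first by exists (modulus t); rewrite ?modulus_gt0.
  have [n nm|e e0 [h1 h2]] := IH; first by apply: tn; exact: ltnW.
  have tm : 0 < modulus (t - m.+1%:R) by rewrite modulus_gt0 subr_eq0 tn.
  exists (Num.min e (modulus (t - m.+1%:R))); first by rewrite lt_min e0.
  split; first by rewrite ge_min h1.
  move=> n; rewrite ltnS leq_eqVlt => /orP[/eqP->|/h2 h]; rewrite ge_min ?h// lexx orbT//.
pose E z := modulus (z - t) < e / 2.
have near z x : E z -> e <= modulus (t - x) -> e / 2 <= modulus (z - x).
  by rewrite /E [modulus (z - t)]modulusB => h h'; have := modulus_tri t z x; lra.
have rE : region M E.
  split; [exact: ball_convex|exact: ball_bounded|exact: ball_open|].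
  by exists (e / 2) => [|z n Ez nM]; [lra|exact: near (h2 n nM)].
exists (e / 2); first lra.
split=> //; exists (e / 2) => [|z Ez]; first lra.
by have := near z 0 Ez; rewrite !subr0; apply.
Qed.

(** A half-plane off the real axis is convex, and the strip 1/4 < Re < 3/4 joins the lower half to
    the upper one between the singular times 0 and 1. A real time is first moved off the axis. *)
Lemma bitransport_home t : regular_time M t -> bitransport t home.
Proof.
have up (s : bool) v v' : 0 < (-1) ^+ s * im v -> 0 < (-1) ^+ s * im v' -> bitransport v v'.
  move=> h h'; pose e := Num.min ((-1) ^+ s * im v) ((-1) ^+ s * im v') / 2.
  have m0 : 0 < Num.min ((-1) ^+ s * im v) ((-1) ^+ s * im v') by rewrite lt_min h.
  have e0 : 0 < e by rewrite divr_gt0.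
  have [rE zE] := side_regionP M s (modulus v + modulus v' + 1) e0.
  have m1 : Num.min ((-1) ^+ s * im v) ((-1) ^+ s * im v') <= (-1) ^+ s * im v.
    by rewrite ge_min lexx.
  have m2 : Num.min ((-1) ^+ s * im v) ((-1) ^+ s * im v') <= (-1) ^+ s * im v'.
    by rewrite ge_min lexx orbT.
  have := modulus_ge0 v; have := modulus_ge0 v' => v0 v'0.
  by apply: (bitransport_link rE zE); apply/side_regionE; rewrite /e; split; lra.
pose low : K := rc (1 / 2) - ii * rc (1 / 2).
have lowE : re low = 1 / 2 /\ im low = - (1 / 2).
  by rewrite /low !(@reimE' R); split; ring.
have low_home : bitransport low home.
  have [rE zE] := @strip_regionP R M 0 10.
  have ml : modulus low < 10.
    by apply: le_lt_trans (modulus_reim _) _; rewrite lowE.1 lowE.2 normrN ger0_norm; lra.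
  have mh : modulus home < 10.
    by apply: le_lt_trans (modulus_reim _) _; rewrite homeE.1 homeE.2 ger0_norm; lra.
  apply: (bitransport_link rE zE); apply/strip_regionE;
    rewrite ?lowE.1 ?homeE.1; split=> //; split; lra.
have nonreal v : im v != 0 -> bitransport v home.
  rewrite neq_lt => /orP[v0|v0].
    apply: bitransport_comp low_home; apply: (up true); rewrite ?lowE.2 expr1; lra.
  by apply: (up false); rewrite ?homeE.2 expr0; lra.
move=> [t0 tn]; have [it|it] := eqVneq (im t) 0; last exact: nonreal.
have [e e0 [rE zE]] := regular_ball (conj t0 tn).
apply: (@bitransport_comp _ (t + ii * rc (e / 4))); last first.
  by apply: nonreal; rewrite !(@reimE' R) it; lra.
apply: (bitransport_link rE zE); rewrite ?subrr ?modulus0//.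
rewrite (_ : _ - t = ii * rc (e / 4)); last by ring.
by rewrite modulusM modulus_ii modulus_rc ger0_norm; lra.
Qed.

End Monodromy.

Section SquareLoop.
Variable R : realType.
Local Notation K := (CC R).
Variables (q : nat -> K) (E : nat -> K -> Prop).
Hypothesis cE : forall k, convex (E k).
Hypothesis qE : [/\ E 0 (q 0) /\ E 0 (q 1), E 1 (q 1) /\ E 1 (q 2),
  E 2 (q 2) /\ E 2 (q 3) & E 3 (q 3) /\ E 3 (q 0)].
Implicit Types f g : K -> K.

(** One convex region for each side: when the loop surrounds a pole, no single convex region can
    carry the integrand. *)
Definition side_hol f := forall k, exists f', hol (E k) f f'.

Lemma square_loopD f g : side_hol f -> side_hol g ->
  square_loop (fun t => f t + g t) q = square_loop f q + square_loop g q.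
Proof.
move=> hf hg; have [[a0 a1] [b1 b2] [c2 c3] [d3 d0]] := qE.
have P k x y : E k x -> E k y -> prim (fun t => f t + g t) x y = prim f x y + prim g x y.
  by move=> Ex Ey; have [f' Hf] := hf k; have [g' Hg] := hg k; exact: (primD (@cE k) Hf Hg Ex Ey).
by rewrite /square_loop (P 0%N)// (P 1%N)// (P 2%N)// (P 3%N)//; ring.
Qed.

Lemma square_loopZ (c : K) f : side_hol f ->
  square_loop (fun t => c * f t) q = c * square_loop f q.
Proof.
move=> hf; have [[a0 a1] [b1 b2] [c2 c3] [d3 d0]] := qE.
have P k x y : E k x -> E k y -> prim (fun t => c * f t) x y = c * prim f x y.
  by move=> Ex Ey; have [f' Hf] := hf k; exact: (primZ c (@cE k) Hf Ex Ey).
by rewrite /square_loop (P 0%N)// (P 1%N)// (P 2%N)// (P 3%N)//; ring.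
Qed.

Lemma square_loop_ext f g : (forall k t, E k t -> f t = g t) ->
  square_loop f q = square_loop g q.
Proof.
move=> e; have [[a0 a1] [b1 b2] [c2 c3] [d3 d0]] := qE.
have P k x y : E k x -> E k y -> prim f x y = prim g x y := prim_ext (@cE k) (e k).
by rewrite /square_loop (P 0%N)// (P 1%N)// (P 2%N)// (P 3%N).
Qed.

Lemma square_loop_sum (I : Type) (s : seq I) (f : I -> K -> K) :
  (forall i, side_hol (f i)) ->
  square_loop (fun t => \sum_(i <- s) f i t) q = \sum_(i <- s) square_loop (f i) q.
Proof.
move=> hf; elim: s => [|i s IH].
  rewrite big_nil (@square_loop_ext _ (fun t => 0 * (fun=> 0) t)).
    by rewrite square_loopZ ?mul0r// => k; exists (fun=> 0); exact: hol_cst.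
  by move=> k t _; rewrite big_nil mulr0.
rewrite big_cons -IH -square_loopD//.
  by apply: square_loop_ext => k t _; rewrite big_cons.
move=> k; have /choice[f' Hf'] := fun i => hf i k.
elim: {IH} s => [|j s [g IH]].
  by exists (fun=> 0); apply: (hol_ext (hol_cst (E k) 0)) => // t _; rewrite big_nil.
exists (fun t => f' j t + g t).
by apply: (hol_ext (holD (Hf' j) IH)) => // t _; rewrite big_cons.
Qed.

End SquareLoop.

(** * Density of the natural combinations of the steps *)

Section StepDensity.
Variable R : realType.
Local Notation K := (CC R).

Lemma sqrt2_bounds : 1 < Num.sqrt (2 : R) < 3 / 2.
Proof.
have h : Num.sqrt (2 : R) ^+ 2 = 2 by rewrite sqr_sqrtr.
have s0 : 0 <= Num.sqrt (2 : R) by exact: sqrtr_ge0.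
apply/andP; split; nra.
Qed.

(* powers of 1 - sqrt 2 are arbitrarily small, of either sign, and of the form
   n - m sqrt 2 with natural numbers n and m *)
Lemma dense_sqrt2 (x e : R) : 0 < e ->
  exists n m : nat, `|n%:R - m%:R * Num.sqrt 2 - x| < e.
Proof.
move=> e0; have /andP[s1 s2] := sqrt2_bounds; set s := Num.sqrt 2 in s1 s2 *.
have ss : s * s = 2 by rewrite -expr2 sqr_sqrtr.
have pw k : exists n m : nat, (1 - s) ^+ k = n%:R - m%:R * s.
  elim: k => [|k [n [m IH]]]; first by exists 1%N, 0%N; rewrite expr0 mul0r subr0.
  exists (n + 2 * m)%N, (n + m)%N; rewrite exprSr IH [(n + 2 * m)%:R]natrD [(2 * m)%:R]natrM natrD.
  rewrite (_ : _ * (1 - s) = n%:R - m%:R * s - n%:R * s + m%:R * (s * s)); last by ring.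
  by rewrite ss; ring.
(* The parity of k gives the power (1 - sqrt 2) ^ k the sign of x, so that a natural multiple of it
   approximates x. *)
have small : exists2 k : nat, (s - 1) ^+ k < e & odd k = (x < 0).
  have e2 : 0 < e / 2 by lra.
  have [k hk] := half_pow_small 1 e2.
  have le j : (s - 1) ^+ j <= 1 / 2 ^+ j.
    rewrite div1r -exprVn lerXn2r ?nnegrE ?subr_ge0 ?invr_ge0 ?(ltW s1)//; lra.
  have [kx|kx] := eqVneq (odd k) (x < 0); first by exists k => //; have := le k; lra.
  exists k.+1; last by move: kx => /=; case: (odd k); case: (x < 0).
  rewrite exprS; have := le k; have : 0 <= (s - 1) ^+ k by rewrite exprn_ge0//; lra.
  nra.
have [k ke kx] := small; have [n [m nm]] := pw k.
set p := (s - 1) ^+ k in ke.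
have p0 : 0 < p by rewrite exprn_gt0// subr_gt0.
have [j hj] : exists j : nat, j%:R * p <= `|x| < (j%:R + 1) * p.
  exists (Num.truncn (`|x| / p)).
  have x0 : 0 <= `|x| / p by rewrite divr_ge0// ltW.
  have := truncn_itv x0; rewrite -natr1 => /andP[h1 h2].
  by rewrite -ler_pdivlMr// h1 -ltr_pdivrMr.
exists (j * n)%N, (j * m)%N.
have -> : (j * n)%:R - (j * m)%:R * s = j%:R * (n%:R - m%:R * s) by rewrite !natrM; ring.
rewrite -nm (_ : 1 - s = - (s - 1)); last by ring.
rewrite exprNn -signr_odd kx -/p; move: hj => /andP[h1 h2].
case: (ltP x 0) h1 h2 => [x0|x0]; rewrite ?expr1 ?expr0 ?mulN1r ?mul1r.
  by rewrite ltr0_norm// ltr_norml => h1 h2; apply/andP; split; lra.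
by rewrite ger0_norm// ltr_norml => h1 h2; apply/andP; split; lra.
Qed.

Lemma dense_steps (z : K) (e : R) : 0 < e ->
  exists n : 'I_4 -> nat, modulus (\sum_l (n l)%:R * step R l - z) < e.
Proof.
move=> e0; have e2 : 0 < e / 2 by lra.
have [n [m h1]] := dense_sqrt2 (re z) e2; have [n' [m' h2]] := dense_sqrt2 (im z) e2.
exists (fun l => nth 0%N [:: n; m; n'; m'] l).
set s := Num.sqrt 2 in h1 h2.
have -> : \sum_(l < 4) (nth 0%N [:: n; m; n'; m'] l)%:R * step R l =
    rc (n%:R - m%:R * s) + ii * rc (n'%:R - m'%:R * s).
  by rewrite !big_ord_recl big_ord0 /step /= !rcB !rcM !rc_nat -/s; ring.
apply: le_lt_trans (modulus_reim _) _.
have -> : re (rc (n%:R - m%:R * s) + ii * rc (n'%:R - m'%:R * s) - z) = n%:R - m%:R * s - re z.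
  by rewrite reB reD [re (ii * _)]reM !re_rc !im_rc re_ii; ring.
have -> : im (rc (n%:R - m%:R * s) + ii * rc (n'%:R - m'%:R * s) - z) = n'%:R - m'%:R * s - im z.
  by rewrite imB imD [im (ii * _)]imM !re_rc !im_rc re_ii im_ii; ring.
lra.
Qed.

End StepDensity.

Section MonodromyAction.
Variables (R : realType) (M : nat) (a b : 'I_M).
Local Notation K := (CC R).
Variables (eta : 'rV[K]_M) (N : 'I_M -> mpoly M K) (Q : mpoly M K).
Hypothesis ab : a != b.
Implicit Types (t v : K) (W u : 'rV[K]_M) (i : 'I_M) (l : 'I_4) (n : nat).

Local Notation residue := (residue R).
Local Notation step := (step R).
Local Notation home := (home R).
Local Notation g := (log_form residue).
Local Notation transp := (transport a b eta N Q residue).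
Local Notation transl := (@translation R M residue).
Local Notation reach := (reach a b eta N Q residue).

Section OnePuncture.
Variable n : nat.

(* the four regions around the square loop about n.+1 *)
Definition side (k : nat) : K -> Prop :=
  match k with
  | 0 => side_region false (1 / 4) (n%:R + 10)
  | 1 => strip_region n (n%:R + 10)
  | 2 => side_region true (1 / 4) (n%:R + 10)
  | _ => strip_region n.+1 (n%:R + 10)
  end.
Local Notation q := (corner (n.+1%:R : K) (1 / 2)).

Lemma sideP k : region M (side k) /\ off_zero (side k).
Proof.
by case: k => [|[|[|k]]]; [apply: side_regionP; lra|exact: strip_regionP|
  apply: side_regionP; lra|exact: strip_regionP].
Qed.

Lemma corner_small k : modulus (q k) < n%:R + 10.
Proof.
rewrite /corner; apply: le_lt_trans (modulusD _ _) _.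
rewrite !modulusM modulusX modulus_ii expr1n modulus_rc modulus_nat.
have := modulusD 1 (ii : K); have -> : `|1 / 2 : R| = 1 / 2 by rewrite ger0_norm; lra.
rewrite modulus1 modulus_ii -natr1.
have : (0 : R) <= n%:R by []; lra.
Qed.

Lemma puncture_corner : [/\
  re (q 0) = n%:R + 3 / 2 /\ im (q 0) = 1 / 2, re (q 1) = n%:R + 1 / 2 /\ im (q 1) = 1 / 2,
  re (q 2) = n%:R + 1 / 2 /\ im (q 2) = - (1 / 2) &
  re (q 3) = n%:R + 3 / 2 /\ im (q 3) = - (1 / 2)].
Proof.
have [[r0 i0] [r1 i1] [r2 i2] [r3 i3]] := re_im_corner (n.+1%:R : K) (1 / 2).
have e : (n.+1%:R : R) = n%:R + 1 by rewrite natr1.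
rewrite r0 r1 r2 r3 i0 i1 i2 i3 re_nat im_nat e; split; split; lra.
Qed.

Lemma side_corner : [/\ side 0 (q 0) /\ side 0 (q 1), side 1 (q 1) /\ side 1 (q 2),
  side 2 (q 2) /\ side 2 (q 3) & side 3 (q 3) /\ side 3 (q 0)].
Proof.
have [[r0 i0] [r1 i1] [r2 i2] [r3 i3]] := puncture_corner.
have e : (n.+1%:R : R) = n%:R + 1 by rewrite natr1.
split; split; rewrite /side; (apply/side_regionE || apply/strip_regionE);
  (split; first exact: corner_small);
  rewrite ?r0 ?r1 ?r2 ?r3 ?i0 ?i1 ?i2 ?i3 ?expr0 ?expr1 ?e; lra.
Qed.

Lemma side_dist k t : side k t -> 1 / 4 <= modulus (t - n.+1%:R).
Proof.
have hr := re_le (t - n.+1%:R); have hi := im_le (t - n.+1%:R).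
have e : (n.+1%:R : R) = n%:R + 1 by rewrite natr1.
move: hr hi; rewrite reB imB re_nat im_nat subr0 !ler_norml e.
move=> /andP[h1 h2] /andP[h3 h4].
by case: k => [|[|[|k]]] /=; (move=> /side_regionE[_] || move=> /strip_regionE[_ []]);
  rewrite ?expr0 ?expr1 ?e => *; lra.
Qed.

Lemma side_off k t : side k t -> t != n.+1%:R.
Proof. by move=> /side_dist h; rewrite -subr_eq0 -modulus_gt0; lra. Qed.

Lemma hol_side_inv k : exists f', hol (side k) (fun t => (t - n.+1%:R)^-1) f'.
Proof.
have [[cE bE oE pE] zE] := sideP k.
have e0 : (0 : R) < 1 / 4 by lra.
eexists; apply: holV e0 (@side_dist k).
exact: (holD (hol_id bE) (hol_cst (side k) (- n.+1%:R))).
Qed.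

Definition log_term (c : K) m t : K := c * (t ^+ 2 / (m.+1%:R ^+ 2 * (t - m.+1%:R))).

(** By partial fractions t^2 / (d^2 (t - d)) = 1 / (t - d) + (t + d) / d^2. The polynomial part has
    zero integral, and for another pole the whole square lies in a convex region of holomorphy. *)
Lemma log_term_loop (c : K) m :
  square_loop (log_term c m) q = if m == n then c * (4 * kappa R) else 0.
Proof.
have cS k : convex (side k) by have [[]] := sideP k.
have bS k : bounded (side k) by have [[]] := sideP k.
case: eqP => [->|/eqP mn].
  pose d : K := n.+1%:R.
  have d0 : d != 0 by rewrite pnatr_eq0.
  have hd k : hol (side k) (fun t => t + d) (fun=> 1 + 0) := holD (hol_id (@bS k)) (hol_cst _ d).
  rewrite (@square_loop_ext _ _ _ cS side_corner _
    (fun t => c * ((t - d)^-1 + d ^- 2 * (t + d)))); last first.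
    move=> k t kt; have td : t - d != 0 by rewrite subr_eq0; exact: side_off kt.
    by rewrite /log_term -/d; clearbody d; field; apply/andP.
  have s1 : side_hol side (fun t => (t - d)^-1) by move=> k; exact: hol_side_inv.
  have s2 : side_hol side (fun t => d ^- 2 * (t + d)).
    by move=> k; exists (fun=> d ^- 2 * (1 + 0)); exact: holZ.
  have s3 : side_hol side (fun t => (t - d)^-1 + d ^- 2 * (t + d)).
    by move=> k; have [f' H] := s1 k; have [f2 H2] := s2 k; eexists; exact: holD H H2.
  rewrite (square_loopZ cS side_corner _ s3) (square_loopD cS side_corner s1 s2).
  rewrite square_loop_inv; last by lra.
  rewrite (_ : square_loop (fun t => d ^- 2 * (t + d)) q = 0) ?addr0//.
  apply: (@square_loop0 R (fun t => modulus (t - 0) < n%:R + 10) _ (fun=> d ^- 2 * (1 + 0))).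
  - exact: ball_convex.
  - exact: holZ (holD (hol_id (@ball_bounded R 0 _)) (hol_cst _ d)).
  - by move=> k; rewrite subr0 corner_small.
(* The only puncture in this strip is n + 1, which is not the pole of the integrand here. *)
pose E (t : K) := modulus (t - 0) < n%:R + 10 /\
  half_plane 1 (n%:R + 1 / 4) t /\ half_plane (-1) (- (n%:R + 7 / 4)) t.
have EE t : E t <-> modulus t < n%:R + 10 /\ n%:R + 1 / 4 < re t /\ re t < n%:R + 7 / 4.
  rewrite /E /half_plane subr0 [1 * t]mul1r mulN1r reN.
  by split=> -[h1 [h2 h3]]; split=> //; split=> //; lra.
have cE : convex E.
  by apply: convexI; [exact: ball_convex|apply: convexI; exact: half_plane_convex].
have bE : bounded E by exact: boundedI (@ball_bounded R 0 _).
have [|g' hg] := @hol_log_term R E c m bE.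
  exists (1 / 4) => [|t /EE[_ [h1 h2]]]; first lra.
  have := re_le (t - m.+1%:R); rewrite !(@reimE' R) ler_norml => /andP[h3 h4].
  move: mn; rewrite neq_ltn => /orP[mn|mn].
    have : (m.+1%:R : R) <= n%:R by rewrite ler_nat.
    lra.
  have : (n%:R + 1 + 1 : R) <= m.+1%:R by rewrite !natr1 ler_nat.
  lra.
apply: (square_loop0 cE hg).
have [[r0 i0] [r1 i1] [r2 i2] [r3 i3]] := puncture_corner.
move=> k; elim/ltn_ind: k => k IH.
case: k IH => [|[|[|[|k]]]] IH; last by rewrite corner4; apply: IH; rewrite !ltnS leqW// leqW// leqW.
all: by apply/EE; (split; first exact: corner_small); rewrite ?r0 ?r1 ?r2 ?r3; lra.
Qed.

End OnePuncture.

(** The path from [home] to the square around [(puncture i l).+1] and back cancels. On the square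
    only [log_form i] has a pole inside, with the residue normalised to give [step l]. *)
Lemma monodromy i l : transp home home (step l *: delta_mx 0 i).
Proof.
pose n := puncture i l; pose q := corner (n.+1%:R : K) (1 / 2).
have [[q00 q01] [q11 q12] [q22 q23] [q33 q30]] := side_corner n.
have hh : side n 0 home.
  apply/side_regionE; rewrite (homeE R).2 expr0; split; last by lra.
  apply: le_lt_trans (modulus_reim _) _; rewrite (homeE R).1 (homeE R).2 ger0_norm; last by lra.
  have : (0 : R) <= n%:R by []; lra.
have L k v v' : side n k v -> side n k v' -> transp v v' (transl v v').
  by have [rE zE] := sideP n k => kv kv'; exact: (transport_link ab rE zE kv kv').
have T := transport_comp (L _ _ _ hh q00) (transport_comp (L _ _ _ q00 q01)
  (transport_comp (L _ _ _ q11 q12) (transport_comp (L _ _ _ q22 q23)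
  (transport_comp (L _ _ _ q33 q30) (L _ _ _ q00 hh))))).
move: T; set A := (X in transport _ _ _ _ _ _ _ _ X).
suff -> : A = step l *: delta_mx 0 i by [].
have [rE _] := sideP n 0.
have h2 := translation_anti rE hh q00.
have -> : A = transl (q 0) (q 1) + transl (q 1) (q 2) + transl (q 2) (q 3) + transl (q 3) (q 0).
  by rewrite /A h2 !addrA [LHS]addrC !addrA addNr add0r.
apply/rowP => j; rewrite !mxE -/(square_loop (g j) q) eqxx /=.
have cS k : convex (side n k) by have [[]] := sideP n k.
have hS l' : side_hol (side n) (log_term (residue l') (puncture j l')).
  move=> k; have [[_ bE _ [e e0 he]] _] := sideP n k.
  by apply: hol_log_term => //; exists e => // t kt; exact: he _ _ kt (puncture_lt j l').
have -> : square_loop (g j) q =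
    \sum_(l' < 4) square_loop (log_term (residue l') (puncture j l')) q.
  exact: (square_loop_sum cS (side_corner n) (index_enum 'I_4) hS).
under eq_bigr do rewrite log_term_loop.
have resE l' : residue l' * (4 * kappa R) = step l'.
  by rewrite /residue divfK// mulf_neq0 ?kappa_neq0// pnatr_eq0.
case: (eqVneq j i) => [->|ji]; last first.
  rewrite mulr0 big1// => l' _; case: eqP => // /puncture_inj[e _].
  by rewrite e eqxx in ji.
rewrite mulr1 (bigD1 l)//= eqxx resE big1 ?addr0// => l' ll'.
by case: eqP => // /puncture_inj[_ e]; rewrite e eqxx in ll'.
Qed.

(** The loops around the punctures of i move the coordinate i alone, so the coordinates are adjusted
    one after the other, each by natural multiples of the steps. *)
Lemma reach_home_dense u W (W' : 'rV[K]_M) (e : R) : 0 < e -> reach u home W ->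
  exists2 V, reach u home V & forall i, modulus (V 0 i - W' 0 i) < e.
Proof.
move=> e0 rW.
suff H (s : seq 'I_M) : exists2 V, reach u home V & forall i, i \in s -> modulus (V 0 i - W' 0 i) < e.
  by have [V rV hV] := H (enum 'I_M); exists V => // i; apply: hV; rewrite mem_enum.
elim: s => [|i s [V rV hV]]; first by exists W.
have adds V' l n : reach u home V' -> reach u home (V' + (n%:R * step l) *: delta_mx 0 i).
  elim: n => [|n IH] rV'; first by rewrite mul0r scale0r addr0.
  by rewrite -natr1 mulrDl mul1r scalerDl addrA; apply: monodromy; exact: IH.
have [n hn] := dense_steps (W' 0 i - V 0 i) e0.
exists (V + (\sum_l (n l)%:R * step l) *: delta_mx 0 i).
  rewrite big_ord_recr big_ord_recr big_ord_recr big_ord_recr big_ord0 /= add0r.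
  by rewrite !scalerDl !addrA; exact/adds/adds/adds/adds.
move=> j; rewrite inE !mxE eqxx /=; case: (eqVneq j i) => [-> _|ji /= js].
  by rewrite mulr1 (_ : _ - _ = \sum_l (n l)%:R * step l - (W' 0 i - V 0 i)); last by ring.
by rewrite mulr0 addr0; exact: hV.
Qed.

End MonodromyAction.

(** * Periods along the small loop *)

Section DenseSubgroup.
Variable R : realType.
Local Notation K := (CC R).

(* Approximating with relative error 1/2 suffices: iterate on the remainder. *)
Lemma dense_subgroup (P : K -> Prop) (rho : R) : P 0 ->
  (forall x y, P x -> P y -> P (x + y)) -> 0 < rho ->
  (forall v, modulus v <= rho -> exists2 x, P x & modulus (x - v) <= modulus v / 2) ->
  forall v (e : R), 0 < e -> exists2 x, P x & modulus (x - v) < e.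
Proof.
move=> P0 PD rho0 H.
have PM n x : P x -> P (n%:R * x).
  move=> Px; elim: n => [|n IH]; first by rewrite mul0r.
  by rewrite -natr1 mulrDl mul1r; exact: PD.
have {}H v : exists2 x, P x & modulus (x - v) <= modulus v / 2.
  (* The relative error is unchanged by scaling: a large v is divided by n + 1 and the approximation
     multiplied back. *)
  have [n hn] : exists n : nat, modulus v <= n.+1%:R * rho.
    have [k hk] := half_pow_small (modulus v) rho0.
    exists (2 ^ k)%N; move: hk; rewrite ler_pdivrMr ?exprn_gt0// => hk.
    apply: (le_trans hk); rewrite mulrC; apply: ler_wpM2r; first exact: ltW.
    have -> : (2 ^+ k : R) = (2 ^ k)%:R by rewrite natrX.
    by rewrite ler_nat leqnSn.
  have n0 : (n.+1%:R : K) != 0 by rewrite pnatr_eq0.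
  have m0 : (0 : R) < n.+1%:R by rewrite ltr0n.
  have [|x Px hx] := H (v / n.+1%:R).
    by rewrite modulusM modulusV modulus_nat ler_pdivrMr// mulrC.
  exists (n.+1%:R * x); first exact: PM.
  rewrite (_ : _ - v = n.+1%:R * (x - v / n.+1%:R)); last by field.
  rewrite modulusM modulus_nat; move: hx; rewrite modulusM modulusV modulus_nat => hx.
  have := ler_wpM2l (ltW m0) hx; rewrite (_ : n.+1%:R * (_ / 2) = modulus v / 2)//.
  by field; rewrite gt_eqF.
move=> v e e0; have e2 : 0 < e / 2 by lra.
have [n hn] := half_pow_small (modulus v) e2.
suff [x Px hx] : exists2 x, P x & modulus (x - v) <= modulus v / 2 ^+ n.
  by exists x => //; lra.
elim: n {hn} => [|n [x Px hx]]; first by exists 0; rewrite ?sub0r ?modulusN ?expr0 ?divr1.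
have [y Py hy] := H (v - x); exists (x + y); first exact: PD.
rewrite (_ : x + y - v = y - (v - x)); last by ring.
rewrite exprS invfM; move: hy; rewrite [modulus (v - x)]modulusB; lra.
Qed.

End DenseSubgroup.

(** * The components of the form near the base point *)

Section RationalNearPoint.
Variables (R : realType) (M : nat).
Local Notation K := (CC R).
Variables (N : 'I_M -> mpoly M K) (Q : mpoly M K) (eta : 'rV[K]_M).
Implicit Types (u v : 'rV[K]_M) (i j : 'I_M).

Definition rval i u : K := poly_eval (N i) u / poly_eval Q u.
(** The derivative of the component i in the direction j, by the quotient rule. *)
Definition rgrad i j u : K :=
  poly_eval (mderiv j (N i) * Q - N i * mderiv j Q) u / poly_eval (Q * Q) u.

Definition box (r : R) u := forall i, modulus (u 0 i - eta 0 i) < r.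

Lemma box_bounded r : vbounded (box r).
Proof.
exists (r + \sum_i modulus (eta 0 i)) => v i Ev.
have : modulus (eta 0 i) <= \sum_i modulus (eta 0 i).
  by rewrite (bigD1 i)//= lerDl sumr_ge0// => j _; exact: modulus_ge0.
have := ltW (Ev i); have := modulus_lb (v 0 i) (- eta 0 i).
by rewrite modulusN; lra.
Qed.

Lemma box_center r : 0 < r -> box r eta.
Proof. by move=> r0 i; rewrite subrr modulus0. Qed.

Lemma poly_near_neq0 p : poly_eval p eta != 0 -> exists2 r : R, 0 < r &
  exists2 c : R, 0 < c & forall u, box r u -> c <= modulus (poly_eval p u).
Proof.
move=> p0; have [h _] := mhol_poly p (@box_bounded 1).
have [L L0 lip] := qdiff_lip (@vdist_ge0 R M) h.
have p0' : 0 < modulus (poly_eval p eta) by rewrite modulus_gt0.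
have D0 : 0 < 2 * (L * M%:R + 1) by have := mulr_ge0 L0 (ler0n R M); lra.
pose r := Num.min 1 (modulus (poly_eval p eta) / (2 * (L * M%:R + 1))).
have r0 : 0 < r by rewrite lt_min ltr01 divr_gt0.
have r1 : r <= 1 by rewrite ge_min lexx.
exists r => //; exists (modulus (poly_eval p eta) / 2); first by lra.
move=> u ur; have u1 : box 1 u by move=> i; exact: lt_le_trans (ur i) r1.
have vr : vdist eta u <= M%:R * r.
  rewrite /vdist; apply: (@le_trans _ _ (\sum_(i < M) r)).
    by apply: ler_sum => i _; exact: ltW (ur i).
  by rewrite sumr_const card_ord mulr_natl.
apply: (half_modulus_le (mulr_ge0 L0 (ler0n R M)) (ltW r0)).
  by rewrite ge_min lexx orbT.
by apply: le_trans (lip _ _ (box_center ltr01) u1) _; rewrite -mulrA ler_wpM2l.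
Qed.

Lemma rational_near : poly_eval Q eta != 0 -> exists (r C c : R),
  [/\ 0 < r, 0 <= C, 0 < c,
      forall u, box r u -> c <= modulus (poly_eval Q u) &
      forall u v, box r u -> box r v -> forall i,
      [/\ modulus (rval i u) <= C, modulus (rval i v - rval i u) <= C * vdist u v,
        modulus (rval i v - rval i u - \sum_j rgrad i j u * (v 0 j - u 0 j))
          <= C * vdist u v ^+ 2 &
        forall j, modulus (rgrad i j u) <= C /\
          modulus (rgrad i j v - rgrad i j u) <= C * vdist u v]].
Proof.
move=> Q0; have [r r0 [c c0 hc]] := poly_near_neq0 Q0.
have hp p := mhol_poly p (@box_bounded r).
have hV := mholV (hp Q) c0 hc.
have Qu u : box r u -> poly_eval Q u != 0.
  by move=> ur; rewrite -modulus_gt0; exact: lt_le_trans (hc u ur).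
have hF i : mhol (box r) (rval i) (fun j u => rgrad i j u).
  apply: (mhol_ext (mholM (hp (N i)) hV)) => // j u ur.
  have Q0u := Qu u ur; rewrite /rgrad poly_evalB !poly_evalM.
  move: (poly_eval _ _) (poly_eval _ _) (poly_eval Q u) (poly_eval (N i) u) Q0u => x y z w z0.
  by field.
have hc2 u : box r u -> c * c <= modulus (poly_eval (Q * Q) u).
  by move=> ur; rewrite poly_evalM modulusM ler_pM ?(ltW c0) ?hc.
have hG i j : exists L, 0 <= L /\ forall u v, box r u -> box r v ->
    modulus (rgrad i j v - rgrad i j u) <= L * vdist u v.
  have hV2 := mholV (hp (Q * Q)) (mulr_gt0 c0 c0) hc2.
  have [h _] := mholM (hp (mderiv j (N i) * Q - N i * mderiv j Q)) hV2.
  by have [L L0 lip] := qdiff_lip (@vdist_ge0 R M) h; exists L.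
have /choice[C HC] : forall i, exists C, 0 <= C /\
    forall u v, box r u -> box r v ->
      [/\ modulus (rval i u) <= C, modulus (rval i v - rval i u) <= C * vdist u v,
        modulus (rval i v - rval i u - \sum_j rgrad i j u * (v 0 j - u 0 j))
          <= C * vdist u v ^+ 2 &
        forall j, modulus (rgrad i j u) <= C /\
          modulus (rgrad i j v - rgrad i j u) <= C * vdist u v].
  move=> i; have [h1 [C1 C10 h2]] := hF i.
  have [L L0 lip] := qdiff_lip (@vdist_ge0 R M) h1.
  have [C2 C20 h3] := h1.
  have /choice[L' HL'] := hG i.
  have S0 : 0 <= \sum_j L' j by apply: sumr_ge0 => j _; exact: (HL' j).1.
  exists (C1 + L + C2 + \sum_j L' j); split; first by rewrite !addr_ge0.
  move=> u v ur vr; have [k1 _ k3] := h3 u v ur vr; have := lip u v ur vr.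
  have d0 := vdist_ge0 u v; have d2 := sqr_ge0 (vdist u v).
  set B := _ + \sum_j L' j.
  have b1 : C1 <= B by rewrite /B; clear -C10 L0 C20 S0; lra.
  have b2 : C2 <= B by rewrite /B; clear -C10 L0 C20 S0; lra.
  have b3 : L <= B by rewrite /B; clear -C10 L0 C20 S0; lra.
  have b4 : \sum_j L' j <= B by rewrite /B; clear -C10 L0 C20 S0; lra.
  have up (c' d x : R) : 0 <= d -> c' <= B -> x <= c' * d -> x <= B * d.
    by move=> d'0 /(ler_wpM2r d'0) h h'; exact: le_trans h.
  move=> k2; split; [exact: le_trans k1 b2|exact: up d0 b3 k2|exact: up d2 b2 k3|move=> j].
  have [L'0 /(_ u v ur vr) hL] := HL' j.
  have L'j : L' j <= \sum_j L' j.
    by rewrite (bigD1 j)//= lerDl sumr_ge0// => k _; exact: (HL' k).1.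
  by split; [exact: le_trans (h2 j u ur) b1|exact: up d0 (le_trans L'j b4) hL].
exists r, (\sum_i C i), c; split=> //; first by apply: sumr_ge0 => i _; exact: (HC i).1.
move=> u v ur vr i; have [C0 /(_ u v ur vr)[k1 k2 k3 k4]] := HC i.
have Ci : C i <= \sum_i C i.
  by rewrite (bigD1 i)//= lerDl sumr_ge0// => k _; exact: (HC k).1.
have d0 := vdist_ge0 u v; have d2 := sqr_ge0 (vdist u v).
have c1 := ler_wpM2r d0 Ci; have c2 := ler_wpM2r d2 Ci.
split; [exact: le_trans k1 Ci|exact: le_trans k2 c1|exact: le_trans k3 c2|move=> j].
by have [k5 k6] := k4 j; split; [exact: le_trans k5 Ci|exact: le_trans k6 c1].
Qed.

End RationalNearPoint.

(** * First-order variation of the integrand *)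

Section Variation.
Variables (R : realType) (M : nat) (a b : 'I_M).
Local Notation K := (CC R).
Variables (F : 'I_M -> 'rV[K]_M -> K) (G : 'I_M -> 'I_M -> 'rV[K]_M -> K).
Variable eta : 'rV[K]_M.
Hypothesis ab : a != b.
Implicit Types (t : K) (w u v : 'rV[K]_M) (i j : 'I_M).

Definition off_b w : R := \sum_(j | j != b) modulus (w 0 j).
Definition norm1 w : R := \sum_j modulus (w 0 j).

Lemma off_b_ge0 w : 0 <= off_b w.
Proof. by apply: sumr_ge0 => j _; exact: modulus_ge0. Qed.
Lemma norm1E w : norm1 w = modulus (w 0 b) + off_b w.
Proof. by rewrite /norm1 (bigD1 b). Qed.

(* u and v are the points with parameters 0 and w of the leaves at time t, and
   d is the velocity of the first one. Up to a bounded error, the first-order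
   variation is (d_b F_a - d_a F_b)(eta) / t - F_b(eta) / t ^ 2. *)
Lemma integrand_variation (r C C' : R) : 0 < r -> 0 <= C -> 0 <= C' ->
  (forall u v, box eta r u -> box eta r v -> forall i,
     [/\ modulus (F i u) <= C, modulus (F i v - F i u) <= C * vdist u v,
       modulus (F i v - F i u - \sum_j G i j u * (v 0 j - u 0 j)) <= C * vdist u v ^+ 2 &
       forall j, modulus (G i j u) <= C /\ modulus (G i j v - G i j u) <= C * vdist u v]) ->
  exists2 C1 : R, 0 <= C1 & forall e : R, 0 < e -> e < 1 / 4 ->
  exists2 C2 : R, 0 <= C2 & forall t w u v (d : 'rV[K]_M),
    e / 2 <= modulus t -> modulus t <= 2 * e ->
    box eta r u -> box eta r v ->
    (forall i, modulus (u 0 i - eta 0 i - (if i == a then t else 0)) <= C' * modulus t ^+ 2 /\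
       modulus (d 0 i - (i == a)%:R) <= C' * modulus t) ->
    (forall i, v 0 i - u 0 i = if i == a then 0 else if i == b then w 0 b / t else w 0 i) ->
    modulus (\sum_i F i v * (d 0 i - (if i == b then w 0 b / t ^+ 2 else 0))
      - \sum_i F i u * d 0 i -
      w 0 b * ((G a b eta - G b a eta) / t - F b eta / t ^+ 2))
    <= C1 * modulus (w 0 b) + C2 * (off_b w + norm1 w ^+ 2).
Proof.
move=> r0 C0 C'0 H.
pose m : R := M%:R; have m0 : 0 <= m by [].
pose D0 := 1 + m * C'; have D00 : 0 <= D0 by rewrite addr_ge0// mulr_ge0.
pose B1 := 1 + C'; have B10 : 0 <= B1 by rewrite addr_ge0.
pose K1 := m * (C * D0 * B1 + C * C').
have K10 : 0 <= K1 by rewrite mulr_ge0// addr_ge0 ?mulr_ge0.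
pose K2 := C * D0 ^+ 2 + m * (C * C').
have K20 : 0 <= K2 by rewrite addr_ge0 ?mulr_ge0 ?sqr_ge0.
exists (K1 + K2) => [|e e0 e4]; first exact: addr_ge0.
(* The powers of 2 / e come from |t| >= e / 2. They may appear here but not in K1 and K2, which are
   fixed before e. *)
pose C2 := m * (C * B1) + m * (C * B1) * (2 / e) ^+ 2 + C * (2 / e) ^+ 3.
have e2 : 0 < 2 / e by rewrite divr_gt0.
have e2' := ltW e2.
have C20 : 0 <= C2 by rewrite !addr_ge0 ?mulr_ge0 ?exprn_ge0 ?mulr_ge0 ?invr_ge0 ?(ltW e0).
exists C2 => // t w u v d te1 te2 bx0 bxw Hpsi psi_displacement.
have mt0 : 0 < modulus t by lra.
have t0 : t != 0 by rewrite -modulus_gt0.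
have mt1 : modulus t <= 1 by lra.
have bxe := box_center eta r0.
pose D i := d 0 i.
have sum_le (f : 'I_M -> K) (c : R) : (forall i, modulus (f i) <= c) ->
    modulus (\sum_i f i) <= m * c.
  move=> h; apply: le_trans (modulus_sum _ _ _) _.
  apply: (@le_trans _ _ (\sum_(i < M) c)); first exact: ler_sum.
  by rewrite sumr_const card_ord mulr_natl.
have prod (x y : K) (p q : R) : modulus x <= p -> modulus y <= q -> modulus (x * y) <= p * q.
  by move=> *; rewrite modulusM ler_pM ?modulus_ge0.
have Db i : modulus (D i) <= B1.
  have [_ h] := Hpsi i.
  have := modulusD (D i - (i == a)%:R) (i == a)%:R; rewrite subrK modulus_nat.
  have : ((i == a)%:R : R) <= 1 by case: (i == a).
  have := ler_wpM2l C'0 mt1; rewrite /B1 /D; lra.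
have d0 : vdist eta u <= D0 * modulus t.
  have : vdist eta u <= \sum_i (C' * modulus t + (if i == a then modulus t else 0)).
    apply: ler_sum => i _; have [h _] := Hpsi i.
    have := modulusD (u 0 i - eta 0 i - (if i == a then t else 0)) (if i == a then t else 0).
    rewrite subrK (fun_if (@modulus R)) modulus0.
    have : C' * modulus t ^+ 2 <= C' * modulus t.
      by rewrite ler_wpM2l// expr2 ler_piMl// ltW.
    lra.
  rewrite big_split /= sumr_const card_ord -mulr_natl -big_mkcond big_pred1_eq -/m.
  by rewrite /D0; lra.
(* X1 and X2 compare the terms linear in w_b with their values at eta. The differences are O(t)
   before the division by t and O(t^2) before the division by t^2, hence bounded by a multiple of
   |w_b| uniformly in e. *)
pose X1 := w 0 b / t * (\sum_i G i b u * D i - G a b eta).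
have hX1 : modulus X1 <= K1 * modulus (w 0 b).
  have h : modulus (\sum_i G i b u * D i - G a b eta) <= K1 * modulus t.
    have -> : \sum_i G i b u * D i - G a b eta =
      \sum_i ((G i b u - G i b eta) * D i + G i b eta * (D i - (i == a)%:R)).
      have -> : G a b eta = \sum_i G i b eta * (i == a)%:R.
        by rewrite (bigD1 a)//= eqxx mulr1 big1 ?addr0// => i /negbTE ->; exact: mulr0.
      by rewrite -sumrB; apply: eq_bigr => i _; ring.
    rewrite /K1 -[leRHS]mulrA; apply: (sum_le) => i.
    apply: le_trans (modulusD _ _) _.
    have [_ _ _ /(_ b)[h1 h2]] := H _ _ bxe bx0 i.
    have [_ h3] := Hpsi i.
    have p1 := prod _ _ _ _ h2 (Db i); have p2 := prod _ _ _ _ h1 h3.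
    have : C * vdist eta u * B1 <= C * (D0 * modulus t) * B1.
      by rewrite ler_wpM2r// ler_wpM2l.
    by move: p1 p2; rewrite /D; lra.
  rewrite /X1 modulusM modulusM modulusV.
  rewrite mulrAC ler_pdivrMr//; have := ler_wpM2l (modulus_ge0 (w 0 b)) h; lra.
pose X2 := - (w 0 b / t ^+ 2) * (F b u - F b eta - G b a eta * t).
have hX2 : modulus X2 <= K2 * modulus (w 0 b).
  have h : modulus (F b u - F b eta - G b a eta * t) <= K2 * modulus t ^+ 2.
    have -> : F b u - F b eta - G b a eta * t =
      (F b u - F b eta - \sum_j G b j eta * (u 0 j - eta 0 j)) +
      \sum_j G b j eta * (u 0 j - eta 0 j - (if j == a then t else 0)).
      have -> : G b a eta * t = \sum_j G b j eta * (if j == a then t else 0).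
        by rewrite (bigD1 a)//= eqxx big1 ?addr0// => i /negbTE ->; exact: mulr0.
      have -> : \sum_j G b j eta * (u 0 j - eta 0 j - (if j == a then t else 0)) =
          \sum_j G b j eta * (u 0 j - eta 0 j) - \sum_j G b j eta * (if j == a then t else 0).
        by rewrite -sumrB; apply: eq_bigr => j _; ring.
      by ring.
    apply: le_trans (modulusD _ _) _.
    have [_ _ h1 h2] := H _ _ bxe bx0 b.
    have h3 : modulus (\sum_j G b j eta * (u 0 j - eta 0 j - (if j == a then t else 0)))
       <= m * (C * (C' * modulus t ^+ 2)).
      apply: (sum_le) => j; apply: (prod); first exact: (h2 j).1.
      by have [] := Hpsi j.
    have h4 : C * vdist eta u ^+ 2 <= C * (D0 * modulus t) ^+ 2.
      rewrite ler_wpM2l// lerXn2r ?nnegrE ?vdist_ge0//.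
      by rewrite mulr_ge0// ltW.
    by move: h1 h3 h4; rewrite /K2 exprMn; lra.
  rewrite /X2 modulusM modulusN modulusM modulusV modulusX mulrAC ler_pdivrMr ?exprn_gt0//.
  have := ler_wpM2l (modulus_ge0 (w 0 b)) h; lra.
pose dv j := v 0 j - u 0 j.
(* X3 collects the displacement in the directions other than b, X4 the second-order remainders of
   the components, and X5 the change of F b times the change of velocity. *)
pose X3 := \sum_i (\sum_(j | j != b) G i j u * dv j) * D i.
have hX3 : modulus X3 <= m * (C * B1) * off_b w.
  rewrite /X3 -mulrA; apply: (sum_le) => i.
  rewrite (_ : C * B1 * off_b w = C * off_b w * B1); last by ring.
  apply: (prod) => //; apply: le_trans (modulus_sum _ _ _) _.
  rewrite mulr_sumr; apply: ler_sum => j jb; apply: (prod).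
    by have [_ _ _ /(_ j)[]] := H _ _ bx0 bxw i.
  rewrite /dv psi_displacement (negbTE jb); case: eqP => _ //.
  by rewrite modulus0 modulus_ge0.
have hdv : vdist u v <= 2 / e * norm1 w.
  rewrite mulr_sumr; apply: ler_sum => j _; rewrite psi_displacement.
  have w0 := modulus_ge0 (w 0 j).
  have h2e : 1 <= 2 / e by rewrite ler_pdivlMr//; lra.
  case: eqP => _; first by rewrite modulus0 mulr_ge0// ltW.
  case: eqP => [->|_]; last by rewrite ler_peMl.
  rewrite modulusM modulusV mulrC ler_wpM2r ?modulus_ge0//.
  have -> : 2 / e = (e / 2)^-1 by field; rewrite gt_eqF.
  by rewrite lef_pV2 ?posrE// divr_gt0.
have n0 : 0 <= norm1 w by rewrite norm1E addr_ge0 ?modulus_ge0 ?off_b_ge0.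
pose X4 := \sum_i (F i v - F i u - \sum_j G i j u * dv j) * D i.
have hX4 : modulus X4 <= m * (C * B1) * (2 / e) ^+ 2 * norm1 w ^+ 2.
  rewrite /X4 (_ : _ * _ ^+ 2 * _ = m * (C * (2 / e * norm1 w) ^+ 2 * B1)); last first.
    by rewrite exprMn; ring.
  apply: (sum_le) => i; apply: (prod) => //.
  have [_ _ h _] := H _ _ bx0 bxw i; apply: le_trans h _.
  by rewrite ler_wpM2l// lerXn2r ?nnegrE ?vdist_ge0// mulr_ge0// ltW.
pose X5 := - (w 0 b / t ^+ 2) * (F b v - F b u).
have hX5 : modulus X5 <= C * (2 / e) ^+ 3 * norm1 w ^+ 2.
  have [_ h _ _] := H _ _ bx0 bxw b.
  have h1 : modulus (F b v - F b u) <= C * (2 / e * norm1 w).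
    by apply: le_trans h _; rewrite ler_wpM2l.
  have h2 : modulus (- (w 0 b / t ^+ 2)) <= norm1 w * (2 / e) ^+ 2.
    rewrite modulusN modulusM modulusV modulusX; apply: ler_pM; rewrite ?modulus_ge0 ?invr_ge0 ?exprn_ge0 ?modulus_ge0//.
      by rewrite norm1E lerDl off_b_ge0.
    have -> : 2 / e = (e / 2)^-1 by field; rewrite gt_eqF.
    rewrite exprVn lef_pV2 ?posrE ?exprn_gt0 ?divr_gt0// lerXn2r ?nnegrE//; lra.
  rewrite /X5 (_ : C * (2 / e) ^+ 3 * norm1 w ^+ 2 =
    norm1 w * (2 / e) ^+ 2 * (C * (2 / e * norm1 w))); first exact: (prod).
  by ring.
have -> : \sum_i F i v * (d 0 i - (if i == b then w 0 b / t ^+ 2 else 0))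
      - \sum_i F i u * d 0 i -
    w 0 b * ((G a b eta - G b a eta) / t - F b eta / t ^+ 2) = X1 + X2 + X3 + X4 + X5.
  have -> : \sum_i F i v * (d 0 i - (if i == b then w 0 b / t ^+ 2 else 0)) =
      \sum_i F i v * D i - F b v * (w 0 b / t ^+ 2).
    rewrite (_ : F b v * (w 0 b / t ^+ 2) =
      \sum_i F i v * (if i == b then w 0 b / t ^+ 2 else 0)).
      by rewrite -sumrB; apply: eq_bigr => i _; rewrite -mulrBr.
    by rewrite (bigD1 b)//= eqxx big1 ?addr0// => i /negbTE ->; exact: mulr0.
  have e3 : X3 = \sum_i (\sum_j G i j u * dv j) * D i -
      w 0 b / t * \sum_i G i b u * D i.
    rewrite mulr_sumr -sumrB; apply: eq_bigr => i _.
    rewrite [in RHS](bigD1 b)//= {2}/dv psi_displacement eq_sym (negbTE ab) eqxx.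
    by move: (\sum_(j | _) _) (G i b _) => x y; ring.
  have e5 : X4 = \sum_i F i v * D i - \sum_i F i u * D i -
      \sum_i (\sum_j G i j u * dv j) * D i.
    rewrite -!sumrB; apply: eq_bigr => i _.
    by move: (F i _) (F i _) (\sum_j _) => x y z; ring.
  rewrite e3 e5 /X1 /X2 /X5 -/D.
  rewrite -[\sum_i F i u * d 0 i]/(\sum_i F i u * D i).
  move: (\sum_i F i v * D i) (\sum_i F i u * D i) (\sum_i (\sum_j _) * D i) (\sum_i G i b u * D i).
  move: (F b v) (F b u) (F b eta) (G a b eta) (G b a eta) => x y z g1 g2 s1 s2 s3 s4.
  by field.
have T := modulusD (X1 + X2 + X3 + X4) X5; have T1 := modulusD (X1 + X2 + X3) X4.
have T2 := modulusD (X1 + X2) X3; have T3 := modulusD X1 X2.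
have A1 : 0 <= m * (C * B1) by rewrite !mulr_ge0.
have A2 : 0 <= m * (C * B1) * (2 / e) ^+ 2 by rewrite mulr_ge0// exprn_ge0// ltW.
have A3 : 0 <= C * (2 / e) ^+ 3 by rewrite mulr_ge0// exprn_ge0// ltW.
have o0 := off_b_ge0 w; have q0 := sqr_ge0 (norm1 w).
have := mulr_ge0 A1 q0; have := mulr_ge0 A2 o0; have := mulr_ge0 A3 o0.
by rewrite /C2; lra.
Qed.

End Variation.

(** * Curves over the small punctured disc *)

Section SmallLoop.
Variables (R : realType) (M : nat) (a b : 'I_M).
Local Notation K := (CC R).
Variables (eta : 'rV[K]_M) (N : 'I_M -> mpoly M K) (Q : mpoly M K).
Variable sigma : 'I_4 -> K.
Hypothesis ab : a != b.
Implicit Types (t v : K) (w u : 'rV[K]_M) (i j : 'I_M).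

Local Notation g := (log_form sigma).
Local Notation psi := (curve a b eta sigma 0).
Local Notation psi' := (curve' a b sigma 0).
Local Notation F := (rval N Q).
Local Notation G := (rgrad N Q).

(** The coordinates W stay holomorphic at t = 0, although the leaf goes to infinity there when W_b
    is nonzero; hence the state at time 0 makes sense. *)
Definition small_disc t := modulus (t - 0) < 1 / 2.

Lemma small_disc_puncture t n : small_disc t -> 1 / 2 <= modulus (t - n.+1%:R).
Proof.
rewrite /small_disc subr0 => tr; have := modulusD (n.+1%:R - t) t.
rewrite subrK modulus_nat [modulus (n.+1%:R - t)]modulusB.
have : (1 : R) <= n.+1%:R by rewrite ler1n.
lra.
Qed.

Lemma small_disc_region : region M small_disc.
Proof.
split; [exact: ball_convex|exact: ball_bounded|exact: ball_open|].
by exists (1 / 2) => [|t n /small_disc_puncture-/(_ n)//]; lra.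
Qed.

(** The factor t^2 in each summand of [log_form] gives a double zero at 0, so its primitive from 0
    has a triple one. *)
Lemma log_form_small : exists2 C : R, 0 <= C & forall t i, small_disc t ->
  modulus (g i t) <= C * modulus t ^+ 2 /\ modulus (prim (g i) 0 t) <= C * modulus t ^+ 3.
Proof.
pose C : R := \sum_l modulus (sigma l) * 2.
have C0 : 0 <= C by apply: sumr_ge0 => l _; rewrite mulr_ge0 ?modulus_ge0.
have h1 t i : small_disc t -> modulus (g i t) <= C * modulus t ^+ 2.
  move=> ts; apply: le_trans (modulus_sum _ _ _) _; rewrite mulr_suml.
  apply: ler_sum => l _; set d : K := (puncture i l).+1%:R.
  rewrite modulusM -[leRHS]mulrA ler_wpM2l ?modulus_ge0//.
  rewrite modulusM modulusV modulusM !modulusX mulrC ler_wpM2r ?exprn_ge0 ?modulus_ge0//.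
  have h := small_disc_puncture (puncture i l) ts.
  have d1 : 1 <= modulus d by rewrite modulus_nat ler1n.
  have : 1 * (1 / 2) <= modulus d ^+ 2 * modulus (t - d).
    by apply: ler_pM => //; rewrite ?divr_ge0// exprn_ege1.
  rewrite mul1r => h2; rewrite -[2]invrK lef_pV2 ?posrE ?invr_gt0//; last lra.
  by rewrite -[2^-1]div1r.
exists C => // t i ts; split; first exact: h1.
have [cE bE oE pE] := small_disc_region.
have [g' hg] := hol_log_form sigma i bE pE.
have E0 : small_disc 0 by rewrite /small_disc subrr modulus0; lra.
pose E z := modulus (z - 0) <= modulus t.
have EE z : E z -> small_disc z.
  by rewrite /E /small_disc !subr0 => h; apply: le_lt_trans h _; move: ts; rewrite /small_disc subr0.
have cE' : convex E by exact: disc_convex.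
have bE' : bounded E by exists (modulus t) => z; rewrite /E subr0.
have := hol_mvi cE' bE' (holW EE (hol_prim cE hg bE E0)) (holW EE hg) (x := 0) (y := t)
  (B := C * modulus t ^+ 2).
rewrite (prim_refl cE hg E0) subr0 subr0 -mulrA -exprSr; apply.
- by rewrite /E subrr modulus0 modulus_ge0.
- by rewrite /E subr0.
- move=> z Ez; apply: le_trans (h1 _ i (EE z Ez)) _; rewrite ler_wpM2l//.
  by move: Ez; rewrite /E subr0 => Ez; rewrite lerXn2r ?nnegrE ?modulus_ge0.
Qed.

Lemma psiE w t i : psi w t 0 i =
  if i == a then eta 0 a + t
  else if i == b then eta 0 b + (w 0 b + prim (g b) 0 t) / t
  else eta 0 i + (w 0 i + prim (g i) 0 t).
Proof. by rewrite [LHS]mxE !mxE. Qed.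

Lemma psi'E w t i : psi' w t 0 i =
  if i == a then 1
  else if i == b then g b t / t - (w 0 b + prim (g b) 0 t) / t ^+ 2
  else g i t.
Proof. by rewrite [LHS]mxE !mxE. Qed.

Lemma psi_displacement w t i : psi w t 0 i - psi 0 t 0 i =
  if i == a then 0 else if i == b then w 0 b / t else w 0 i.
Proof.
rewrite !psiE; case: eqP => _; first by rewrite subrr.
case: eqP => _; rewrite mxE.
  by move: (prim _ _ _) => p; ring.
by move: (prim _ _ _) => p; ring.
Qed.

Lemma psi'_displacement w t i :
  psi' w t 0 i = psi' 0 t 0 i - (if i == b then w 0 b / t ^+ 2 else 0).
Proof.
rewrite (psi'E w t i) (psi'E 0 t i); have [->|_] := eqVneq i a.
  by rewrite (negbTE ab) subr0.
case: eqP => _; rewrite ?subr0// mxE.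
by move: (prim _ _ _) (g b t) => p q; ring.
Qed.

(** Even after division by t the triple zero of the primitive leaves O(t^2): the curve with state 0
    is the line eta + t e_a up to second order. *)
Lemma psi_small : exists2 C : R, 0 <= C & forall t i, small_disc t -> t != 0 ->
  modulus (psi 0 t 0 i - eta 0 i - (if i == a then t else 0)) <= C * modulus t ^+ 2 /\
  modulus (psi' 0 t 0 i - (i == a)%:R) <= C * modulus t.
Proof.
have [C C0 H] := log_form_small; exists (2 * C); first by rewrite mulr_ge0.
move=> t i ts t0; have m0 : 0 < modulus t by rewrite modulus_gt0.
have m1 : modulus t <= 1 by move: ts; rewrite /small_disc subr0; lra.
rewrite psiE psi'E; move: (H t i ts) (H t b ts); rewrite !mxE !add0r.
move: (g i t) (prim (g i) 0 t) (g b t) (prim (g b) 0 t) => gi pi gb pb [hg hp] [hgb hpb].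
have e1 : C * modulus t ^+ 3 <= C * modulus t ^+ 2.
  by rewrite ler_wpM2l// exprS ler_piMl ?sqr_ge0.
have e2 : C * modulus t ^+ 2 <= C * modulus t.
  by rewrite ler_wpM2l// expr2 ler_piMl// ltW.
have p1 : 0 <= C * modulus t by rewrite mulr_ge0// ltW.
have p2 : 0 <= C * modulus t ^+ 2 by rewrite mulr_ge0// sqr_ge0.
case: (eqVneq i a) => [->|ia].
  rewrite subrr modulus0 (_ : _ - t = 0) ?modulus0; last by ring.
  by split; lra.
case: (eqVneq i b) => [->|ib]; rewrite !subr0.
  split.
    rewrite addrC addKr modulusM modulusV ler_pdivrMr//.
    by apply: le_trans hpb _; rewrite exprSr mulrA; have := mulr_ge0 p2 (ltW m0); lra.
  apply: le_trans (modulusBD _ _) _; rewrite !modulusM !modulusV modulusX.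
  have h1 : modulus gb / modulus t <= C * modulus t.
    by rewrite ler_pdivrMr// -mulrA -expr2.
  have h2 : modulus pb / modulus t ^+ 2 <= C * modulus t.
    by rewrite ler_pdivrMr ?exprn_gt0// -mulrA -exprS.
  lra.
by rewrite addrC addKr; split; lra.
Qed.

End SmallLoop.

Section SmallLoopSides.
Variables (R : realType) (M : nat) (a b : 'I_M).
Local Notation K := (CC R).
Variables (eta : 'rV[K]_M) (N : 'I_M -> mpoly M K) (Q : mpoly M K).
Variable sigma : 'I_4 -> K.
Hypothesis ab : a != b.
Implicit Types (t v : K) (w u : 'rV[K]_M) (i j : 'I_M).

Local Notation S := (leaf_S a eta).
Local Notation psi := (curve a b eta sigma 0).
Local Notation psi' := (curve' a b sigma 0).
Local Notation integrand w := (lift_integrand N Q (psi w) (psi' w)).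

(** The region of the top side, Im t > e / 2, turned by k right angles. *)
Definition loop_side (e : R) k t := modulus (t - 0) < 2 * e /\ half_plane ((- ii) ^+ k.+1) (e / 2) t.
Local Notation q e := (corner (0 : K) e).

Lemma loop_side_le e k t : loop_side e k t -> e / 2 <= modulus t /\ modulus t <= 2 * e.
Proof.
rewrite /loop_side /half_plane subr0 => -[h1 h2]; split; last exact: ltW.
have := re_le ((- ii) ^+ k.+1 * t); rewrite modulusM modulusX modulusN modulus_ii expr1n mul1r.
by rewrite ler_norml => /andP[_ h3]; lra.
Qed.

Lemma loop_side_region e k : 0 < e -> e < 1 / 4 ->
  [/\ region M (loop_side e k), off_zero (loop_side e k) &
      forall t, loop_side e k t -> small_disc t].
Proof.
move=> e0 e4.
have sd t : loop_side e k t -> small_disc t.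
  by move=> /loop_side_le[_ h]; rewrite /small_disc subr0; lra.
split=> //; last by exists (e / 2) => [|t /loop_side_le[]//]; lra.
split.
- by apply: convexI; [exact: ball_convex|exact: half_plane_convex].
- exact: boundedI (@ball_bounded R 0 _).
- by apply: is_openI; [exact: ball_open|exact: half_plane_open].
- exists (1 / 2) => [|t n /sd/small_disc_puncture-/(_ n)//]; lra.
Qed.

Lemma loop_side_corner e k : 0 < e -> loop_side e k (q e k) /\ loop_side e k (q e k.+1).
Proof.
move=> e0.
have small l : modulus (q e l - 0) < 2 * e.
  rewrite subr0 /corner add0r !modulusM modulusX modulus_ii expr1n mul1r modulus_rc gtr0_norm//.
  rewrite mulrC ltr_pM2r//.
  have h : modulus (1 + ii : K) ^+ 2 = 2 by rewrite modulus_sqr !(@reimE' R); ring.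
  by have := modulus_ge0 (1 + ii : K); nra.
have i1 : - ii * ii = 1 :> K by rewrite mulNr ii2 opprK.
have ik : (- ii) ^+ k * ii ^+ k = 1 :> K by rewrite -exprMn i1 expr1n.
split; split=> //; rewrite /half_plane /corner add0r.
  have -> : (- ii) ^+ k.+1 * (rc e * (ii ^+ k * (1 + ii))) =
     rc e * (- ii * (1 + ii)) * ((- ii) ^+ k * ii ^+ k) by rewrite exprS; ring.
  by rewrite ik mulr1 !(@reimE' R); lra.
have -> : (- ii) ^+ k.+1 * (rc e * (ii ^+ k.+1 * (1 + ii))) =
   rc e * (1 + ii) * ((- ii * ii) * ((- ii) ^+ k * ii ^+ k)) by rewrite !exprS; ring.
by rewrite ik i1 !mulr1 !(@reimE' R); lra.
Qed.

Lemma loop_corner e : 0 < e -> [/\ loop_side e 0 (q e 0) /\ loop_side e 0 (q e 1),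
  loop_side e 1 (q e 1) /\ loop_side e 1 (q e 2), loop_side e 2 (q e 2) /\ loop_side e 2 (q e 3)
  & loop_side e 3 (q e 3) /\ loop_side e 3 (q e 0)].
Proof.
move=> e0; have h k := loop_side_corner k e0.
split=> //; have := h 3; by rewrite corner4.
Qed.

(** The state is taken at time 0, which lies in none of the regions around the sides; to use
    [hol_curve] there, the base time is moved to a corner. *)
Lemma curve_rebase w v t : small_disc v -> small_disc t ->
  curve a b eta sigma v (coords sigma 0 w v) t = psi w t /\
  curve' a b sigma v (coords sigma 0 w v) t = psi' w t.
Proof.
move=> vs ts; have E0 : small_disc (0 : K) by rewrite /small_disc subrr modulus0; lra.
by rewrite /curve /curve' (coordsD sigma w (small_disc_region R M) E0 vs ts).
Qed.

Lemma hol_psi e k w : 0 < e -> e < 1 / 4 ->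
  (forall i, hol (loop_side e k) (fun t => psi w t 0 i) (fun t => psi' w t 0 i)) /\
  exists f : K -> 'rV[K]_M, forall i, hol (loop_side e k) (fun t => psi' w t 0 i) (fun t => f t 0 i).
Proof.
move=> e0 e4; have [rE zE sd] := loop_side_region k e0 e4.
have [qk _] := loop_side_corner k e0; have qs := sd _ qk.
pose W := coords sigma 0 w (q e k).
split.
  move=> i; apply: (hol_ext (hol_curve eta sigma ab W i rE zE qk)) => t kt.
    by rewrite (curve_rebase w qs (sd t kt)).1.
  by rewrite (curve_rebase w qs (sd t kt)).2.
have [f Hf] := hol_curve' sigma ab W rE zE qk; exists f => i.
have eW t : loop_side e k t -> curve' a b sigma (q e k) W t 0 i = psi' w t 0 i.
  by move=> kt; rewrite (curve_rebase w qs (sd t kt)).2.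
exact: (hol_ext (Hf i) eW (fun t _ => erefl)).
Qed.

Lemma leaf_S_lower e t w : e / 2 <= modulus t -> small_disc t ->
  e / 2 * (1 / 2) ^+ (4 * M) <= modulus (poly_eval S (psi w t)).
Proof.
move=> te ts; rewrite poly_evalM tpolyE puncture_polyE leaf_point_time modulusM.
have p n : 0 <= (1 / 2 : R) ^+ n by apply: exprn_ge0; lra.
have h n : (1 / 2 : R) ^+ n <= modulus (\prod_(k < n) (t - k.+1%:R)).
  elim: n => [|n IH]; first by rewrite big_ord0 expr0 modulus1.
  rewrite big_ord_recr /= modulusM exprSr; apply: ler_pM (p n) _ IH (small_disc_puncture n ts); lra.
have [e0|e0] := leP 0 e; first by apply: ler_pM te (h _) => //; lra.
apply: (@le_trans _ _ 0); last by rewrite mulr_ge0 ?modulus_ge0.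
by rewrite mulr_le0_ge0//; lra.
Qed.

End SmallLoopSides.

Section SmallLoopPeriod.
Variables (R : realType) (M : nat) (a b : 'I_M).
Local Notation K := (CC R).
Variables (eta : 'rV[K]_M) (N : 'I_M -> mpoly M K) (Q : mpoly M K).
Variable sigma : 'I_4 -> K.
Hypothesis ab : a != b.
Implicit Types (t v : K) (w u : 'rV[K]_M) (i j : 'I_M).

Local Notation S := (leaf_S a eta).
Local Notation psi := (curve a b eta sigma 0).
Local Notation psi' := (curve' a b sigma 0).
Local Notation integrand w := (lift_integrand N Q (psi w) (psi' w)).
Local Notation q e := (corner (0 : K) e).

(** The period f w is the integral of omega around the square. The integrand is compared with G,
    that of the state 0 plus its explicit first-order variation; G has integral f 0 + T w_b. *)
Lemma small_loop_period : poly_eval Q eta != 0 -> rgrad N Q a b eta != rgrad N Q b a eta ->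
  exists (e d C : R) (T : K) (f : 'rV[K]_M -> K),
  [/\ 0 < e, 0 < d, 0 <= C, T != 0 & forall w, (forall i, modulus (w 0 i) < d) ->
    [/\ good a eta Q (psi w (q e 0)),
        period N (leaf_P a b eta sigma) Q (psi w (q e 0)) (f w) &
        modulus (f w - f 0 - T * w 0 b) <=
          modulus T * modulus (w 0 b) / 8 + C * (off_b b w + norm1 w ^+ 2)]].
Proof.
move=> Q0 D0; have [r [C [c [r0 C0 c0 hc Hr]]]] := rational_near N Q0.
have [C' C'0 Hpsi] := psi_small a b eta sigma.
pose D := rgrad N Q a b eta - rgrad N Q b a eta.
pose T := D * (4 * kappa R).
have T0 : T != 0.
  by rewrite !mulf_neq0 ?subr_eq0 ?kappa_neq0// pnatr_eq0.
have mT0 : 0 < modulus T by rewrite modulus_gt0.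
have [C1 C10 hC1] := integrand_variation ab r0 C0 C'0 Hr.
have p1 : 0 < 2 * C' + 5 by lra.
have p2 : 0 < 64 * (C1 + 1) by lra.
(* The three bounds keep the loop in the small disc, keep the displaced curves in the box of radius
   r, and make 8 e C1 at most |T| / 8. *)
pose e := Num.min (1 / 8) (Num.min (r / (2 * C' + 5)) (modulus T / (64 * (C1 + 1)))).
have e0 : 0 < e by rewrite !lt_min !divr_gt0.
have e8 : e <= 1 / 8 by rewrite ge_min lexx.
have e4 : e < 1 / 4 by clear -e8; lra.
have disc t : modulus t <= 2 * e -> small_disc t.
  by move=> te; rewrite /small_disc subr0; clear -te e4; lra.
have nz t : e / 2 <= modulus t -> t != 0.
  by move=> te; rewrite -modulus_gt0; clear -te e0; lra.
have e20 : 0 <= 2 * e by clear -e0; lra.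
have ee : e ^+ 2 <= 2 * e by rewrite expr2; clear -e0 e8; nra.
have er : e * (2 * C' + 5) <= r.
  by rewrite -ler_pdivlMr// /e !ge_min lexx orbT.
have eT : e * (64 * (C1 + 1)) <= modulus T.
  by rewrite -ler_pdivlMr// /e !ge_min lexx !orbT.
have [C2 C20 H] := hC1 e e0 e4.
pose f w := square_loop (integrand w) (q e).
have C2' : 0 <= 8 * e * C2 by rewrite !mulr_ge0// ltW.
(* With |w_b| < e^2 and |t| >= e / 2 the displacement w_b / t is at most 2 e; the factor 8 e is the
   length of the square. *)
exists e, (e ^+ 2), (8 * e * C2), T, f; split=> //; first by rewrite exprn_gt0.
have bx t w : e / 2 <= modulus t -> modulus t <= 2 * e ->
    (forall i, modulus (w 0 i) < e ^+ 2) -> box eta r (psi w t).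
  move=> te1 te2 hw i.
  have t0 := nz t te1; have ts := disc t te2.
  have [h1 _] := Hpsi t i ts t0; have h2 := psi_displacement a b eta sigma w t i.
  have h3 : modulus (psi w t 0 i - psi 0 t 0 i) <= 2 * e.
    rewrite h2; case: eqP => _; first by rewrite modulus0.
    case: eqP => _; last exact: le_trans (ltW (hw i)) ee.
    rewrite modulusM modulusV ler_pdivrMr ?modulus_gt0//.
    by apply: le_trans (ltW (hw b)) _; rewrite expr2; clear -e0 te1; nra.
  move: h3 h1; move: (psi w t 0 i) (psi 0 t 0 i) (eta 0 i) => x y z h3 h1.
  have h4 : modulus (if i == a then t else 0) <= 2 * e.
    by case: eqP => _ //; rewrite modulus0.
  move: h1 h4; move: (if i == a then t else 0) => s h1 h4.
  have : C' * modulus t ^+ 2 <= C' * e.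
    by rewrite ler_wpM2l// expr2; clear -te1 te2 e0 e8; nra.
  rewrite (_ : x - z = (x - y) + ((y - z - s) + s)); last by ring.
  have := modulusD (x - y) (y - z - s + s); have := modulusD (y - z - s) s.
  by have := mulr_ge0 C'0 (ltW e0); clear -er h1 h3 h4 e0; lra.
have low t w : e / 2 <= modulus t -> modulus t <= 2 * e ->
    (forall i, modulus (w 0 i) < e ^+ 2) ->
    e / 2 * (1 / 2) ^+ (4 * M) * c <= modulus (poly_eval (S * Q) (psi w t)).
  move=> te1 te2 hw; rewrite poly_evalM modulusM; apply: ler_pM.
  - by rewrite mulr_ge0 ?exprn_ge0 ?divr_ge0 ?ltW.
  - exact: ltW.
  - by apply: leaf_S_lower => //; exact: disc.
  - exact/hc/bx.
have cc0 : 0 < e / 2 * (1 / 2) ^+ (4 * M) * c by rewrite !mulr_gt0 ?exprn_gt0 ?divr_gt0.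
have hw0 i : modulus ((0 : 'rV[K]_M) 0 i) < e ^+ 2 by rewrite mxE modulus0 exprn_gt0.
have lift w k : (forall i, modulus (w 0 i) < e ^+ 2) ->
    (exists R', hol (loop_side e k) (integrand w) R') /\
    forall x y z, loop_side e k x -> loop_side e k y ->
    same_leaf (lift_field N (leaf_P a b eta sigma) Q) (ext (psi w x) z)
      (ext (psi w y) (z + prim (integrand w) x y)).
  move=> hw; have [rE zE sd] := loop_side_region M k e0 e4; have [cE bE oE pE] := rE.
  have [h1 [h h2]] := hol_psi eta sigma ab k w e0 e4.
  apply: (@lift_convex R M N _ Q S _ (psi w) (psi' w) h _ cE bE oE h1 h2 _ cc0).
    by move=> s i Es; exact: (curve_leaf_equation eta sigma ab 0 w i rE zE Es).
  by move=> s /loop_side_le[te1 te2]; exact: low.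
move=> w hw; have [[q00 q01] [q11 q12] [q22 q23] [q33 q30]] := loop_corner e0.
split.
- rewrite /good -modulus_gt0; apply: lt_le_trans cc0 _.
  by have [te1 te2] := loop_side_le q00; exact: low.
- move=> z; rewrite /f /square_loop !addrA.
  apply: same_leaf_trans ((lift w 0%N hw).2 _ _ z q00 q01) _.
  apply: same_leaf_trans ((lift w 1%N hw).2 _ _ _ q11 q12) _.
  apply: same_leaf_trans ((lift w 2%N hw).2 _ _ _ q22 q23) _.
  exact: (lift w 3%N hw).2 _ _ _ q33 q30.
pose k0 := rval N Q b eta.
pose G t := integrand 0 t + w 0 b * (D * t^-1 + k0 * (- 1 / t ^+ 2)).
have cE k : convex (loop_side e k) by have [[]] := loop_side_region M k e0 e4.
have bE k : bounded (loop_side e k) by have [[]] := loop_side_region M k e0 e4.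
have hV k : hol (loop_side e k) (fun t => t^-1) (fun t => - 1 / t ^+ 2).
  by have [_ zE _] := loop_side_region M k e0 e4; exact: hol_inv_time.
have hV2 k : exists f', hol (loop_side e k) (fun t => - 1 / t ^+ 2) f'.
  eexists; apply: (hol_ext (holZ (-1) (holM (hV k) (hV k)))) => // t _.
  by rewrite expr2 invfM.
have s1 : side_hol (loop_side e) (integrand 0) by move=> k; have [] := lift 0 k hw0.
have s2 : side_hol (loop_side e) (fun t => D * t^-1).
  by move=> k; eexists; exact: holZ (hV k).
have s3 : side_hol (loop_side e) (fun t => k0 * (- 1 / t ^+ 2)).
  by move=> k; have [f' h] := hV2 k; eexists; exact: holZ h.
have s4 : side_hol (loop_side e) (fun t => D * t^-1 + k0 * (- 1 / t ^+ 2)).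
  by move=> k; have [f2 h2] := s2 k; have [f3 h3] := s3 k; eexists; exact: holD h2 h3.
have s5 : side_hol (loop_side e) (fun t => w 0 b * (D * t^-1 + k0 * (- 1 / t ^+ 2))).
  by move=> k; have [f' h] := s4 k; eexists; exact: holZ h.
have s6 : side_hol (loop_side e) G.
  by move=> k; have [f2 h2] := s1 k; have [f3 h3] := s5 k; eexists; exact: holD h2 h3.
have cor := loop_corner e0.
have eG : square_loop G (q e) = f 0 + T * w 0 b.
  rewrite (square_loopD cE cor s1 s5) (square_loopZ cE cor _ s4) (square_loopD cE cor s2 s3).
  have h k : exists f', hol (loop_side e k) (fun t => t^-1) f' by eexists; exact: hV k.
  rewrite (square_loopZ cE cor D h) (square_loopZ cE cor k0 hV2).
  have -> : square_loop (fun t => t^-1) (q e) = 4 * kappa R.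
    rewrite -(@square_loop_inv R 0 e e0); apply: (square_loop_ext cE cor) => k t _.
    by rewrite subr0.
  (* This integrand has the single-valued primitive 1 / t, so the term in F_b(eta) does not
     contribute. *)
  have -> : square_loop (fun t => - 1 / t ^+ 2) (q e) = 0.
    have ftc k x y : loop_side e k x -> loop_side e k y ->
        prim (fun t => - 1 / t ^+ 2) x y = y^-1 - x^-1.
      by move=> xk yk; have [f' h'] := hV2 k; exact: (prim_ftc (@cE k) (@bE k) (hV k) h' xk yk).
    rewrite /square_loop (ftc _ _ _ q00 q01) (ftc _ _ _ q11 q12) (ftc _ _ _ q22 q23).
    rewrite (ftc _ _ _ q33 q30).
    by move: ((q e 0)^-1) ((q e 1)^-1) ((q e 2)^-1) ((q e 3)^-1) => x0 x1 x2 x3; ring.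
  by rewrite /T /f; move: (square_loop _ _) => x; ring.
have GE t : G t = integrand 0 t + w 0 b * (D * t^-1 + k0 * (- 1 / t ^+ 2)) by [].
clearbody G.
have eX (x y z x' : K) : x' = y + z -> x - y - z = x - x'.
  by move=> ->; rewrite opprD addrA.
rewrite (eX _ _ _ _ eG) {eX} -[f w]/(square_loop (integrand w) (q e)).
set B := C1 * modulus (w 0 b) + C2 * (off_b b w + norm1 w ^+ 2).
have ptw k t : loop_side e k t -> modulus (integrand w t - G t) <= B.
  move=> kt; have [te1 te2] := loop_side_le kt.
  have t0 := nz t te1; have ts := disc t te2.
  have := H t w (psi 0 t) (psi w t) (psi' 0 t) te1 te2 (bx t 0 te1 te2 hw0) (bx t w te1 te2 hw)
    (fun i => Hpsi t i ts t0) (psi_displacement a b eta sigma w t).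
  have -> : \sum_i rval N Q i (psi w t) * (psi' 0 t 0 i - (if i == b then w 0 b / t ^+ 2 else 0))
    = integrand w t by apply: eq_bigr => i _; rewrite -(psi'_displacement sigma ab w t).
  rewrite -[\sum_i rval N Q i (psi 0 t) * psi' 0 t 0 i]/(integrand 0 t).
  have -> : integrand w t - G t = integrand w t - integrand 0 t -
     w 0 b * (D / t - rval N Q b eta / t ^+ 2).
    by rewrite GE -/k0; move: (integrand w t) (integrand 0 t) => x y; ring.
  by [].
have len k : modulus (q e k.+1 - q e k) = 2 * e.
  rewrite /corner !add0r exprS.
  have -> : rc e * (ii * ii ^+ k * (1 + ii)) - rc e * (ii ^+ k * (1 + ii)) =
    rc e * (ii ^+ k * (ii * ii - 1)) by ring.
  rewrite ii2 !modulusM modulusX modulus_ii expr1n modulus_rc gtr0_norm// mul1r.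
  by rewrite -opprD modulusN -[1 + 1]/(2%:R) modulus_nat mulrC.
have side k x y : loop_side e k x -> loop_side e k y -> modulus (y - x) = 2 * e ->
    modulus (prim (integrand w) x y - prim G x y) <= B * (2 * e).
  move=> kx ky <-; have [[f' hf] _] := lift w k hw; have [g' hg] := s6 k.
  exact: (prim_le (@cE k) kx ky hf hg (ptw k)).
have l3 : modulus (q e 0 - q e 3) = 2 * e by rewrite -(corner4 0 e 0) len.
have := side 0%N _ _ q00 q01 (len 0%N); have := side 1%N _ _ q11 q12 (len 1%N).
have := side 2 _ _ q22 q23 (len 2); have := side 3 _ _ q33 q30 l3.
rewrite /square_loop.
set x0 := prim (integrand w) _ _; set x1 := prim (integrand w) _ _.
set x2 := prim (integrand w) _ _; set x3 := prim (integrand w) _ _.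
set y0 := prim G _ _; set y1 := prim G _ _; set y2 := prim G _ _; set y3 := prim G _ _.
move: x0 x1 x2 x3 y0 y1 y2 y3 => x3 x2 x1 x0 y3 y2 y1 y0 h3 h2 h1 h0.
rewrite (_ : x0 + x1 + x2 + x3 - (y0 + y1 + y2 + y3) =
  (x0 - y0) + (x1 - y1) + (x2 - y2) + (x3 - y3)); last by ring.
have := modulusD (x0 - y0 + (x1 - y1) + (x2 - y2)) (x3 - y3).
have := modulusD (x0 - y0 + (x1 - y1)) (x2 - y2); have := modulusD (x0 - y0) (x1 - y1).
have wb0 := modulus_ge0 (w 0 b).
have : e * (64 * C1) * modulus (w 0 b) <= modulus T * modulus (w 0 b).
  by rewrite ler_wpM2r//; clear -eT e0; lra.
by move: h0 h1 h2 h3; rewrite /B; clear -wb0; lra.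
Qed.

End SmallLoopPeriod.

(** * Density *)

Section Density.
Variables (R : realType) (M : nat) (a b : 'I_M).
Local Notation K := (CC R).
Variables (eta : 'rV[K]_M) (N : 'I_M -> mpoly M K) (Q : mpoly M K).
Hypothesis ab : a != b.
Implicit Types (t v : K) (w u : 'rV[K]_M) (i j : 'I_M).

Local Notation sigma := (residue R).
Local Notation S := (leaf_S a eta).
Local Notation plf := (proj_leaf N (leaf_P a b eta sigma) Q).

(** The state of u is transported to [home], moved there by the monodromy, and transported on to
    time s. *)
Lemma reach_dense u s (W' : 'rV[K]_M) (e : R) : good a eta Q u -> regular_time M s -> 0 < e ->
  exists2 V, reach a b eta N Q sigma u s V & forall i, modulus (V 0 i - W' 0 i) < e.
Proof.
move=> gu rs e0; have rt := good_regular gu; have [W eW] := leaf_pointK b rt.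
have [r r0 [rE zE]] := regular_ball rt.
set t := u 0 a - eta 0 a in rt eW rE zE.
have tt : modulus (t - t) < r by rewrite subrr modulus0.
have gW : good a eta Q (leaf_point a b eta t W) by rewrite eW.
have ru : reach a b eta N Q sigma u t W.
  by apply/(reach_good N sigma ab u rE zE tt gW); rewrite eW; exact: proj_leaf_refl.
have [A [hA _]] := bitransport_home eta N Q ab rt.
have [B [_ hB]] := bitransport_home eta N Q ab rs.
(* The way from [home] to s translates by - B, which the target at [home] compensates. *)
have [V rV hV] := reach_home_dense ab (W' + B) e0 (hA _ _ ru).
exists (V - B); first exact: hB.
by move=> i; rewrite !mxE -addrA -opprD [B 0 i + _]addrC; have := hV i; rewrite mxE.
Qed.

(** The target is first perturbed to a good point v, at whose time the states of the leaf are
    dense. *)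
Lemma proj_dense u u0 (r : R) : good a eta Q u -> 0 < r ->
  exists2 u', plf u u' & forall i, modulus (u' 0 i - u0 0 i) < r.
Proof.
move=> gu r0; have SQ0 : S * Q != 0.
  by apply: contraNneq gu => ->; rewrite poly_eval0.
have [|v vr gv] := poly_nonvanishing u0 (e := r / 2) _ SQ0; first lra.
have rt := good_regular gv; have [W eW] := leaf_pointK b rt.
have [q q0 [zE' zE]] := regular_ball rt.
set t := v 0 a - eta 0 a in rt eW zE' zE.
have tt : modulus (t - t) < q by rewrite subrr modulus0.
have [r1 r10 [c c0 hc]] := poly_near_neq0 gv.
have t0 : 0 < modulus t by rewrite modulus_gt0; have [] := rt.
(* The second bound in e is for the coordinate b, where the state is divided by t; r1 keeps the
   point found good. *)
pose p := Num.min (r / 2) r1; pose e := Num.min p (modulus t * p).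
have p0 : 0 < p by rewrite lt_min r10 andbT; lra.
have e0 : 0 < e by rewrite lt_min p0 mulr_gt0.
have [V rV hV] := reach_dense W gu rt e0.
have vV i : modulus (leaf_point a b eta t V 0 i - v 0 i) < p.
  have := hV i; rewrite lt_min => /andP[h1 _].
  have := hV b; rewrite lt_min => /andP[_ h2].
  rewrite -eW !mxE; case: eqP => _; first by rewrite subrr modulus0.
  case: eqP => _; rewrite opprD addrACA subrr add0r// -mulrBl modulusM modulusV.
  by rewrite ltr_pdivrMr// mulrC.
have gV : good a eta Q (leaf_point a b eta t V).
  rewrite /good -modulus_gt0; apply: lt_le_trans c0 (hc _ _) => i.
  by have := vV i; rewrite lt_min => /andP[].
exists (leaf_point a b eta t V).
  exact/(reach_good N sigma ab u zE' zE tt gV).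
move=> i; have := vV i; rewrite lt_min => /andP[h _].
by have := modulus_tri (leaf_point a b eta t V 0 i) (v 0 i) (u0 0 i); have := vr i; lra.
Qed.

(** To approximate a small v, take states w near (v / T) e_b and w' near 0, both on the leaf of u;
    then f w - f w' is a period close to T w_b, hence to v. *)
Lemma period_dense u : poly_eval Q eta != 0 ->
  rgrad N Q a b eta != rgrad N Q b a eta -> good a eta Q u ->
  forall v (e : R), 0 < e ->
  exists2 T, period N (leaf_P a b eta sigma) Q u T & modulus (T - v) < e.
Proof.
move=> Q0 D0 gu.
have [e [d [C [T [f [e0 d0 C0 T0 H]]]]]] := small_loop_period sigma ab Q0 D0.
pose s := corner (0 : K) e 0.
have hw0 i : modulus ((0 : 'rV[K]_M) 0 i) < d by rewrite mxE modulus0.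
have rs : regular_time M s.
  have [g0 _ _] := H 0 hw0; have := good_regular g0.
  by rewrite /curve leaf_point_time.
have [q q0 [rE zE]] := regular_ball rs.
have ss : modulus (s - s) < q by rewrite subrr modulus0.
(* States at time 0 cannot be reached directly, 0 being a singular time; they are translated to the
   corner s and back. *)
have near (w0 : 'rV[K]_M) (m : R) : 0 < m -> (forall i, modulus (w0 0 i) + m <= d) ->
    exists w, [/\ forall i, modulus (w 0 i - w0 0 i) < m,
      period N (leaf_P a b eta sigma) Q u (f w) &
      modulus (f w - f 0 - T * w 0 b) <=
        modulus T * modulus (w 0 b) / 8 + C * (off_b b w + norm1 w ^+ 2)].
  move=> m0 hm; have [V rV hV] := reach_dense (w0 + translation M sigma 0 s) gu rs m0.
  pose w := V - translation M sigma 0 s; exists w.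
  have ww i : modulus (w 0 i - w0 0 i) < m.
    have := hV i; rewrite !mxE.
    by rewrite [w0 0 i + _]addrC opprD addrA.
  have wd i : modulus (w 0 i) < d.
    by have := modulusD (w 0 i - w0 0 i) (w0 0 i); rewrite subrK; have := ww i; have := hm i; lra.
  have [gw pw bw] := H w wd; split=> //.
  have ewV : curve a b eta sigma 0 w s = leaf_point a b eta s V.
    by rewrite /curve coords_translation subrK.
  apply: period_proj_leaf pw; apply: proj_leaf_sym; rewrite ewV in gw *.
  exact/(reach_good N sigma ab u rE zE ss gw).
have mT : 0 < modulus T by rewrite modulus_gt0.
pose m : R := M%:R; have m0 : 0 <= m by [].
(* The states are approximated up to x^2, where x = |v / T|. All errors but |T| x / 8 add up to at
   most Kc x^2, and x0 makes this at most another |T| x / 8, so the total is below |v| / 2. *)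
pose Kc := 3 * modulus T + 2 * C * (m + (m + 2) ^+ 2).
have Kc0 : 0 < Kc by rewrite ltr_wpDr ?mulr_gt0// !mulr_ge0// addr_ge0// sqr_ge0.
pose x0 := Num.min 1 (Num.min (d / 2) (modulus T / (8 * Kc))).
have x00 : 0 < x0 by rewrite !lt_min ltr01 !divr_gt0// mulr_gt0.
apply: (@dense_subgroup R _ (modulus T * x0)).
- exact: period0.
- by move=> x y; exact: periodD.
- exact: mulr_gt0.
move=> v hv; have [->|v0] := eqVneq v 0.
  by exists 0; [exact: period0|rewrite subrr modulus0 mul0r].
pose x := modulus (v / T).
have xE : modulus v = modulus T * x.
  by rewrite /x modulusM modulusV mulrC divfK// gt_eqF.
have xp : 0 < x by rewrite modulus_gt0 mulf_neq0// invr_eq0.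
have xx0 : x <= x0 by move: hv; rewrite xE ler_pM2l.
have [x1 [xd xK]] : x <= 1 /\ (x <= d / 2 /\ x <= modulus T / (8 * Kc)).
  by split; [|split]; apply: le_trans xx0 _; rewrite !ge_min lexx ?orbT.
have x2 : x ^+ 2 <= x by rewrite expr2 ler_piMl// ltW.
have x2p : 0 < x ^+ 2 by rewrite exprn_gt0.
pose w0 : 'rV[K]_M := \row_i (if i == b then v / T else 0).
have [i|w [hw pw bw]] := near w0 (x ^+ 2) x2p.
  by rewrite mxE; case: eqP => _; rewrite ?modulus0 -?/x; clear -x2 xd x2p xp; lra.
have [i|w' [hw' pw' bw']] := near 0 (x ^+ 2) x2p.
  by rewrite mxE modulus0; clear -x2 xd xp; lra.
exists (f w - f w'); first by apply: periodD => //; exact: periodN.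
have off (z y : 'rV[K]_M) : (forall i, i != b -> y 0 i = 0) ->
    (forall i, modulus (z 0 i - y 0 i) < x ^+ 2) -> off_b b z <= m * x ^+ 2.
  move=> y0 hz; apply: (@le_trans _ _ (\sum_(i < M) x ^+ 2)).
    rewrite /off_b big_mkcond; apply: ler_sum => i _; case: ifP => ib; last exact: ltW.
    by have := hz i; rewrite y0// subr0 => /ltW.
  by rewrite sumr_const card_ord mulr_natl.
have ow : off_b b w <= m * x ^+ 2.
  by apply: off hw => i ib; rewrite mxE (negbTE ib).
have ow' : off_b b w' <= m * x ^+ 2 by apply: off hw' => i _; rewrite mxE.
have wb0 : w0 0 b = v / T by rewrite mxE eqxx.
have wb : modulus (w 0 b) <= x + x ^+ 2.
  have := modulusD (w 0 b - w0 0 b) (w0 0 b); rewrite subrK wb0 -/x.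
  by have := hw b; rewrite wb0; clear; lra.
have wb' : modulus (w' 0 b) <= x ^+ 2 by have := hw' b; rewrite mxE subr0 => /ltW.
have ge0 (z : 'rV[K]_M) : 0 <= norm1 z by rewrite (norm1E b) addr_ge0 ?modulus_ge0 ?off_b_ge0.
have nb (z : 'rV[K]_M) : off_b b z <= m * x ^+ 2 -> modulus (z 0 b) <= x + x ^+ 2 ->
    norm1 z ^+ 2 <= (m + 2) ^+ 2 * x ^+ 2.
  move=> h1 h2; rewrite -exprMn lerXn2r ?nnegrE ?ge0//.
    by rewrite mulr_ge0 ?addr_ge0// ltW.
  by rewrite (norm1E b); have := ler_wpM2l m0 x2; clear -h1 h2 x2; lra.
have nw := nb _ ow wb; have nw' := nb w' ow' (ler_wpDl (ltW xp) wb').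
have main : modulus (f w - f w' - v) <= (modulus T * modulus (w 0 b) / 8 + C * (off_b b w + norm1 w ^+ 2)) +
   ((modulus T * modulus (w' 0 b) / 8 + C * (off_b b w' + norm1 w' ^+ 2)) +
    (modulus T * modulus (w 0 b - v / T) + modulus T * modulus (w' 0 b))).
  move: bw bw'; move: (_ + C * _) (_ + C * _) => B B' bw bw'.
  have -> : f w - f w' - v = (f w - f 0 - T * w 0 b) +
      (- (f w' - f 0 - T * w' 0 b) + (T * (w 0 b - v / T) + - (T * w' 0 b))).
    by rewrite mulrBr [T * (v / T)]mulrC divfK//;
      move: (f w) (f w') (f 0) (w 0 b) (w' 0 b) => y1 y2 y3 y4 y5; ring.
  apply: le_trans (modulusD _ _) _; apply: lerD => //.
  apply: le_trans (modulusD _ _) _; apply: lerD; first by rewrite modulusN.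
  by apply: le_trans (modulusD _ _) _; rewrite modulusN !modulusM.
apply: le_trans main _; rewrite xE.
have h1 : modulus T * modulus (w 0 b) <= modulus T * (x + x ^+ 2) by rewrite ler_wpM2l// ltW.
have h2 : modulus T * modulus (w' 0 b) <= modulus T * x ^+ 2 by rewrite ler_wpM2l// ltW.
have h3 : modulus T * modulus (w 0 b - v / T) <= modulus T * x ^+ 2.
  by rewrite ler_wpM2l// ltW//; have := hw b; rewrite wb0.
have h4 : C * (off_b b w + norm1 w ^+ 2) <= C * (m * x ^+ 2 + (m + 2) ^+ 2 * x ^+ 2).
  by rewrite ler_wpM2l// lerD.
have h5 : C * (off_b b w' + norm1 w' ^+ 2) <= C * (m * x ^+ 2 + (m + 2) ^+ 2 * x ^+ 2).
  by rewrite ler_wpM2l// lerD.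
have h6 : Kc * x ^+ 2 <= modulus T * x / 8.
  have : x * (8 * Kc) <= modulus T by rewrite -ler_pdivlMr// mulr_gt0.
  by move=> /(ler_wpM2l (ltW xp)); rewrite expr2; clear; lra.
have h7 : 0 <= modulus T * x ^+ 2 by rewrite mulr_ge0// ltW.
have h8 : Kc * x ^+ 2 = 3 * (modulus T * x ^+ 2) +
  2 * (C * (m * x ^+ 2 + (m + 2) ^+ 2 * x ^+ 2)) by rewrite /Kc; ring.
move: h1 h2 h3 h4 h5 h6 h7 h8.
move: (C * (off_b _ w + _)) => y1; move: (C * (off_b _ w' + _)) => y2.
move: (C * _) => y3; move: (Kc * _) => y4.
by have := ltW (mulr_gt0 mT xp); clear; lra.
Qed.

End Density.

Section LeafDensity.
Variables (R : realType) (M : nat) (a b : 'I_M).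
Local Notation K := (CC R).
Variables (eta : 'rV[K]_M) (N : 'I_M -> mpoly M K) (Q : mpoly M K).
Hypothesis ab : a != b.
Hypothesis Q0 : poly_eval Q eta != 0.
Hypothesis D0 : rgrad N Q a b eta != rgrad N Q b a eta.

Definition dense_field := lift_field N (leaf_P a b eta (residue R)) Q.
Definition bad_locus : mpoly M.+1 K := mwiden (leaf_S a eta * Q).

(** The projected leaf leads close to the x-part of q; the height found there is then corrected by a
    period, which transfers from p to the new point. *)
Lemma same_leaf_dense (p q : 'rV[K]_M.+1) (r : R) : poly_eval bad_locus p != 0 -> 0 < r ->
  exists2 p', same_leaf dense_field p p' & forall i, modulus (p' 0 i - q 0 i) < r.
Proof.
rewrite poly_eval_mwiden => gp r0.
have [u pu hu] := proj_dense N ab (x_part q) gp r0.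
have [z hz] := proj_leafP pu (p 0 ord_max).
have [T pT hT] := period_dense ab Q0 D0 gp (q 0 ord_max - z) r0.
exists (ext u (z + T)).
  rewrite -[X in same_leaf _ X _]ext_x_part.
  by apply: same_leaf_trans hz _; exact: period_proj_leaf pu pT z.
move=> i; case: (unliftP ord_max i) => [j ->|->].
  by rewrite ext_lift; have := hu j; rewrite mxE widen_lift.
by rewrite ext_max; move: hT; rewrite opprB addrA [T + z]addrC.
Qed.

(** The leaves have x_a' = 1, so the component a of the field is the whole factor S * Q; in
    particular the field is not zero. *)
Lemma dense_field_lift : dense_field (lift ord_max a) = bad_locus.
Proof. by rewrite /dense_field /lift_field liftK mulrC /leaf_P eqxx. Qed.

Lemma bad_locus_neq0 : bad_locus != 0.
Proof.
have S0 : leaf_S a eta != 0.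
  (* The time -1 is regular, all singular times being nonnegative integers. *)
  suff : poly_eval (leaf_S a eta) (\row_i (eta 0 a - 1)) != 0.
    by apply: contraNneq => ->; rewrite poly_eval0.
  apply/leaf_S_neq0; rewrite mxE addrAC subrr sub0r; split; first by rewrite oppr_eq0 oner_eq0.
  by move=> n _; rewrite eq_sym -addr_eq0 natr1 pnatr_eq0.
have QN0 : Q != 0 by apply: contraNneq Q0 => ->; rewrite poly_eval0.
have SQ0 : leaf_S a eta * Q != 0 by rewrite mulf_neq0.
have [v _ gv] := poly_nonvanishing 0 (@ltr01 R) SQ0.
apply: contraNneq gv => h.
by rewrite -[v](x_part_ext _ 0) -poly_eval_mwiden -/bad_locus h poly_eval0.
Qed.


Lemma open_near n (U : set 'rV[K]_n) : open U -> forall u, U u ->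
  exists2 r : R, 0 < r & forall v : 'rV[K]_n, (forall i, modulus (v 0 i - u 0 i) < r) -> U v.
Proof. by rewrite openE => oU u /oU /nbhs_row. Qed.

End LeafDensity.

(** * Zero sets of polynomials *)

Section PolynomialZeros.
Variables (R : realType) (n : nat).
Local Notation K := (CC R).
Implicit Types (p : mpoly n K) (u : 'rV[K]_n).

Lemma differentiable_poly_eval p u : differentiable (fun w => poly_eval p w : K) u.
Proof.
elim/mpoly_gen_ind : p => [c|i|p q hp hq|p q hp hq].
- rewrite (_ : (fun _ => _) = cst c); first exact: differentiable_cst.
  by apply/funext => w; rewrite poly_evalC.
- rewrite (_ : (fun _ => _) = (fun w : 'rV[K]_n => w 0 i)); first exact: differentiable_coord.
  by apply/funext => w; rewrite poly_eval_var.
- rewrite (_ : (fun _ => _) = (fun w => poly_eval p w : K) + (fun w => poly_eval q w : K)).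
    exact: differentiableD.
  by apply/funext => w; rewrite poly_evalD.
- rewrite (_ : (fun _ => _) = (fun w => poly_eval p w : K) * (fun w => poly_eval q w : K)).
    exact: differentiableM.
  by apply/funext => w; rewrite poly_evalM.
Qed.

Lemma holomorphic_poly_map k (p : 'I_k -> mpoly n K) :
  holomorphic_on setT (fun w => \row_i poly_eval (p i) w : 'rV[K]_k).
Proof.
move=> u _.
rewrite (_ : (fun _ => _) = \sum_i (fun w => poly_eval (p i) w *: delta_mx 0 i)).
  by apply: differentiable_sum => i; apply: differentiableZl; exact: differentiable_poly_eval.
by apply/funext => w; rewrite fct_sumE [LHS]row_sum_delta; apply: eq_bigr => i _; rewrite mxE.
Qed.

Lemma poly_zeros_analytic p : @analytic_subset K n (affine_space K n) [set u | poly_eval p u = 0].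
Proof.
move=> [] u; exists setT, 1%N, (fun w => \row_(i < 1) poly_eval p w); split=> //.
- exact: openT.
- exact: (holomorphic_poly_map (fun _ : 'I_1 => p)).
move=> w _; split=> [/= h|/rowP/(_ 0)]; last by rewrite !mxE.
by apply/rowP => i; rewrite !mxE.
Qed.

Lemma poly_zeros_closed p : closed [set u : 'rV[K]_n | poly_eval p u = 0].
Proof.
rewrite -openC openE => u /= /eqP pu; apply/nbhs_row.
have [r r0 [c c0 h]] := poly_near_neq0 pu; exists r => // v /h hv /= v0.
by move: hv; rewrite v0 modulus0; lra.
Qed.

Lemma poly_zeros_proper p : p != 0 -> [set u : 'rV[K]_n | poly_eval p u = 0] != setT.
Proof.
move=> p0; have [v _ /eqP pv] := poly_nonvanishing 0 (@ltr01 R) p0.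
by apply/eqP => /seteqP[_ /(_ v I)].
Qed.

End PolynomialZeros.

(** * Rational forms *)

Section DenseField.
Variables (R : realType) (M : nat) (a b : 'I_M).
Local Notation K := (CC R).
Variables (eta : 'rV[K]_M) (N : 'I_M -> mpoly M K) (Q : mpoly M K).
Hypothesis ab : a != b.
Hypothesis Q0 : poly_eval Q eta != 0.
Hypothesis D0 : rgrad N Q a b eta != rgrad N Q b a eta.

Lemma dense_field_generic_leaf : generic_leaf_dense (generated (dense_field a b eta N Q)).
Proof.
exists [set u | poly_eval (bad_locus a eta Q) u = 0]; split.
- exact: poly_zeros_closed.
- exact: poly_zeros_analytic.
- exact/poly_zeros_proper/bad_locus_neq0.
move=> L [p _ ->] [q [pq /= /eqP gq]] U [u Uu] oU.
have [r r0 hU] := open_near oU Uu.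
have [q' qq' hq'] := same_leaf_dense ab Q0 D0 u gq r0.
by exists q'; split; [exact: hU|exact: Relation_Operators.rst_trans pq qq'].
Qed.

End DenseField.

Section RationalForms.
Variables (K : numClosedFieldType) (M : nat) (omega : rational_form K M).

Lemma common_denominator : exists (N : 'I_M -> mpoly M K) (Q : mpoly M K),
  Q != 0 /\ forall i, omega i = tofrac (N i) / tofrac Q.
Proof.
pose n i := (frac (repr (omega i))).1; pose d i := (frac (repr (omega i))).2.
have d0 i : d i != 0 by exact: denom_ratioP.
exists (fun i => n i * \prod_(j | j != i) d j), (\prod_j d j); split.
  by apply/prodf_neq0 => i _.
move=> i; have e : \prod_j d j = d i * \prod_(j | j != i) d j by rewrite (bigD1 i).
have p0 : \prod_(j | j != i) d j != 0 by apply/prodf_neq0 => j _.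
rewrite e !tofracM [LHS]frac_repr -/(n i) -/(d i).
by rewrite -mulf_div divff ?mulr1// tofrac_eq0.
Qed.

Definition grad_numer (N : 'I_M -> mpoly M K) Q i j :=
  mderiv j (N i) * Q - N i * mderiv j Q.

(** The extra factor Q makes a single nonvanishing point serve both purposes: Q is nonzero there and
    the two mixed derivatives differ. *)
Lemma nonclosed_numer N Q : Q != 0 -> (forall i, omega i = tofrac (N i) / tofrac Q) ->
  ~ closed_form omega -> exists a b,
  a != b /\ (grad_numer N Q a b - grad_numer N Q b a) * Q != 0.
Proof.
move=> Q0 oE /existsNP[b /existsNP[a h]]; exists a, b.
have e : grad_numer N Q a b - grad_numer N Q b a != 0.
  rewrite subr_eq0 /grad_numer; apply/eqP => e; apply: h.
  by rewrite (oE a) (oE b) (rat_derivE b (N a) Q0) (rat_derivE a (N b) Q0) e.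
by split; [apply: contraNneq e => ->; rewrite subrr|rewrite mulf_neq0].
Qed.

Lemma grad_numer_neq N Q i j u : poly_eval ((grad_numer N Q i j - grad_numer N Q j i) * Q) u != 0 ->
  poly_eval Q u != 0 /\
  poly_eval (grad_numer N Q i j) u / poly_eval (Q * Q) u !=
  poly_eval (grad_numer N Q j i) u / poly_eval (Q * Q) u.
Proof.
rewrite !poly_evalM mulf_eq0 negb_or poly_evalB subr_eq0 => /andP[xy z0]; split=> //.
by rewrite (inj_eq (mulIf _))// invr_eq0 mulf_neq0.
Qed.

Lemma rat_value_unique (f : ratfun K M) u c c' :
  rat_value f u c -> rat_value f u c' -> c = c'.
Proof.
move=> [p [q [-> q0 ->]]] [p' [q' [e q'0 ->]]].
have t (s : mpoly M K) : poly_eval s u != 0 -> tofrac s != 0.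
  by move=> h; rewrite tofrac_eq0; apply: contraNneq h => ->; rewrite poly_eval0.
move/eqP: e; rewrite eqr_div ?t// -!tofracM tofrac_eq => /eqP/(congr1 (fun s => poly_eval s u)).
by rewrite !poly_evalM => e; apply/eqP; rewrite eqr_div// e.
Qed.

(** Multiplied out, because the common denominator may vanish at a point that is not a pole of the
    component. *)
Lemma rat_evalE N Q i u : Q != 0 -> omega i = tofrac N / tofrac Q ->
  rat_value (omega i) u !=set0 -> rat_eval (omega i) u * poly_eval Q u = poly_eval N u.
Proof.
move=> Q0 oE [c hc]; rewrite /rat_eval (xget_unique 0 hc); last by move=> y /rat_value_unique/(_ hc).
move: hc => [p [q [e q0 ->]]].
have tq : tofrac q != 0 by rewrite tofrac_eq0; apply: contraNneq q0 => ->; rewrite poly_eval0.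
have tQ : tofrac Q != 0 by rewrite tofrac_eq0.
move/eqP: e; rewrite oE (eqr_div _ _ tQ tq) -!tofracM tofrac_eq.
move=> /eqP/(congr1 (fun s => poly_eval s u)); rewrite !poly_evalM => e.
by rewrite mulrAC -e mulfK.
Qed.

End RationalForms.

Section RationalLegendrian.
Variables (R : realType) (M : nat) (omega : rational_form (CC R) M).
Local Notation K := (CC R).

Lemma nonclosed_point N Q : Q != 0 -> (forall i, omega i = tofrac (N i) / tofrac Q) ->
  ~ closed_form omega -> exists a b (eta : 'rV[K]_M),
  [/\ a != b, poly_eval Q eta != 0 & rgrad N Q a b eta != rgrad N Q b a eta].
Proof.
move=> Q0 oE /(nonclosed_numer Q0 oE)[a [b [ab pqQ]]].
have [eta _ /grad_numer_neq[e1 e2]] := poly_nonvanishing 0 (@ltr01 R) pqQ.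
by exists a, b, eta; split.
Qed.

Lemma lift_field_legendrian N Q P : Q != 0 -> (forall i, omega i = tofrac (N i) / tofrac Q) ->
  legendrian_on (generated (lift_field N P Q)) (off_poles omega) (graph_distribution omega).
Proof.
move=> Q0 oE [] u _ /= hu; rewrite /graph_distribution /= mxE lift_field_max poly_eval_sum.
apply: eq_bigr => i _.
rewrite [x_part _ 0 i]mxE widen_lift mxE lift_field_lift !poly_evalM.
by rewrite -(rat_evalE Q0 (oE i) (hu i)) mulrA.
Qed.

Lemma rational_legendrian : ~ closed_form omega -> exists Y : 'I_M.+1 -> mpoly M.+1 K,
  [/\ exists i, Y i != 0,
      legendrian_on (generated Y) (off_poles omega) (graph_distribution omega) &
      generic_leaf_dense (generated Y)].
Proof.
move=> ncl; have [N [Q [Q0 oE]]] := common_denominator omega.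
have [a [b [eta [ab Qe De]]]] := nonclosed_point Q0 oE ncl.
exists (dense_field a b eta N Q); split.
- by exists (lift ord_max a); rewrite dense_field_lift bad_locus_neq0.
- exact: lift_field_legendrian.
- exact: dense_field_generic_leaf.
Qed.

End RationalLegendrian.

(** * Projective space *)

Section Homogenization.
Variables (K : numClosedFieldType) (n : nat).
Implicit Types (p q : mpoly n K) (P : mpoly n.+1 K) (u : 'rV[K]_n) (Z : 'rV[K]_n.+1) (c : K).

Definition homogeneous d P := forall c Z, poly_eval P (c *: Z) = c ^+ d * poly_eval P Z.

Lemma poly_evalX k (P : mpoly k K) d w : poly_eval (P ^+ d) w = poly_eval P w ^+ d.
Proof. by rewrite /poly_eval rmorphXn. Qed.

(** Powers of Z_0 equalise degrees without changing the values on the affine chart, where Z_0 =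
    1. *)
Lemma homogeneous_raise e d P : homogeneous d P -> homogeneous (e + d) (mvar K ord0 ^+ e * P).
Proof.
by move=> h c Z; rewrite !poly_evalM !poly_evalX !poly_eval_var h mxE exprMn exprD; ring.
Qed.

Lemma raise_homogenize e P u :
  poly_eval (mvar K ord0 ^+ e * P) (homogenize ord0 u) = poly_eval P (homogenize ord0 u).
Proof. by rewrite poly_evalM poly_evalX poly_eval_var homogenize_diag expr1n mul1r. Qed.

Lemma homogenization p : exists d P, homogeneous d P /\
  forall u, poly_eval P (homogenize ord0 u) = poly_eval p u.
Proof.
elim/mpoly_gen_ind : p => [c|i|p q [d [P [hP eP]]] [e [Q [hQ eQ]]]|p q [d [P [hP eP]]] [e [Q [hQ eQ]]]].
- by exists 0%N, (mpolyC _ c); split=> [c' Z|u]; rewrite !poly_evalC// mul1r.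
- exists 1%N, (mvar K (lift ord0 i)); split=> [c Z|u]; rewrite !poly_eval_var.
    by rewrite mxE.
  exact: homogenize_lift.
- exists (e + d)%N, (mvar K ord0 ^+ e * P + mvar K ord0 ^+ d * Q); split=> [c Z|u].
    rewrite !poly_evalD (homogeneous_raise e hP) [in RHS]mulrDr; congr (_ + _).
    by rewrite addnC (homogeneous_raise d hQ).
  by rewrite !poly_evalD !raise_homogenize eP eQ.
- exists (d + e)%N, (P * Q); split=> [c Z|u]; rewrite !poly_evalM ?eP ?eQ// hP hQ exprD; ring.
Qed.

(** The common degree is made positive since the differential of the projection to a chart has
    degree -1, which leaves the degree d for the transition factor. *)
Lemma homogenization_family k (Y : 'I_k -> mpoly n K) : exists d (H : 'I_k -> mpoly n.+1 K),
  forall i, homogeneous d.+1 (H i) /\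
    forall u, poly_eval (H i) (homogenize ord0 u) = poly_eval (Y i) u.
Proof.
have /choice[d /choice[P hP]] := fun i => homogenization (Y i).
pose D := \sum_i d i; have dD i : (d i <= D)%N by rewrite /D (bigD1 i)//= leq_addr.
exists D, (fun i => mvar K ord0 ^+ (D.+1 - d i) * P i) => i.
have [h e] := hP i; split=> [|u]; last by rewrite raise_homogenize e.
by have := homogeneous_raise (D.+1 - d i) h; rewrite subnK// leqW.
Qed.

Lemma dehomogenization i P : exists p, forall u, poly_eval p u = poly_eval P (homogenize i u).
Proof.
elim/mpoly_gen_ind : P => [c|j|P Q [p hp] [q hq]|P Q [p hp] [q hq]].
- by exists (mpolyC _ c) => u; rewrite !poly_evalC.
- case: (unliftP i j) => [k ->|->].
    by exists (mvar K k) => u; rewrite !poly_eval_var homogenize_lift.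
  by exists 1 => u; rewrite poly_eval1 poly_eval_var homogenize_diag.
- by exists (p + q) => u; rewrite !poly_evalD hp hq.
- by exists (p * q) => u; rewrite !poly_evalM hp hq.
Qed.

End Homogenization.

(** * The field in the charts of projective space *)

Section ProjectiveField.
Variables (K : numClosedFieldType) (n d : nat) (H : 'I_n -> mpoly n.+1 K).
Hypothesis hH : forall i, homogeneous d.+1 (H i).
Implicit Types (a b : 'I_n.+1) (u v : 'rV[K]_n) (Z : 'rV[K]_n.+1).

(* the components 0, H 0, ..., H (n - 1) of a field on the cone *)
Definition cone_field Z : 'rV[K]_n.+1 :=
  \row_j if unlift ord0 j is Some k then poly_eval (H k) Z else 0.

(** The image of the cone field under the differential of the projection Z_k / Z_a, at the points
    with Z_a = 1. *)
Definition chart_field a u : 'rV[K]_n := \row_k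
  (cone_field (homogenize a u) 0 (lift a k) - u 0 k * cone_field (homogenize a u) 0 a).

Lemma cone_field_homogeneous c Z : cone_field (c *: Z) = c ^+ d.+1 *: cone_field Z.
Proof.
apply/rowP => j; rewrite !mxE; case: unliftP => [k _|_]; first exact: hH.
by rewrite mulr0.
Qed.

Lemma dhomogenize_chart_field a u : dhomogenize a (chart_field a u) =
  cone_field (homogenize a u) - cone_field (homogenize a u) 0 a *: homogenize a u.
Proof.
set Z := homogenize a u; apply/rowP => j; rewrite [RHS]mxE [X in _ + X]mxE [X in _ - X]mxE [LHS]mxE.
case: (unliftP a j) => [k ->|->]; last by rewrite homogenize_diag mulr1 subrr.
by rewrite mxE homogenize_lift mulrC.
Qed.

Lemma dhomogenize_inj a : injective (@dhomogenize K n a).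
Proof.
move=> v w /rowP h; apply/rowP => k.
by have := h (lift a k); rewrite !mxE liftK.
Qed.

Lemma dhomogenize_diag a v : dhomogenize a v 0 a = 0.
Proof. by rewrite mxE unlift_none. Qed.

(** Modulo multiples of Z, the radial direction, both sides lift to the same multiple of the cone
    field. *)
Lemma chart_field_change a b u : homogenize a u 0 b != 0 ->
  chart_field b (CP_change a b u) =
  (homogenize a u 0 b)^-1 ^+ d *: 'd (CP_change a b) u (chart_field a u).
Proof.
move=> h0; have [_ /(_ (chart_field a u))[al E]] := diff_CP_change h0.
apply: (@dhomogenize_inj b).
have dZ c v : dhomogenize b (c *: v) = c *: dhomogenize b v.
  by apply/rowP => j; rewrite !mxE; case: unliftP => [k _|_]; rewrite ?mxE ?mulr0.
rewrite dZ E !dhomogenize_chart_field (homogenize_CP_change h0) cone_field_homogeneous.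
(* Lifts of tangent vectors of chart b have vanishing entry b; this determines the radial
   coefficient. *)
have Eb : al * homogenize a u 0 b + (homogenize a u 0 b)^-1 *
    (cone_field (homogenize a u) 0 b - cone_field (homogenize a u) 0 a * homogenize a u 0 b) = 0.
  have := dhomogenize_diag b ('d (CP_change a b) u (chart_field a u)).
  by rewrite E dhomogenize_chart_field !mxE.
move: (homogenize a u) h0 Eb => Z; move: (cone_field Z) => F.
set h := Z 0 b => h0 Eb.
have -> : al = - (h^-1 * (F 0 b - F 0 a * h)) / h.
  by apply: (mulIf h0); rewrite divfK//; apply/eqP; rewrite -addr_eq0 Eb.
apply/rowP => j; rewrite !mxE -/h exprS.
move: (h^-1 ^+ d) (Z 0 j) (F 0 j) (F 0 a) (F 0 b) => x y z s t; by field.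
Qed.

Lemma chart_field_affine u : chart_field ord0 u = \row_k poly_eval (H k) (homogenize ord0 u).
Proof. by apply/rowP => k; rewrite !mxE liftK unlift_none mulr0 subr0. Qed.

(** If the field vanishes in chart a, the cone field is radial. Its entry 0 is zero whereas Z_0 = 1,
    so the radial factor is zero too. *)
Lemma chart_field_vanish a u : homogenize ord0 u 0 a != 0 ->
  chart_field a (CP_change ord0 a u) = 0 -> forall k, poly_eval (H k) (homogenize ord0 u) = 0.
Proof.
move=> h0 v0 k; have := dhomogenize_chart_field a (CP_change ord0 a u).
have -> : dhomogenize a (chart_field a (CP_change ord0 a u)) = 0.
  by rewrite v0; apply/rowP => j; rewrite !mxE; case: unliftP => [l _|_]; rewrite ?mxE.
rewrite (homogenize_CP_change h0) cone_field_homogeneous.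
set Z := homogenize ord0 u; set c := ((Z 0 a)^-1 ^+ d.+1 *: cone_field Z) 0 a => /esym/eqP; rewrite subr_eq0 => /eqP e.
have c0 : c = 0.
  have F0 : cone_field Z 0 ord0 = 0 by rewrite mxE unlift_none.
  have Z1 : Z 0 ord0 = 1 by exact: homogenize_diag.
  have /rowP/(_ ord0) := e; rewrite [LHS]mxE [RHS]mxE [X in _ = _ * X]mxE F0 Z1 mulr0 mulr1.
  by move=> /esym/eqP; rewrite mulf_eq0 invr_eq0 (negbTE h0) orbF => /eqP.
move: e; rewrite c0 scale0r => /eqP; rewrite scaler_eq0 expf_eq0 invr_eq0 (negbTE h0) andbF /=.
by move=> /eqP/rowP/(_ (lift ord0 k)); rewrite mxE liftK mxE.
Qed.

End ProjectiveField.

(** * Points and open sets of projective space *)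

Section ProjectivePoints.
Local Open Scope quotient_scope.
Variables (K : numClosedFieldType) (n : nat).
Implicit Types (v : nonzero_vectors K n) (u : 'rV[K]_n).

Definition CP_point v : CP K n :=
  \pi_(quotient_topology {eq_quot @collinear_equivRel K n}) v.

Lemma CP_point_surj p : exists v, CP_point v = p.
Proof. by exists (repr p); exact: reprK. Qed.

Lemma CP_point_eq v w : CP_point v = CP_point w <->
  exists c, set_val w = c *: set_val v.
Proof.
split.
  by move=> /eqmodP /=; rewrite /collinear /= => /andP[_] /sub_rVP.
move=> [c e]; apply/eqmodP; rewrite /= /collinear.
have c0 : c != 0.
  apply/eqP => c0; have /set_mem := valP w; rewrite /nonzero_vectors /=.
  by rewrite -set_valE e c0 scale0r eqxx.
rewrite e; apply/andP; split; apply/sub_rVP; last by exists c.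
by exists c^-1; rewrite scalerA mulVf// scale1r.
Qed.

Definition hvector i u : nonzero_vectors K n := exist _ (homogenize i u) (homogenize_neq0 i u).

Lemma CP_point_hvector i u : CP_point (hvector i u) = CP_chart i u.
Proof. by []. Qed.

Lemma set_val_hvector i u : set_val (hvector i u) = homogenize i u.
Proof. by rewrite set_valE. Qed.

Lemma CP_point_chart v i : set_val v 0 i != 0 -> exists u,
  set_val v = set_val v 0 i *: homogenize i u /\ CP_point v = CP_chart i u.
Proof.
move=> v0; exists (\row_k (set_val v 0 (lift i k) / set_val v 0 i)).
have e : set_val v = set_val v 0 i *: homogenize i (\row_k (set_val v 0 (lift i k) / set_val v 0 i)).
  apply/rowP => j; rewrite !mxE; case: unliftP => [k ->|->]; last by rewrite mulr1.
  by rewrite mxE mulrC divfK.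
split=> //; rewrite -CP_point_hvector; apply/esym/CP_point_eq.
by exists (set_val v 0 i); rewrite set_val_hvector.
Qed.

Lemma CP_openP (O : set (CP K n)) : open O <-> exists2 A : set 'rV[K]_n.+1, open A &
  forall v, A (set_val v) <-> O (CP_point v).
Proof.
split=> [[A oA e]|[A oA e]]; exists A => //.
  by move=> v; have /seteqP[h1 h2] := e; split; [exact: h1|exact: h2].
by apply/seteqP; split=> v /e.
Qed.

Definition projective_foliation (H : 'I_n -> mpoly n.+1 K) :
    foliation (projective_space K n) :=
  @Foliation K n (projective_space K n) 'I_n.+1 id (fun _ => setT) (chart_field H).

End ProjectivePoints.

Section ProjectiveFoliation.
Variables (R : realType) (n d : nat).
Local Notation K := (CC R).
Variables (Y : 'I_n -> mpoly n K) (H : 'I_n -> mpoly n.+1 K).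
Hypothesis hH : forall i, homogeneous d.+1 (H i).
Hypothesis eH : forall i u, poly_eval (H i) (homogenize ord0 u) = poly_eval (Y i) u.
Implicit Types (a b : 'I_n.+1) (u v w : 'rV[K]_n).
Local Notation X := (projective_space K n).

Lemma homogenize_coord_poly a b : exists2 p : mpoly n K, p != 0 &
  forall u, poly_eval p u = homogenize a u 0 b.
Proof.
have [p hp] := dehomogenization a (mvar K b); exists p => [|u]; last by rewrite hp poly_eval_var.
suff : poly_eval p (const_mx 1) != 0 by apply: contraNneq => ->; rewrite poly_eval0.
rewrite hp poly_eval_var mxE; case: unliftP => [k _|_]; last exact: oner_neq0.
by rewrite mxE oner_neq0.
Qed.

Lemma chart_field_poly a : exists V : 'I_n -> mpoly n K,
  chart_field H a = fun u => \row_k poly_eval (V k) u.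
Proof.
have h j : exists p : mpoly n K, forall u, poly_eval p u = cone_field H (homogenize a u) 0 j.
  case: (unliftP ord0 j) => [k ->|->].
    have [p hp] := dehomogenization a (H k); exists p => u.
    by rewrite hp mxE liftK.
  by exists 0 => u; rewrite poly_eval0 mxE unlift_none.
have /choice[P hP] := h.
exists (fun k => P (lift a k) - mvar K k * P a); apply/funext => u; apply/rowP => k.
by rewrite !mxE poly_evalB poly_evalM poly_eval_var !hP !mxE.
Qed.

Lemma chart_field_ord0 u : chart_field H ord0 u = \row_k poly_eval (Y k) u.
Proof. by rewrite chart_field_affine; apply/rowP => k; rewrite !mxE eH. Qed.

End ProjectiveFoliation.

Section ChartFieldOverlap.
Variables (K : numClosedFieldType) (n d : nat) (H : 'I_n -> mpoly n.+1 K).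
Hypothesis hH : forall i, homogeneous d.+1 (H i).
Implicit Types (a b : 'I_n.+1) (u : 'rV[K]_n).

Lemma chart_field_transition a b u : homogenize a u 0 b != 0 ->
  let T := @transition K n (projective_space K n) a b in
  chart_field H b (T u) = (homogenize a u 0 b)^-1 ^+ d *: 'd T u (chart_field H a u).
Proof.
move=> h0 T; have [_ TE] := diff_transition h0.
have dTE : 'd (CP_change a b) u (chart_field H a u) =
    'd (@transition K n (projective_space K n) a b) u (chart_field H a u) :=
  esym (congr1 (fun h : _ -> _ => h (chart_field H a u)) TE).
rewrite {}/T (transitionE h0) (chart_field_change hH h0).
exact (congr1 (fun w : 'rV[K]_n => (homogenize a u 0 b)^-1 ^+ d *: w) dTE).
Qed.

Lemma chart_field_overlap a b : let T := @transition K n (projective_space K n) a b in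
  exists g : 'rV[K]_n -> K, forall u, fol_overlap (F := projective_foliation H) a b u ->
    [/\ differentiable g u, g u != 0 &
      chart_field H b (T u) = g u *: 'd T u (chart_field H a u)].
Proof.
move=> T; exists (fun u => (homogenize a u 0 b)^-1 ^+ d) => u [_ [w _ wu]].
have h0 : homogenize a u 0 b != 0 by apply/range_chart; exists w.
split; last exact: (chart_field_transition h0).
- have dV := differentiableV (diff_homogenize a b u).1 h0.
  elim: {T} d => [|e IH]; first exact: differentiable_cst.
  rewrite (_ : (fun _ => _) = (fun u => (homogenize a u 0 b)^-1 : K) *
    (fun u => (homogenize a u 0 b)^-1 ^+ e : K)); first exact: differentiableM.
  by apply/funext => w'; rewrite exprS.
- by rewrite expf_neq0// invr_eq0.
Qed.

End ChartFieldOverlap.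

Section ProjectiveFoliationTheory.
Variables (R : realType) (n d : nat).
Local Notation K := (CC R).
Variables (Y : 'I_n -> mpoly n K) (H : 'I_n -> mpoly n.+1 K).
Hypothesis hH : forall i, homogeneous d.+1 (H i).
Hypothesis eH : forall i u, poly_eval (H i) (homogenize ord0 u) = poly_eval (Y i) u.
Implicit Types (a b : 'I_n.+1) (u v w : 'rV[K]_n).
Local Notation X := (projective_space K n).
Local Notation F := (projective_foliation H).

Lemma CP_cover (p : CP K n) : exists i u, CP_chart i u = p.
Proof.
have [v <-] := CP_point_surj p.
have /set_mem/eqP v0 := valP v.
have [j vj] : exists j, set_val v 0 j != 0.
  apply/not_existsP => h; apply: v0; apply/rowP => j; rewrite mxE.
  by have := h j; rewrite set_valE => /negP; rewrite negbK => /eqP.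
by have [u [_ ->]] := CP_point_chart vj; exists j, u.
Qed.

(** The components in chart a are polynomials. If all were zero, the field would vanish wherever
    chart a meets the affine chart, forcing q * Y i = 0. *)
Lemma chart_field_nonvanishing a (W : set 'rV[K]_n) : (exists i, Y i != 0) ->
  open W -> W !=set0 -> exists2 u, W u & chart_field H a u != 0.
Proof.
move=> [i Yi] oW [u0 Wu0]; have [r r0 hW] := open_near oW Wu0.
have [V VE] := chart_field_poly H a.
have [k Vk] : exists k, V k != 0.
  apply/not_existsP => h; have [q q0 qE] := homogenize_coord_poly R ord0 a.
  have qY : q * Y i != 0 by rewrite mulf_neq0.
  have [u _] := poly_nonvanishing 0 (@ltr01 R) qY.
  rewrite poly_evalM qE mulf_eq0 negb_or => /andP[h0] /eqP; apply; rewrite -eH.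
  apply: (chart_field_vanish hH h0); rewrite VE; apply/rowP => k; rewrite !mxE.
  by have /negP := h k; rewrite negbK => /eqP ->; rewrite poly_eval0.
have [u hu Vu] := poly_nonvanishing u0 r0 Vk; exists u; first exact: hW.
by apply: contraNneq Vu; rewrite VE => /rowP/(_ k); rewrite !mxE => ->.
Qed.

Lemma projective_foliationP : (exists i, Y i != 0) -> is_foliation F.
Proof.
move=> Y0; split.
- by move=> p; have [i [u <-]] := CP_cover p; exists i, u.
- move=> a; split; first exact: openT.
  rewrite -[fol_field _]/(chart_field H a); have [V ->] := chart_field_poly H a.
  exact: holomorphic_poly_map.
- move=> a W oW W0 _; exact: chart_field_nonvanishing.
exact: chart_field_overlap.
Qed.

End ProjectiveFoliationTheory.

(** * Tangency and density on projective space *)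

Section ProjectiveLegendrian.
Variables (R : realType) (n d : nat).
Local Notation K := (CC R).
Variables (Y : 'I_n -> mpoly n K) (H : 'I_n -> mpoly n.+1 K).
Hypothesis hH : forall i, homogeneous d.+1 (H i).
Hypothesis eH : forall i u, poly_eval (H i) (homogenize ord0 u) = poly_eval (Y i) u.
Implicit Types (a b : 'I_n.+1) (u v w : 'rV[K]_n).
Local Notation X := (projective_space K n).

Lemma hyperplane_scale (xi : 'I_n.+1 -> 'rV[K]_n -> set 'rV[K]_n) i u c v :
  @hyperplane_distribution K n X xi -> xi i u v -> xi i u (c *: v).
Proof.
move=> [_ /(_ i u)[W [al [_ Wu _ /(_ u Wu)[_ ->]]]]] /= h.
under eq_bigr do rewrite mxE mulrCA.
by rewrite -mulr_sumr h mulr0.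
Qed.

Lemma legendrian_affine (xi : 'I_n.+1 -> 'rV[K]_n -> set 'rV[K]_n) a u :
  @hyperplane_distribution K n X xi ->
  (forall u, xi ord0 u (\row_k poly_eval (Y k) u)) ->
  homogenize a u 0 ord0 != 0 -> xi a u (chart_field H a u).
Proof.
move=> hxi hY h0; apply/(hxi.1 a ord0 u); first exact/range_chart.
have := chart_field_transition hH h0; set g := _ ^+ d => E.
have g0 : g != 0 by apply: expf_neq0; exact: invr_neq0.
have := hY (@transition K n X a ord0 u); rewrite -(chart_field_ord0 eH) E.
by move=> /(hyperplane_scale g^-1 hxi); rewrite scalerA mulVf// scale1r.
Qed.

Lemma projective_legendrian (xi : 'I_n.+1 -> 'rV[K]_n -> set 'rV[K]_n) :
  @hyperplane_distribution K n X xi ->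
  (forall u, xi ord0 u (\row_k poly_eval (Y k) u)) ->
  legendrian_on (projective_foliation H) setT xi.
Proof.
move=> hxi hY a u _ _; rewrite -/(chart_field H a u).
have [W [al [oW Wu hal alE]]] := hxi.2 a u.
rewrite (alE u Wu).2 /=; apply: contrapT => /eqP h.
pose phi w : K := \sum_k al w 0 k * chart_field H a w 0 k.
have [V VE] := chart_field_poly H a.
have dphi : differentiable phi u.
  rewrite (_ : phi = \sum_k (fun w => al w 0 k : K) * (fun w => poly_eval (V k) w : K)).
    apply: differentiable_sum => k; apply: differentiableM; last exact: differentiable_poly_eval.
    exact: (differentiable_comp (hal u Wu) (differentiable_coord _ _ _)).
  by apply/funext => w; rewrite fct_sumE; apply: eq_bigr => k _; rewrite VE mxE.
have [r r0 hr] : exists2 r : R, 0 < r &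
    forall v, (forall i, modulus (v 0 i - u 0 i) < r) -> phi v != 0.
  have cphi : {for u, continuous phi} := differentiable_continuous dphi.
  apply/nbhs_row; apply: (cphi [set x : K | x != 0]).
  by apply/nbhs_modulus; exists (modulus (phi u)); [rewrite modulus_gt0|move=> y;
    apply: contraTneq => ->; rewrite sub0r modulusN ltxx].
have [r' r'0 hr'] := open_near oW Wu.
(* In chart a the hyperplane at infinity is the zero set of q, so every neighbourhood of u contains
   points of the affine chart. *)
have [q q0 qE] := homogenize_coord_poly R a ord0.
have m0 : 0 < Num.min r r' by rewrite lt_min r0.
have [v hv qv] := poly_nonvanishing u m0 q0.
have Wv : W v by apply: hr' => i; have := hv i; rewrite lt_min => /andP[].
have vr i : modulus (v 0 i - u 0 i) < r by have := hv i; rewrite lt_min => /andP[].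
have /eqP := hr v vr; apply.
have : xi a v (chart_field H a v) by apply: legendrian_affine => //; rewrite -qE.
by rewrite (alE v Wv).2.
Qed.

End ProjectiveLegendrian.

Section ProjectiveDensity.
Variables (R : realType) (n d : nat).
Local Notation K := (CC R).
Variables (Y : 'I_n -> mpoly n K) (H : 'I_n -> mpoly n.+1 K).
Hypothesis eH : forall i u, poly_eval (H i) (homogenize ord0 u) = poly_eval (Y i) u.
Implicit Types (u w : 'rV[K]_n).
Local Notation X := (projective_space K n).
Local Notation F := (projective_foliation H).

Lemma same_leaf_projective u w : same_leaf Y u w ->
  Relation_Operators.clos_refl_sym_trans _ (@fol_step K n X F) (CP_chart ord0 u) (CP_chart ord0 w).
Proof.
elim=> {u w} [u w|u|u w _|u v w _ h1 _ h2]; last 3 first.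
- exact: Relation_Operators.rst_refl.
- exact: Relation_Operators.rst_sym.
- exact: Relation_Operators.rst_trans h1 h2.
move=> [[] [gamma [r [t [hg tr /= <- <-]]]]]; apply: Relation_Operators.rst_step.
exists ord0, gamma, r, t; split=> // s /hg[_ dg]; split=> //.
by rewrite -[fol_field _]/(chart_field H ord0) (chart_field_ord0 eH).
Qed.

Lemma projective_generic_leaf (G : mpoly n K) : G != 0 ->
  (forall u (v : 'rV[K]_n) (r : R), poly_eval G u != 0 -> 0 < r ->
     exists2 w, same_leaf Y u w & forall i, modulus (w 0 i - v 0 i) < r) ->
  generic_leaf_dense F.
Proof.
move=> G0 Gd; have [e [P [hP eP]]] := homogenization G.
(* The factor Z_0 puts the hyperplane at infinity into the exceptional set, so that every other
   point lies in the affine chart. *)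
pose B : mpoly n.+1 K := mvar K ord0 ^+ 1 * P.
have hB : homogeneous (1 + e) B := homogeneous_raise 1 hP.
have eB u : poly_eval B (homogenize ord0 u) = poly_eval G u by rewrite raise_homogenize eP.
have B0 Z : poly_eval B Z != 0 -> Z 0 ord0 != 0.
  by rewrite poly_evalM expr1 poly_eval_var mulf_eq0 negb_or => /andP[].
clearbody B.
(* Stated for all representatives; B being homogeneous, a single one decides. *)
pose A : set (CP K n) := [set p | forall v : nonzero_vectors K n, CP_point v = p -> poly_eval B (set_val v) = 0].
have AP (v : nonzero_vectors K n) : A (CP_point v) <-> poly_eval B (set_val v) = 0.
  split=> [/(_ v erefl)//|h v' /esym/CP_point_eq[c ->]].
  by rewrite hB h mulr0.
have Achart i u : A (CP_chart i u) <-> poly_eval B (homogenize i u) = 0.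
  by rewrite -CP_point_hvector -set_val_hvector; exact: AP.
exists A; split.
- rewrite -openC; apply/CP_openP.
  exists (~` [set Z | poly_eval B Z = 0]); first exact/closed_openC/poly_zeros_closed.
  by move=> v; split=> h /AP.
- move=> i u; have [p hp] := dehomogenization i B.
  have [W [k [f [oW Wu hf fE]]]] := poly_zeros_analytic p tt u.
  exists W, k, f; split=> // w /fE /= <-; rewrite hp; exact: Achart.
- have [u _ gu] := poly_nonvanishing 0 (@ltr01 R) G0.
  apply/eqP => AT; have : A (CP_chart ord0 u) by rewrite AT.
  by move/Achart; rewrite eB => /eqP; apply/negP.
move=> L [p _ ->] [q [pq /= Aq]] T [y Ty] oT.
have [v vq] := CP_point_surj q.
have Bv : poly_eval B (set_val v) != 0 by apply/eqP => h; apply: Aq; rewrite -vq; exact/AP.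
have [u [uE uq]] := CP_point_chart (B0 _ Bv).
have gu : poly_eval G u != 0.
  by apply: contraNneq Bv => h; rewrite uE hB eB h mulr0.
have [U oU UT] := (CP_openP T).1 oT.
have [v1 v1y] := CP_point_surj y.
have Uv1 : U (set_val v1) by apply/UT; rewrite v1y.
have [r r0 hU] := open_near oU Uv1.
have X0 : mvar K ord0 != 0 :> mpoly n.+1 K.
  have : poly_eval (mvar K ord0) (const_mx 1 : 'rV[K]_n.+1) != 0.
    by rewrite poly_eval_var mxE oner_neq0.
  by apply: contraNneq => ->; rewrite poly_eval0.
(* The target y may lie at infinity; it is replaced by a nearby point of the affine chart inside the
   same open set. *)
have [Z hZ Z0] := poly_nonvanishing (set_val v1) r0 X0.
rewrite poly_eval_var in Z0.
have Zn : Z \in nonzero_vectors K n.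
  by apply/mem_set; apply: contraNneq Z0 => ->; rewrite mxE.
pose v2 : nonzero_vectors K n := exist _ Z Zn.
have v2E : set_val v2 = Z by rewrite set_valE.
have [|u2 [_ u2E]] := @CP_point_chart _ _ v2 ord0; first by rewrite v2E.
have Uu2 : U (homogenize ord0 u2).
  rewrite -set_val_hvector; apply/UT; rewrite CP_point_hvector -u2E.
  by apply/UT; rewrite v2E; exact: hU.
have [r2 r20 hU2] := open_near oU Uu2.
have [w uw hw] := Gd u u2 r2 gu r20.
exists (CP_chart ord0 w); split.
  rewrite -CP_point_hvector; apply/UT; rewrite set_val_hvector; apply: hU2 => i.
  rewrite !mxE; case: unliftP => [k _|_]; first exact: hw.
  by rewrite subrr modulus0.
apply: Relation_Operators.rst_trans pq _; rewrite -vq uq.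
exact: same_leaf_projective.
Qed.

End ProjectiveDensity.

(** * The contact distribution *)

Section ContactForm.
Variables (K : numClosedFieldType) (m : nat).

Lemma contact_x_lt (k : 'I_m) : (k.*2 < m.*2)%N.
Proof. by rewrite ltn_double. Qed.
Lemma contact_y_lt (k : 'I_m) : (k.*2.+1 < m.*2)%N.
Proof. by rewrite -doubleS leq_double. Qed.
Definition contact_x k : 'I_m.*2 := Ordinal (contact_x_lt k).
Definition contact_y k : 'I_m.*2 := Ordinal (contact_y_lt k).

Lemma contact_x_eq k l : (contact_x k == contact_x l) = (k == l).
Proof. by rewrite -val_eqE /= (inj_eq double_inj). Qed.
Lemma contact_y_eq k l : (contact_y k == contact_y l) = (k == l).
Proof. by rewrite -val_eqE /= eqSS (inj_eq double_inj). Qed.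
Lemma contact_xy k l : (contact_x k == contact_y l) = false.
Proof. by rewrite -val_eqE /=; apply/eqP => /(congr1 odd); rewrite /= !odd_double. Qed.

(** The indicators give y_k at the index of x_k and - x_k at that of y_k without a case distinction
    on the parity of i. *)
Definition contact_coef i : mpoly m.*2 K := \sum_(k < m)
  ((i == contact_x k)%:R * mvar K (contact_y k) - (i == contact_y k)%:R * mvar K (contact_x k)).

Lemma contact_coef_x k : contact_coef (contact_x k) = mvar K (contact_y k).
Proof.
rewrite /contact_coef (bigD1 k)//= contact_x_eq eqxx contact_xy mul1r mul0r subr0.
rewrite big1 ?addr0// => l lk; rewrite contact_x_eq [k == l]eq_sym (negbTE lk) contact_xy.
by rewrite !mul0r subr0.
Qed.
Lemma contact_coef_y k : contact_coef (contact_y k) = - mvar K (contact_x k).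
Proof.
rewrite /contact_coef (bigD1 k)//= contact_y_eq eqxx eq_sym contact_xy mul1r mul0r sub0r.
rewrite big1 ?addr0// => l lk; rewrite contact_y_eq [k == l]eq_sym (negbTE lk) eq_sym contact_xy.
by rewrite !mul0r subr0.
Qed.

Lemma contact_coef_sum (P : 'I_m.*2 -> mpoly m.*2 K) : \sum_i contact_coef i * P i =
  \sum_(k < m) (mvar K (contact_y k) * P (contact_x k) - mvar K (contact_x k) * P (contact_y k)).
Proof.
under eq_bigr do rewrite mulr_suml.
rewrite exchange_big /=; apply: eq_bigr => k _.
under eq_bigr do rewrite mulrBl; rewrite sumrB; congr (_ - _).
  by rewrite (bigD1 (contact_x k))//= eqxx mul1r big1 ?addr0// => i /negbTE ->; rewrite !mul0r.
by rewrite (bigD1 (contact_y k))//= eqxx mul1r big1 ?addr0// => i /negbTE ->; rewrite !mul0r.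
Qed.

(** The curvature in the plane (x_k, y_k) is the constant 2, so any base point will do. *)
Lemma contact_nonclosed (k : 'I_m) (u : 'rV[K]_m.*2) :
  poly_eval ((grad_numer contact_coef 1 (contact_x k) (contact_y k) -
    grad_numer contact_coef 1 (contact_y k) (contact_x k)) * 1) u != 0.
Proof.
rewrite mulr1 /grad_numer contact_coef_x contact_coef_y.
have d1 i : mderiv i (1 : mpoly m.*2 K) = 0 by rewrite -mpolyC1 mderivC.
have dX i : mderiv i (mvar K i) = 1 by rewrite mderiv_var eqxx.
rewrite !d1 !mulr0 !subr0 mderivN !dX !mulr1 opprK.
by rewrite poly_evalD poly_eval1 -[1 + 1]/(2%:R) pnatr_eq0.
Qed.

End ContactForm.

Section ContactFoliation.
Variables (R : realType) (m : nat).
Local Notation K := (CC R).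

Lemma contact_lift_field (P : 'I_m.*2 -> mpoly m.*2 K) xi u :
  @is_contact_distribution K m xi ->
  xi ord0 u (\row_k poly_eval (lift_field (contact_coef K (m:=m)) P 1 k) u).
Proof.
move=> [_ ->] /=; rewrite mxE lift_field_max contact_coef_sum poly_eval_sum.
apply: eq_bigr => k _.
have ex : inord k.*2 = lift ord_max (contact_x k) :> 'I_m.*2.+1.
  by rewrite -widen_lift; apply: val_inj; rewrite /= inordK// ltnS ltnW// contact_x_lt.
have ey : inord k.*2.+1 = lift ord_max (contact_y k) :> 'I_m.*2.+1.
  by rewrite -widen_lift; apply: val_inj; rewrite /= inordK// ltnS ltnW// contact_y_lt.
rewrite !mxE ex ey !lift_field_lift !mul1r poly_evalB !poly_evalM !poly_eval_var.
by rewrite !mxE !widen_lift.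
Qed.

Lemma contact_legendrian xi : (1 <= m)%N -> @is_contact_distribution K m xi ->
  exists F : foliation (projective_space K m.*2.+1),
    [/\ is_foliation F, legendrian_on F setT xi & generic_leaf_dense F].
Proof.
move=> m1 hxi; pose k : 'I_m := Ordinal m1; pose N := contact_coef K (m:=m).
pose a := contact_x k; pose b := contact_y k.
have ab : a != b by rewrite /a /b contact_xy.
have [Q0 D0] := grad_numer_neq (contact_nonclosed k (0 : 'rV[K]_m.*2)).
(* The contact form has polynomial coefficients: the denominator is 1 and the base point eta can be
   the origin. *)
pose Y := dense_field a b 0 N 1.
have [d [H hH]] := homogenization_family Y.
have hH1 i : homogeneous d.+1 (H i) := (hH i).1.
have eH i u : poly_eval (H i) (homogenize ord0 u) = poly_eval (Y i) u := (hH i).2 u.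
have G0 := bad_locus_neq0 a Q0.
exists (projective_foliation H); split.
- apply: (projective_foliationP hH1 eH); exists (lift ord_max a).
  by rewrite /Y dense_field_lift.
- by apply: (projective_legendrian hH1 eH hxi.1) => u; exact: contact_lift_field.
- apply: (projective_generic_leaf eH G0) => u v r; exact: same_leaf_dense.
Qed.

End ContactFoliation.

Theorem corollary2 (R : realType) :
  (forall (M : nat) (omega : rational_form (CC R) M),
     (2 <= M)%N -> ~ closed_form omega ->
     exists Y : 'I_M.+1 -> mpoly M.+1 (CC R),
       [/\ exists i, Y i != 0,
           legendrian_on (generated Y) (off_poles omega)
             (graph_distribution omega) &
           generic_leaf_dense (generated Y)]) /\
  (forall (m : nat)
     (xi : 'I_m.*2.+2 -> 'rV[CC R]_m.*2.+1 -> set 'rV[CC R]_m.*2.+1),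
     (1 <= m)%N -> is_contact_distribution xi ->
     exists F : foliation (projective_space (CC R) m.*2.+1),
       [/\ is_foliation F, legendrian_on F setT xi & generic_leaf_dense F]).
Proof.
split=> [M omega _|m xi]; [exact: rational_legendrian|exact: contact_legendrian].
Qed.
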